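(* Consider the problem $\min_{x\in\mathcal X}F(x)$, $F(x)=\frac1n\sum_{i=1}^n f_i(g_i(x))+r(x)$, under the standing assumptions (A1)-(A4) listed in the context (with $\mu\ge0$; $f_i$ is not assumed to be smooth), and suppose in addition that each $g_i$ is smooth. Let $x_*$ be a minimizer of $F$ over $\mathcal X$. Run ALEXR (described in the context) with $\psi_i=\frac12\|\cdot\|_2^2$, $\theta=1$, and suitable $\eta=O(\frac1\epsilon)$, $\tau=O(\frac1{B\epsilon})$. Then $\mathbb E[F(\bar x_T)-F(x_* )]\le\epsilon$ holds after $$T=O\left(\max\left\{\frac1S,\frac{\Omega_{\mathcal Y}^0}{BS}\right\}\epsilon^{-2}\right)$$ iterations, where $\bar x_T=\frac1T\sum_{t=0}^{T-1}x_{t+1}$, $\Omega_{\mathcal Y}^0=\mathbb E[U_\psi(\tilde y_T,y_0)]=\sum_{i=1}^n\mathbb E[U_{\psi_i}(\tilde y_T^{(i)},y_0^{(i)})]$, and $\tilde y_T^{(i)}\in\arg\max_{v\in\mathcal Y_i}\{v^\top g_i(\bar x_T)-f_i^*(v)\}$.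
   Context: **Problem.** $\mathcal X\subseteq\mathbb R^d$, $g_i:\mathcal X\to\mathbb R^m$ with $g_i(x)=\mathbb E_{\zeta_i\sim\mathbb P_i}[g_i(x;\zeta_i)]$, $f_i:\mathbb R^m\to\mathbb R$ deterministic, $i\in[n]=\{1,\dots,n\}$. The norm on $\mathcal X$ is $\|\cdot\|_2$; $\mathbb R^m$ carries a norm $\|\cdot\|$ (dual variables) with dual norm $\|\cdot\|_*$ (values of $g_i$). $f_i^*$ is the convex conjugate of $f_i$, and $\mathcal Y_i=\mathrm{dom} f_i^*\subset\mathbb R^m$, regarded as a convex compact set, so that $f_i(u)=\max_{v\in\mathcal Y_i}\{v^\top u-f_i^*(v)\}$; $\mathcal Y=\mathcal Y_1\times\dots\times\mathcal Y_n\subset\mathbb R^{nm}$, and $y^{(i)}\in\mathbb R^m$ is the $i$-th block of $y\in\mathbb R^{nm}$. **Standing assumptions.** (A1) $\mathcal X$ is closed and convex; $r$ is proper, lower semicontinuous and $\mu$-convex on $\mathcal X$ ($\mu\ge0$), i.e. $r-\frac\mu2\|\cdot\|_2^2$ is convex. (A2) Each $g_i$ is convex (coordinatewise) and $\|g_i(x)-g_i(x')\|_*\le C_g\|x-x'\|_2$ for all $x,x'\in\mathcal X$. (A3) Each $f_i$ is convex and $|f_i(u)-f_i(u')|\le C_f\|u-u'\|_*$ for all $u,u'$. If $g_i$ is not affine, $f_i$ is non-decreasing in each coordinate of its input. (Consequently $\|y^{(i)}\|\le C_f$ on $\mathcal Y_i$, and $\mathcal Y_i\subseteq\mathbb R^m_+$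 in the monotone case.) (A4) There are finite $\sigma_0^2,\sigma_1^2,\delta^2$ such that for all $x\in\mathcal X$, $g_i'(x)\in\partial g_i(x)$, $y\in\mathcal Y$: $\mathbb E_{\zeta_i}\|g_i(x)-g_i(x;\zeta_i)\|_*^2\le\sigma_0^2$; $\mathbb E_{\zeta_i}\|[g_i'(x)]^\top-[g_i'(x;\zeta_i)]^\top\|_{\rm op}^2\le\sigma_1^2$; $\frac1n\sum_{j=1}^n\|[g_j'(x)]^\top y^{(j)}-\frac1n\sum_{i=1}^n[g_i'(x)]^\top y^{(i)}\|_2^2\le\delta^2$. The stochastic (sub)gradients $g_i'(x;\zeta_i)$ are unbiased. **Smoothness.** $g_i$ is ($L_g$-)smooth if it is differentiable and there is $L_g>0$ with $\|g_i(x_1)-g_i(x_2)-\nabla g_i(x_2)(x_1-x_2)\|_*\le\frac{L_g}2\|x_1-x_2\|_2^2$ for all $x_1,x_2\in\mathcal X$. **Bregman divergences.** $U_{\psi_i}(u,v)=\psi_i(u)-\psi_i(v)-\langle\nabla\psi_i(v),u-v\rangle$, and $U_\psi(y_1,y_2)=\sum_{i=1}^nU_{\psi_i}(y_1^{(i)},y_2^{(i)})$; for $\psi_i=\frac12\|\cdot\|_2^2$ one has $U_{\psi_i}(u,v)=\frac12\|u-v\|_2^2$. **Algorithm ALEXR.** Parameters $\eta,\tau>0$, $\theta\in[0,1]$, batch sizes $S,B$. Start from $x_{-1}=x_0\in\mathcal X$, $y_0\in\mathcal Y$. For $t=0,1,\dots,T-1$: sample uniformly $\mathcal S_t\subset[n]$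 with $|\mathcal S_t|=S$; for each $i\in\mathcal S_t$ draw two independent i.i.d. mini-batches $\mathcal B_t^{(i)},\tilde{\mathcal B}_t^{(i)}$ of size $B$ from $\mathbb P_i$ (mini-batch estimators are averages over the batch), set $\tilde g_t^{(i)}=g_i(x_t;\mathcal B_t^{(i)})+\theta\,(g_i(x_t;\mathcal B_t^{(i)})-g_i(x_{t-1};\mathcal B_t^{(i)}))$, $y_{t+1}^{(i)}=\arg\max_{v\in\mathcal Y_i}\{v^\top\tilde g_t^{(i)}-f_i^*(v)-\tau U_{\psi_i}(v,y_t^{(i)})\}$; for $i\notin\mathcal S_t$ set $y_{t+1}^{(i)}=y_t^{(i)}$. Then set $G_t=\frac1S\sum_{i\in\mathcal S_t}[g_i'(x_t;\tilde{\mathcal B}_t^{(i)})]^\top y_{t+1}^{(i)}$ with $g_i'(x_t;\tilde{\mathcal B}_t^{(i)})\in\partial g_i(x_t;\tilde{\mathcal B}_t^{(i)})$, and $x_{t+1}=\arg\min_{x\in\mathcal X}\{\langle G_t,x\rangle+r(x)+\frac\eta2\|x-x_t\|_2^2\}$. Independence holds across iterations and indices. **Asymptotic convention.** The iteration bound means: there is a constant $C$ independent of $n,S,B,\epsilon$ (but possibly depending on $C_f,C_g,L_g,\sigma_0,\sigma_1,\delta$, norm-equivalence constants, and the distance of $x_0$ to $x_*$) such that, for all sufficiently small $\epsilon$ (lower-order terms in $1/\epsilon$ being suppressed), the accuracy is attained whenever $T\ge C\max\{1/S,\Omega_{\mathcal Y}^0/(BS)\}\epsilon^{-2}$, where $\Omega^0_{\mathcal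 Y}$ is the quantity associated with that run. In the choices $\eta=O(1/\epsilon)$, $\tau=O(1/(B\epsilon))$ the hidden constants may depend on the problem parameters. *)

(* Defs.v *)
(* Points of R^k are row vectors.  Accordingly the derivative of a map
   R^d -> R^m is a matrix A : 'M_(d, m) acting by h |-> h *m A (the convention
   of the library's jacobian), and [g'(x)]^T y is y *m A^T. *)
From HB Require Import structures.
From mathcomp Require Import all_boot all_order all_algebra.
From mathcomp Require Import all_classical all_reals all_analysis.

Set Implicit Arguments.
Unset Strict Implicit.
Unset Printing Implicit Defensive.

Import Order.TTheory GRing.Theory Num.Theory.
Import numFieldNormedType.Exports.

Local Open Scope classical_set_scope.
Local Open Scope ring_scope.

Section Vectors.
Context {R : realType}.

Definition dotv k (u v : 'rV[R]_k) : R := \sum_(j < k) u 0 j * v 0 j.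

Definition norm2 k (u : 'rV[R]_k) : R := Num.sqrt (dotv u u).

Definition is_norm k (N : 'rV[R]_k -> R) : Prop :=
  [/\ forall u v, N (u + v) <= N u + N v,
      forall (c : R) u, N (c *: u) = `|c| * N u
    & forall u, N u = 0 -> u = 0].

Definition dual_norm k (N : 'rV[R]_k -> R) (u : 'rV[R]_k) : R :=
  sup [set dotv v u | v in [set v | N v <= 1]].

(* Operator norm of v |-> v *m A from (R^m, N) to (R^d, norm2). *)
Definition op_norm d m (N : 'rV[R]_m -> R) (A : 'M[R]_(m, d)) : R :=
  sup [set norm2 (v *m A) | v in [set v | N v <= 1]].

Definition norm_equiv k (a b : R) (N : 'rV[R]_k -> R) : Prop :=
  forall u, a * norm2 u <= N u <= b * norm2 u.

End Vectors.

Section ConvexAnalysis.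
Context {R : realType}.

Definition conjugate k (f : 'rV[R]_k -> R) (v : 'rV[R]_k) : \bar R :=
  ereal_sup [set (dotv v u - f u)%:E | u in setT].

Definition edom k (phi : 'rV[R]_k -> \bar R) : set 'rV[R]_k :=
  [set v | (phi v < +oo)%E].

Definition proper_on k (X : set 'rV[R]_k) (r : 'rV[R]_k -> \bar R) : Prop :=
  (forall x, X x -> r x != -oo%E) /\ exists2 x, X x & (r x < +oo)%E.

Definition lsc_on k (X : set 'rV[R]_k) (r : 'rV[R]_k -> \bar R) : Prop :=
  forall x, X x -> forall a : R, (a%:E < r x)%E ->
    \forall y \near within X (nbhs x), (a%:E < r y)%E.

Definition econvex_on k (X : set 'rV[R]_k) (r : 'rV[R]_k -> \bar R) : Prop :=
  forall x y (t : R), X x -> X y -> 0 <= t <= 1 ->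
    (r (t *: x + (1 - t) *: y)%R <= t%:E * r x + (1 - t)%:E * r y)%E.

Definition strongly_convex_on k (X : set 'rV[R]_k) (mu : R)
    (r : 'rV[R]_k -> \bar R) : Prop :=
  econvex_on X (fun x => r x - (mu / 2 * norm2 x ^+ 2)%:E)%E.

Definition argmin_on k (X : set 'rV[R]_k) (phi : 'rV[R]_k -> \bar R)
    (x : 'rV[R]_k) : Prop :=
  X x /\ forall x', X x' -> (phi x <= phi x')%E.

Definition argmax_on k (X : set 'rV[R]_k) (phi : 'rV[R]_k -> \bar R)
    (x : 'rV[R]_k) : Prop :=
  X x /\ forall x', X x' -> (phi x' <= phi x)%E.

(* A \in \partial g(x) for g : X -> R^m, row by row. *)
Definition subgradient d m (X : set 'rV[R]_d) (g : 'rV[R]_d -> 'rV[R]_m)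
    (x : 'rV[R]_d) (A : 'M[R]_(d, m)) : Prop :=
  forall x', X x' -> forall k, g x 0 k + ((x' - x) *m A) 0 k <= g x' 0 k.

(* Derivative of a map that is only given on X: the remainder is tested along
   points of X.  When x is interior to X this is the Frechet derivative. *)
Definition is_jacobian_on d m (X : set 'rV[R]_d) (g : 'rV[R]_d -> 'rV[R]_m)
    (x : 'rV[R]_d) (A : 'M[R]_(d, m)) : Prop :=
  forall e : R, 0 < e ->
    \forall x' \near within X (nbhs x),
      `|g x' - g x - (x' - x) *m A| <= e * `|x' - x|.

Definition affine_on d m (X : set 'rV[R]_d) (g : 'rV[R]_d -> 'rV[R]_m) : Prop :=
  exists (A : 'M[R]_(d, m)) (c : 'rV[R]_m), forall x, X x -> g x = x *m A + c.

Definition coord_nondecreasing m (f : 'rV[R]_m -> R) : Prop :=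
  forall u u' : 'rV[R]_m, (forall k, u 0 k <= u' 0 k) -> f u <= f u'.

Definition gradient k (psi : 'rV[R]_k -> R) (v : 'rV[R]_k) : 'rV[R]_k :=
  \row_j 'D_(delta_mx 0 j) (psi : 'rV[R]_k -> R^o) v.

Definition bregman k (psi : 'rV[R]_k -> R) (u v : 'rV[R]_k) : R :=
  psi u - psi v - dotv (gradient psi v) (u - v).

Definition half_sqnorm k (u : 'rV[R]_k) : R := 2^-1 * norm2 u ^+ 2.

End ConvexAnalysis.

(* The maps are total, but only their values on X matter.  [ginner' i x] is the
   (sub)gradient g_i'(x), [soracle i x z] is g_i(x; z) and [soracle' i x z] is
   the stochastic (sub)gradient g_i'(x; z), where z ~ [zlaw i]. *)
Record fcco (R : realType) (d m n : nat) := Fcco {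
  X : set 'rV[R]_d ;
  reg : 'rV[R]_d -> \bar R ;
  fouter : 'I_n -> 'rV[R]_m -> R ;
  ginner : 'I_n -> 'rV[R]_d -> 'rV[R]_m ;
  ginner' : 'I_n -> 'rV[R]_d -> 'M[R]_(d, m) ;
  zdisp : 'I_n -> measure_display ;
  Z : forall i : 'I_n, measurableType (zdisp i) ;
  zlaw : forall i : 'I_n, probability (Z i) R ;
  soracle : forall i : 'I_n, 'rV[R]_d -> Z i -> 'rV[R]_m ;
  soracle' : forall i : 'I_n, 'rV[R]_d -> Z i -> 'M[R]_(d, m) }.

Arguments soracle {R d m n} _ i x z.
Arguments soracle' {R d m n} _ i x z.

Section Assumptions.
Context {R : realType} {d m n : nat} (pb : fcco R d m n).

Definition Ydom (i : 'I_n) : set 'rV[R]_m := edom (conjugate (fouter pb i)).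

Definition objective (x : 'rV[R]_d) : \bar R :=
  ((n%:R^-1 * \sum_(i < n) fouter pb i (ginner pb i x))%:E + reg pb x)%E.

Definition assumption_domain (mu : R) : Prop :=
  [/\ closed (X pb), convex_set (X pb), proper_on (X pb) (reg pb),
      lsc_on (X pb) (reg pb)
    & 0 <= mu /\ strongly_convex_on (X pb) mu (reg pb)].

Definition assumption_inner (N : 'rV[R]_m -> R) (Cg : R) : Prop :=
  forall i : 'I_n,
    (forall k, convex_function (X pb) (fun x => ginner pb i x 0 k)) /\
    (forall x x', X pb x -> X pb x' ->
       dual_norm N (ginner pb i x - ginner pb i x') <= Cg * norm2 (x - x')).

Definition assumption_outer (N : 'rV[R]_m -> R) (Cf : R) : Prop :=
  forall i : 'I_n,
    [/\ convex_function setT (fouter pb i),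
        forall u u', `|fouter pb i u - fouter pb i u'| <=
                     Cf * dual_norm N (u - u'),
        ~ affine_on (X pb) (ginner pb i) -> coord_nondecreasing (fouter pb i)
      & compact (Ydom i)].

(* Row vectors carry no sigma-algebra in the library, hence the detour through
   d.-tuple R for joint measurability in (x, z). *)
Definition oracle_measurable : Prop :=
  forall i : 'I_n,
    let D := [set p : d.-tuple R * Z pb i | X pb (\row_j tnth p.1 j)] in
    (forall k, measurable_fun D
       (fun p => soracle pb i (\row_j tnth p.1 j) p.2 0 k)) /\
    (forall l k, measurable_fun D
       (fun p => soracle' pb i (\row_j tnth p.1 j) p.2 l k)).

Definition has_mean i (h : Z pb i -> R) (c : R) : Prop :=
  (zlaw pb i).-integrable setT (EFin \o h) /\
  (\int[zlaw pb i]_z (h z)%:E = c%:E)%E.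

Definition oracle_unbiased : Prop :=
  forall (i : 'I_n) x, X pb x ->
    (forall k, has_mean (fun z => soracle pb i x z 0 k) (ginner pb i x 0 k)) /\
    (forall l k, has_mean (fun z => soracle' pb i x z l k) (ginner' pb i x l k)).

Definition oracle_subgradient : Prop :=
  forall (i : 'I_n) x, X pb x ->
    subgradient (X pb) (ginner pb i) x (ginner' pb i x) /\
    forall z, subgradient (X pb) (soracle pb i ^~ z) x (soracle' pb i x z).

Definition assumption_variance (N : 'rV[R]_m -> R) (s0 s1 delta : R) : Prop :=
  forall x, X pb x ->
    [/\ forall i : 'I_n,
          (\int[zlaw pb i]_z
             ((dual_norm N (ginner pb i x - soracle pb i x z)) ^+ 2)%:E
           <= (s0 ^+ 2)%:E)%E,
        forall i : 'I_n,
          (\int[zlaw pb i]_z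
             ((op_norm N ((ginner' pb i x)^T - (soracle' pb i x z)^T)) ^+ 2)%:E
           <= (s1 ^+ 2)%:E)%E
      & forall y : 'I_n -> 'rV[R]_m, (forall i, Ydom i (y i)) ->
          n%:R^-1 * \sum_(j < n)
            norm2 (y j *m (ginner' pb j x)^T
                   - n%:R^-1 *: \sum_(i < n) y i *m (ginner' pb i x)^T) ^+ 2
          <= delta ^+ 2].

Definition assumption_oracle (N : 'rV[R]_m -> R) (s0 s1 delta : R) : Prop :=
  [/\ oracle_measurable, oracle_unbiased, oracle_subgradient
    & assumption_variance N s0 s1 delta].

Definition smooth_inner (N : 'rV[R]_m -> R) (Lg : R) : Prop :=
  forall i : 'I_n,
    (forall x, X pb x ->
       is_jacobian_on (X pb) (ginner pb i) x (ginner' pb i x)) /\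
    (forall x1 x2, X pb x1 -> X pb x2 ->
       dual_norm N (ginner pb i x1 - ginner pb i x2
                    - (x1 - x2) *m ginner' pb i x2)
       <= Lg / 2 * norm2 (x1 - x2) ^+ 2).

End Assumptions.

Section Algorithm.
Context {R : realType} {d m n : nat} (pb : fcco R d m n).

Definition minibatch B i (x : 'rV[R]_d) (zs : 'I_B -> Z pb i) : 'rV[R]_m :=
  B%:R^-1 *: \sum_(b < B) soracle pb i x (zs b).

Definition minibatch' B i (x : 'rV[R]_d) (zs : 'I_B -> Z pb i) : 'M[R]_(d, m) :=
  B%:R^-1 *: \sum_(b < B) soracle' pb i x (zs b).

Context {dO : measure_display} {Omega : measurableType dO}
  (P : probability Omega R).

Definition mutually_independent (K : finType) (F : K -> set_system Omega) : Prop :=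
  forall (J : {set K}) (A : K -> set Omega), (forall k, k \in J -> F k (A k)) ->
    fine (P (\bigcap_(k in [set` J]) A k)) = \prod_(k in J) fine (P (A k)).

(* [sel t] is the sampled block set; [bat false t i] and [bat true t i] are the
   two mini-batches of block i at iteration t.  Mini-batches exist
   for every block, but those of blocks outside [sel t] are never used. *)
Definition sample_index (T B : nat) : finType :=
  ('I_T + bool * 'I_T * 'I_n * 'I_B)%type.

Definition sample_events T B (sel : nat -> Omega -> {set 'I_n})
    (bat : bool -> nat -> forall i, Omega -> 'I_B -> Z pb i)
    (k : sample_index T B) : set_system Omega :=
  match k with
  | inl t => [set sel t @^-1` U | U in setT]
  | inr (c, t, i, b) =>
      preimage_set_system setT (fun w => bat c t i w b) measurable
  end.

(* [x t.-1] is x_{t-1}, since x_{-1} = x_0.  Only iterations t < T are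
   constrained. *)
Record alexr_run (psi : 'I_n -> 'rV[R]_m -> R) (eta tau theta : R)
    (Sz Bz T : nat) (x0 : 'rV[R]_d) (y0 : 'I_n -> 'rV[R]_m)
    (sel : nat -> Omega -> {set 'I_n})
    (bat : bool -> nat -> forall i, Omega -> 'I_Bz -> Z pb i)
    (x : nat -> Omega -> 'rV[R]_d)
    (y : nat -> Omega -> 'I_n -> 'rV[R]_m) : Prop := AlexrRun {
  sel_measurable : forall t U, (t < T)%N -> measurable (sel t @^-1` U) ;
  sel_card : forall t w, (t < T)%N -> #|sel t w| = Sz ;
  sel_uniform : forall t (U : {set 'I_n}), (t < T)%N -> #|U| = Sz ->
    P [set w | sel t w = U] = (('C(n, Sz))%:R^-1)%:E ;
  bat_measurable : forall c t i b, (t < T)%N ->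
    measurable_fun setT (fun w => bat c t i w b) ;
  bat_law : forall c t i b (A : set (Z pb i)), (t < T)%N -> measurable A ->
    P [set w | A (bat c t i w b)] = zlaw pb i A ;
  samples_independent : mutually_independent (@sample_events T Bz sel bat) ;
  x_init : forall w, x 0%N w = x0 ;
  y_init : forall w, y 0%N w = y0 ;
  y_step : forall t w i, (t < T)%N -> i \in sel t w ->
    let g1 := minibatch (x t w) (bat false t i w) in
    let g0 := minibatch (x t.-1 w) (bat false t i w) in
    let gt := g1 + theta *: (g1 - g0) in
    argmax_on (Ydom pb i)
      (fun v => (dotv v gt)%:E - conjugate (fouter pb i) v
                - (tau * bregman (psi i) v (y t w i))%:E)%E
      (y t.+1 w i) ;
  y_keep : forall t w i, (t < T)%N -> i \notin sel t w ->
    y t.+1 w i = y t w i ;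
  x_step : forall t w, (t < T)%N ->
    let G := Sz%:R^-1 *: \sum_(i in sel t w)
               y t.+1 w i *m (minibatch' (x t w) (bat true t i w))^T in
    argmin_on (X pb)
      (fun z => (dotv G z)%:E + reg pb z
                + (eta / 2 * norm2 (z - x t w) ^+ 2)%:E)%E
      (x t.+1 w) }.

Definition xbar (x : nat -> Omega -> 'rV[R]_d) (T : nat) (w : Omega) :
    'rV[R]_d :=
  T%:R^-1 *: \sum_(t < T) x t.+1 w.

(* The maximizer need not be unique, so measurability of the selection has to
   be required for E[U_psi(yt, y_0)] to make sense. *)
Definition dual_best_response (x : nat -> Omega -> 'rV[R]_d) (T : nat)
    (yt : Omega -> 'I_n -> 'rV[R]_m) : Prop :=
  (forall i k, measurable_fun setT (fun w => yt w i 0 k)) /\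
  (forall w i, argmax_on (Ydom pb i)
     (fun v => (dotv v (ginner pb i (xbar x T w)))%:E
               - conjugate (fouter pb i) v)%E
     (yt w i)).

Definition OmegaY0 (psi : 'I_n -> 'rV[R]_m -> R)
    (yt : Omega -> 'I_n -> 'rV[R]_m) (y0 : 'I_n -> 'rV[R]_m) : \bar R :=
  'E_P[fun w => \sum_(i < n) bregman (psi i) (yt w i) (y0 i)].

End Algorithm.

(* Main.v *)
(* With yt a maximizer at the averaged iterate, F(xbar) - F(x_star) is at most the
   saddle-point gap of the Lagrangian at (xbar, yt), hence at most the average of
   the one-step gaps.  Let yb_t be the dual step computed for all blocks.  The
   three-point inequality of the two proximal steps telescopes the one-step gaps
   up to three noises: xi = (1 - (n/S) 1[i in S_t]) (yb_t - y_t), from sampling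
   the blocks; nu, the mini-batch error of the extrapolated inner values; and e,
   the error of the stochastic direction G_t.  As yt depends on the whole run,
   xi and nu are not centred against yt - y_t.  One therefore splits yt - y_t =
   (yt - y_0) - (y_t - y_0): the second part has mean zero against the noise, and
   Young's inequality charges the first to |yt - y_0|^2, that is to Omega, and to
   the squared norms of the summed noises, whose increments are orthogonal.  The
   xi part is absorbed by the movement terms |yb_t - y_t|^2, and smoothness of
   g_i by the primal movement for small eps.  Altogether
     E[F(xbar) - F(x_star)] <= 6 tau Omega / (S T) + O(1 / (B tau))
       + O(1 / (eta S)) + eta D^2 / (2 T) + O(1 / (eta T)),
   and eta ~ 1 / (S eps), tau ~ 1 / (B eps) make each term at most eps / 8. *)
Require Import Defs.
From HB Require Import structures.
From mathcomp Require Import all_boot all_order all_algebra perm.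
From mathcomp Require Import all_classical all_reals all_analysis.
From mathcomp Require Import measurable_realfun ring lra.

Set Implicit Arguments.
Unset Strict Implicit.
Unset Printing Implicit Defensive.

Import Order.TTheory GRing.Theory Num.Theory.
Import numFieldNormedType.Exports.

Local Open Scope classical_set_scope.
Local Open Scope ring_scope.

(** The dual step is computed for all blocks because [yb t] depends on the past and on the
    mini-batches of inner values, but not on the set sampled at time [t]. Membership of a block in
    that set is therefore independent of [yb t - y t], which centres [xi] and bounds its second
    moment by n/S times the movement. The remaining obstacles are measure-theoretic. A run does not
    postulate that its iterates are measurable; this is derived from the nonexpansiveness of
    proximal steps, and measurability of g_i and g_i' from their being means of the oracle. The
    derivative g_i' is controlled only along directions that stay in X, so G_t itself need not be
    integrable and only its error is estimated. Conditional expectations are replaced by Fubini: the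
    samples are finitely many, and one of them is integrated out against the sigma-algebra generated
    by all the others. Centring e_t against x_* - x_t requires square-integrable iterates; a crude
    recursion provides this and enters no constant. The threshold on eps may depend on S and B and
    absorbs the lower-order terms, whereas the constant of the rate does not. *)

(** * Euclidean geometry of row vectors *)

Section EuclideanVectors.
Context {R : realType} {k : nat}.
Implicit Types (u v w : 'rV[R]_k) (c : R).

Lemma dotvC u v : dotv u v = dotv v u.
Proof. by apply: eq_bigr => j _; rewrite mulrC. Qed.

Lemma dotvDl u v w : dotv (u + v) w = dotv u w + dotv v w.
Proof.
by rewrite /dotv -big_split/=; apply: eq_bigr => j _; rewrite mxE mulrDl.
Qed.

Lemma dotvZl c u v : dotv (c *: u) v = c * dotv u v.
Proof. by rewrite /dotv mulr_sumr; apply: eq_bigr => j _; rewrite mxE mulrA. Qed.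

Lemma dotvNl u v : dotv (- u) v = - dotv u v.
Proof. by rewrite -scaleN1r dotvZl mulN1r. Qed.

Lemma dotvBl u v w : dotv (u - v) w = dotv u w - dotv v w.
Proof. by rewrite dotvDl dotvNl. Qed.

Lemma dotvDr u v w : dotv w (u + v) = dotv w u + dotv w v.
Proof. by rewrite dotvC dotvDl !(dotvC _ w). Qed.

Lemma dotvZr c u v : dotv u (c *: v) = c * dotv u v.
Proof. by rewrite dotvC dotvZl dotvC. Qed.

Lemma dotvNr u v : dotv u (- v) = - dotv u v.
Proof. by rewrite dotvC dotvNl dotvC. Qed.

Lemma dotvBr u v w : dotv w (u - v) = dotv w u - dotv w v.
Proof. by rewrite dotvDr dotvNr. Qed.

Lemma dotv0 u : dotv u 0 = 0.
Proof. by rewrite /dotv big1// => j _; rewrite mxE mulr0. Qed.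

Lemma dot0v u : dotv 0 u = 0.
Proof. by rewrite dotvC dotv0. Qed.

Lemma dotv_suml (I : Type) (s : seq I) (P : pred I) (F : I -> 'rV[R]_k) v :
  dotv (\sum_(i <- s | P i) F i) v = \sum_(i <- s | P i) dotv (F i) v.
Proof.
apply: (big_rec2 (fun a b => dotv a v = b)); first exact: dot0v.
by move=> i a b _ <-; rewrite dotvDl.
Qed.

Lemma dotv_sumr (I : Type) (s : seq I) (P : pred I) (F : I -> 'rV[R]_k) v :
  dotv v (\sum_(i <- s | P i) F i) = \sum_(i <- s | P i) dotv v (F i).
Proof. by rewrite dotvC dotv_suml; apply: eq_bigr => i _; rewrite dotvC. Qed.

Lemma dotvv_ge0 u : 0 <= dotv u u.
Proof. by apply: sumr_ge0 => j _; rewrite -expr2 sqr_ge0. Qed.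

Lemma norm2_ge0 u : 0 <= norm2 u.
Proof. exact: sqrtr_ge0. Qed.

Lemma norm2_sqr u : norm2 u ^+ 2 = dotv u u.
Proof. by rewrite sqr_sqrtr// dotvv_ge0. Qed.

Lemma dotvv_eq0 u : dotv u u = 0 -> u = 0.
Proof.
move/eqP; rewrite psumr_eq0; last by move=> j _; rewrite -expr2 sqr_ge0.
move=> /allP h; apply/rowP => j; rewrite mxE; apply/eqP.
by have := h j (mem_index_enum _); rewrite /= mulf_eq0 orbb.
Qed.

Lemma norm2_eq0 u : norm2 u = 0 -> u = 0.
Proof. by move=> h; apply: dotvv_eq0; rewrite -norm2_sqr h expr0n. Qed.

Lemma norm20 : norm2 (0 : 'rV[R]_k) = 0.
Proof. by rewrite /norm2 dotv0 sqrtr0. Qed.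

Lemma norm2Z c u : norm2 (c *: u) = `|c| * norm2 u.
Proof.
by rewrite /norm2 dotvZl dotvZr mulrA -expr2 sqrtrM ?sqr_ge0// sqrtr_sqr.
Qed.

Lemma norm2N u : norm2 (- u) = norm2 u.
Proof. by rewrite -scaleN1r norm2Z normrN1 mul1r. Qed.

Lemma norm2_distC u v : norm2 (u - v) = norm2 (v - u).
Proof. by rewrite -norm2N opprB. Qed.

Lemma dotvv_distC u v : dotv (u - v) (u - v) = dotv (v - u) (v - u).
Proof. by rewrite -!norm2_sqr norm2_distC. Qed.

Lemma dotvvD u v : dotv (u + v) (u + v) = dotv u u + 2 * dotv u v + dotv v v.
Proof. by rewrite !dotvDl !dotvDr (dotvC v u); ring. Qed.

Lemma dotvvB u v : dotv (u - v) (u - v) = dotv u u - 2 * dotv u v + dotv v v.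
Proof. by rewrite dotvvD dotvNr dotvNl dotvNr opprK mulrN. Qed.

Lemma dotvv_distDle u v : dotv (u + v) (u + v) <= 2 * dotv u u + 2 * dotv v v.
Proof. have := dotvv_ge0 (u - v); rewrite dotvvB dotvvD; lra. Qed.

Lemma cauchy_schwarz u v : dotv u v <= norm2 u * norm2 v.
Proof.
have [u0|u0] := eqVneq (norm2 u) 0.
  by rewrite (norm2_eq0 u0) dot0v norm20 mul0r.
have [v0|v0] := eqVneq (norm2 v) 0.
  by rewrite (norm2_eq0 v0) dotv0 norm20 mulr0.
have up : 0 < norm2 u by rewrite lt_neqAle eq_sym u0 norm2_ge0.
have vp : 0 < norm2 v by rewrite lt_neqAle eq_sym v0 norm2_ge0.
have := dotvv_ge0 (norm2 v *: u - norm2 u *: v).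
rewrite dotvvB !dotvZl !dotvZr -!norm2_sqr => h.
rewrite -subr_ge0 -(pmulr_rge0 _ (mulr_gt0 up vp)); nra.
Qed.

Lemma norm_dotv_le u v : `|dotv u v| <= norm2 u * norm2 v.
Proof.
rewrite ler_norml cauchy_schwarz andbT lerNl -dotvNl (le_trans (cauchy_schwarz _ _))//.
by rewrite norm2N.
Qed.

Lemma dotv_young c u v : 0 < c ->
  dotv u v <= c / 2 * dotv u u + (2 * c)^-1 * dotv v v.
Proof.
move=> c0; have := dotvv_ge0 (c *: u - v).
rewrite dotvvB !dotvZl !dotvZr => h.
rewrite -(ler_pM2l (_ : 0 < 2 * c)) ?mulr_gt0//.
rewrite mulrDr [2 * c * (_^-1 * _)]mulrA divff ?mul1r; last by rewrite mulf_neq0 ?gt_eqF.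
nra.
Qed.

Lemma norm2D u v : norm2 (u + v) <= norm2 u + norm2 v.
Proof.
rewrite -(ler_pXn2r (_ : 0 < 2)%N) ?nnegrE ?addr_ge0 ?norm2_ge0//.
rewrite norm2_sqr dotvvD sqrrD !norm2_sqr.
have := cauchy_schwarz u v; lra.
Qed.

Lemma norm2B_le u v : norm2 (u - v) <= norm2 u + norm2 v.
Proof. by rewrite (le_trans (norm2D _ _))// norm2N. Qed.

Lemma dotv_delta u j : dotv u (delta_mx 0 j) = u 0 j.
Proof.
rewrite /dotv (bigD1 j)//= mxE !eqxx/= mulr1 big1 ?addr0// => i ij.
by rewrite mxE (negbTE ij) mulr0.
Qed.

Lemma coord_le_norm2 u j : `|u 0 j| <= norm2 u.
Proof.
rewrite -dotv_delta (le_trans (norm_dotv_le _ _))// -[leRHS]mulr1.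
by rewrite ler_wpM2l ?norm2_ge0// /norm2 dotv_delta mxE !eqxx sqrtr1.
Qed.

End EuclideanVectors.

Lemma dotv_mulmx {R : realType} d m (y : 'rV[R]_m) (v : 'rV[R]_d)
    (A : 'M[R]_(d, m)) : dotv (y *m A^T) v = dotv y (v *m A).
Proof.
rewrite /dotv; under eq_bigr do rewrite mxE mulr_suml.
rewrite exchange_big/=; apply: eq_bigr => j _.
rewrite mxE mulr_sumr; apply: eq_bigr => i _; rewrite !mxE; ring.
Qed.

(** * Convexity, averages and proximal steps *)

(** Stands in for letting [s] tend to 0 in first-order conditions and difference quotients. *)
Lemma affine_ge0_at0 {R : realType} (A B : R) :
  (forall s, 0 < s <= 1 -> 0 <= A + s * B) -> 0 <= A.
Proof.
move=> h; rewrite leNgt; apply/negP => A0.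
have B0 : 0 < `|B| + 1 by rewrite ltr_wpDl.
pose s := Num.min 1 (- A / (2 * (`|B| + 1))).
have s0 : 0 < s by rewrite lt_min ltr01/= divr_gt0 ?mulr_gt0 ?oppr_gt0.
have s1 : s <= 1 by rewrite ge_min lexx.
have := h s; rewrite s0 s1 => /(_ isT).
have : s * (2 * (`|B| + 1)) <= - A.
  by rewrite -ler_pdivlMr ?mulr_gt0// ge_min lexx orbT.
have := ler_norm B; nra.
Qed.

(** Convexity of the set and of the function are bundled because conjugates and the regulariser are
    handled as real functions on their effective domains. *)
Definition rconvex_on {R : realType} k (K : set 'rV[R]_k) (h : 'rV[R]_k -> R) :=
  forall u v (t : R), K u -> K v -> 0 <= t <= 1 ->
    K (t *: u + (1 - t) *: v) /\
    h (t *: u + (1 - t) *: v) <= t * h u + (1 - t) * h v.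

Lemma rconvex_convex_function {R : realType} k (K : set 'rV[R]_k)
    (h : 'rV[R]_k -> R) : convex_function K h ->
  forall u v (t : R), K u -> K v -> 0 <= t <= 1 ->
    h (t *: u + (1 - t) *: v) <= t * h u + (1 - t) * h v.
Proof.
move=> ch u v t Ku Kv /andP[t0 t1].
by have := ch (Itv01 t0 t1) u v; rewrite !inE; apply.
Qed.

Lemma rconvex_convex_set {R : realType} k (K : set 'rV[R]_k) : convex_set K ->
  forall u v (t : R), K u -> K v -> 0 <= t <= 1 -> K (t *: u + (1 - t) *: v).
Proof.
move=> cK u v t Ku Kv /andP[t0 t1].
by apply: set_mem; apply: (cK u v (Itv01 t0 t1)); exact: mem_set.
Qed.

Lemma rconvex_add {R : realType} k (K : set 'rV[R]_k) (h h' : 'rV[R]_k -> R) :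
  rconvex_on K h -> rconvex_on K h' -> rconvex_on K (fun x => h x + h' x).
Proof.
move=> ch ch' u v t Ku Kv t01.
have [? ?] := ch u v t Ku Kv t01; have [_ ?] := ch' u v t Ku Kv t01.
split=> //; lra.
Qed.

Lemma rconvex_add_dotv {R : realType} k (K : set 'rV[R]_k) h (g : 'rV[R]_k) :
  rconvex_on K h -> rconvex_on K (fun x => h x + dotv g x).
Proof.
move=> ch u v t Ku Kv t01; have [? ?] := ch u v t Ku Kv t01; split=> //.
rewrite dotvDr !dotvZr; lra.
Qed.

Lemma jensen_mean {R : realType} k (K : set 'rV[R]_k) (h : 'rV[R]_k -> R)
    (x : nat -> 'rV[R]_k) T : (0 < T)%N -> rconvex_on K h ->
  (forall t, (t < T)%N -> K (x t)) ->
  K (T%:R^-1 *: \sum_(t < T) x t) /\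
  h (T%:R^-1 *: \sum_(t < T) x t) <= T%:R^-1 * \sum_(t < T) h (x t).
Proof.
move=> + ch; elim: T => // -[_ _ Kx|T IH _ Kx].
  rewrite !big_ord_recl !big_ord0 !addr0 invr1 scale1r mul1r; split=> //.
  exact: Kx.
have [||KT hT] := IH => //; first by move=> t tT; apply: Kx; exact: ltnW.
(* Weight of the old average in the new one, so that convexity between two points suffices. *)
pose s : R := T.+1%:R / T.+2%:R.
have T1 : (T.+1%:R : R) != 0 by rewrite pnatr_eq0.
have T2 : (T.+2%:R : R) != 0 by rewrite pnatr_eq0.
have s01 : 0 <= s <= 1.
  by rewrite divr_ge0//= ler_pdivrMr ?ltr0n// mul1r ler_nat.
have sE : s * T.+1%:R^-1 = T.+2%:R^-1 by rewrite /s mulrAC divff ?mul1r.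
have s1E : 1 - s = T.+2%:R^-1.
  apply: (mulIf T2); rewrite mulrBl mulVf// mul1r divfK//.
  by rewrite -natrB// subSnn.
have [Kc hc] := ch _ _ _ KT (Kx T.+1 (ltnSn _)) s01.
have E : T.+2%:R^-1 *: \sum_(t < T.+2) x t =
    s *: (T.+1%:R^-1 *: \sum_(t < T.+1) x t) + (1 - s) *: x T.+1.
  by rewrite scalerA sE s1E big_ord_recr/= scalerDr.
rewrite E; split=> //; apply: le_trans hc _.
rewrite [X in _ <= _ * X]big_ord_recr/= mulrDr s1E lerD2r -sE -[leRHS]mulrA.
by rewrite ler_wpM2l//; case/andP: s01.
Qed.

(** Minimality is tested on the segment from [p] to [v]. At first order it gives [0 <= h v - h p + c
    * dotv (v - p) (p - z)], and expanding the square of [v - z] around [p] does the rest. *)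
Lemma prox_three_point {R : realType} k (K : set 'rV[R]_k)
    (h : 'rV[R]_k -> R) (c : R) (p z : 'rV[R]_k) :
  rconvex_on K h -> K p ->
  (forall v, K v -> h p + c / 2 * dotv (p - z) (p - z)
                    <= h v + c / 2 * dotv (v - z) (v - z)) ->
  forall v, K v -> h p + c / 2 * dotv (p - z) (p - z)
      + c / 2 * dotv (v - p) (v - p) <= h v + c / 2 * dotv (v - z) (v - z).
Proof.
move=> ch Kp hp v Kv.
have -> : v - z = (v - p) + (p - z) by rewrite addrA subrK.
rewrite (dotvvD (v - p)).
suff : 0 <= h v - h p + c * dotv (v - p) (p - z) by lra.
apply: (@affine_ge0_at0 _ _ (c / 2 * dotv (v - p) (v - p))) => s s01.
have s01' : 0 <= s <= 1 by case/andP: s01 => /ltW -> ->.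
have [Ks hs] := ch v p s Kv Kp s01'.
have := hp _ Ks.
have -> : s *: v + (1 - s) *: p - z = s *: (v - p) + (p - z).
  by apply/rowP => j; rewrite !mxE; ring.
rewrite (dotvvD (s *: _)) !dotvZl dotvZr => {}hp.
case/andP: s01 => s0 _.
rewrite -(pmulr_rge0 _ s0); nra.
Qed.

(** The two three-point inequalities, each tested at the other minimiser, add up to monotonicity;
    Cauchy-Schwarz concludes. The input of a step is the combination [z - c^-1 *: g]. The lemma
    serves the measurability of the iterates. *)
Lemma prox_nonexpansive {R : realType} k (K : set 'rV[R]_k)
    (h : 'rV[R]_k -> R) (c : R) (p z g p' z' g' : 'rV[R]_k) :
  0 < c -> rconvex_on K h -> K p -> K p' ->
  (forall v, K v -> h p + dotv g p + c / 2 * dotv (p - z) (p - z)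
                    <= h v + dotv g v + c / 2 * dotv (v - z) (v - z)) ->
  (forall v, K v -> h p' + dotv g' p' + c / 2 * dotv (p' - z') (p' - z')
                    <= h v + dotv g' v + c / 2 * dotv (v - z') (v - z')) ->
  norm2 (p - p') <= norm2 ((z - c^-1 *: g) - (z' - c^-1 *: g')).
Proof.
move=> c0 ch Kp Kp' hp hp'.
have := prox_three_point (rconvex_add_dotv g ch) Kp hp Kp'.
have := prox_three_point (rconvex_add_dotv g' ch) Kp' hp' Kp.
rewrite (dotvv_distC p' p) => h1 h2.
set q := _ - _ - (_ - _).
suff le : dotv (p - p') (p - p') <= dotv (p - p') q.
  have := cauchy_schwarz (p - p') q; have := norm2_ge0 (p - p').
  have := norm2_ge0 q.
  move: le; rewrite -norm2_sqr.
  case: (lerP (norm2 (p - p')) (norm2 q)) => // ? ? ? ? ?; nra.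
rewrite -(ler_pM2l c0) /q.
rewrite [X in _ <= _ * X]dotvBr [X in _ <= _ * (X - _)]dotvBr.
rewrite [X in _ <= _ * (_ - X)]dotvBr !dotvZr !mulrBr !(mulrA c).
rewrite (divff (lt0r_neq0 c0)) !mul1r.
move: h1 h2; rewrite !dotvvB !dotvBl (dotvC g p) (dotvC g p') (dotvC g' p) (dotvC g' p').
lra.
Qed.

Lemma continuous_dotvl {R : realType} k (u : 'rV[R]_k) :
  continuous (fun v : 'rV[R]_k => dotv v u).
Proof.
apply: continuous_big => [|j _ v]; first exact: add_continuous.
by apply: (cvgM (@coord_continuous _ _ _ 0 j v)); exact: cvg_cst.
Qed.

Lemma continuous_dotvv {R : realType} k (u : 'rV[R]_k) :
  continuous (fun v : 'rV[R]_k => dotv (v - u) (v - u)).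
Proof.
apply: continuous_big => [|j _ v]; first exact: add_continuous.
have h : (fun w : 'rV[R]_k => (w - u) 0 j) w @[w --> v] --> (v - u) 0 j.
  under eq_fun do rewrite !mxE; rewrite !mxE.
  by apply: (cvgB (@coord_continuous _ _ _ 0 j v)); exact: cvg_cst.
exact: (cvgM h h).
Qed.

Lemma finite_min_seq {R : realType} (I : eqType) (s : seq I) (h : I -> R) i0 :
  i0 \in s -> exists2 i, i \in s & forall j, j \in s -> h i <= h j.
Proof.
elim: s i0 => // a s IH i0 _.
case: s IH => [_|b s IH].
  by exists a; rewrite ?mem_head// => j; rewrite inE => /eqP ->.
have [i is_ hi] := IH b (mem_head _ _).
have [le|/ltW le] := lerP (h a) (h i).
- exists a; rewrite ?mem_head// => j; rewrite inE => /predU1P[->//|js].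
  exact: le_trans (hi j js).
- exists i; first by rewrite inE is_ orbT.
  by move=> j; rewrite inE => /predU1P[->//|js]; exact: hi.
Qed.

(** On [Y] the function [H] is a supremum of continuous functions, hence lower semicontinuous.
    Without a minimiser, the open sets where some [F i] exceeds some value of [H] cover [Y]. *)
Lemma compact_min_sup_continuous {R : realType} k (Y : set 'rV[R]_k)
    (I : choiceType) (F : I -> 'rV[R]_k -> R) (H : 'rV[R]_k -> R) y0 :
  compact Y -> Y y0 -> (forall i, continuous (F i)) ->
  (forall v i, Y v -> F i v <= H v) ->
  (forall v a, Y v -> a < H v -> exists i, a < F i v) ->
  exists2 p, Y p & forall v, Y v -> H p <= H v.
Proof.
move=> cY Yy0 cF FH HF; apply: contrapT => nomin.
have ex p : Y p -> exists2 v, Y v & H v < H p.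
  move=> Yp; apply: contrapT => nov; apply: nomin; exists p => // v Yv.
  by rewrite leNgt; apply/negP => lt; apply: nov; exists v.
move: cY; rewrite compact_cover => /(_ ('rV[R]_k * I)%type
  [set vi | Y vi.1] (fun vi => [set p | H vi.1 < F vi.2 p])) [].
- move=> [v i] /= _; apply: (@open_comp _ _ (F i) [set a | H v < a]).
    by move=> p _; exact: cF.
  exact: open_gt.
- move=> p Yp; have [v Yv lt] := ex p Yp.
  by have [i lti] := HF p _ Yp lt; exists (v, i).
move=> D' sD' cov.
have [vi0 vi0D _] := cov _ Yy0.
(* The point with the least value of [H] in the finite subcover is itself covered, by a pair with a
   strictly smaller value. *)
have [vi viD hvi] := finite_min_seq (fun vi => H vi.1) vi0D.
have Yvi : Y vi.1 by have := sD' vi viD; rewrite inE.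
have [vj vjD /= lt] := cov _ Yvi.
have := lt_le_trans lt (FH _ vj.2 Yvi).
by rewrite ltNge hvi.
Qed.

(** * Convex conjugates of finite convex functions *)

Section Conjugate.
Context {R : realType} {k : nat}.
Variable f : 'rV[R]_k -> R.

Definition rconj (v : 'rV[R]_k) : R := fine (conjugate f v).

Lemma conjugate_ge v u : ((dotv v u - f u)%:E <= conjugate f v)%E.
Proof. by apply: ereal_sup_ubound; exists u. Qed.

Lemma conjugateE v : edom (conjugate f) v -> conjugate f v = (rconj v)%:E.
Proof.
move=> Yv; rewrite fineK// fin_real// (lt_le_trans _ (conjugate_ge v 0)) ?ltNyr//.
Qed.

Lemma fenchel_young v u : edom (conjugate f) v -> dotv v u - f u <= rconj v.
Proof. by move=> Yv; rewrite -lee_fin -conjugateE// conjugate_ge. Qed.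

Lemma rconj_le v c : (forall u, dotv v u - f u <= c) ->
  edom (conjugate f) v /\ rconj v <= c.
Proof.
move=> h.
have le : (conjugate f v <= c%:E)%E.
  by apply: ge_ereal_sup => _ [u _ <-]; rewrite lee_fin.
have Yv : edom (conjugate f) v by rewrite /edom/= (le_lt_trans le) ?ltry.
by split=> //; rewrite -lee_fin -conjugateE.
Qed.

Lemma rconvex_rconj : rconvex_on (edom (conjugate f)) rconj.
Proof.
move=> u v t Yu Yv /andP[t0 t1]; apply: rconj_le => w.
rewrite dotvDl !dotvZl.
have := fenchel_young w Yu; have := fenchel_young w Yv; nra.
Qed.

Lemma rconj_lt_ex v a : edom (conjugate f) v -> a < rconj v ->
  exists u, a < dotv v u - f u.
Proof.
move=> Yv lt; apply: contrapT => no.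
have [_] : edom (conjugate f) v /\ rconj v <= a.
  apply: rconj_le => u; rewrite leNgt; apply/negP => lt'; apply: no.
  by exists u.
by rewrite leNgt lt.
Qed.

(** If [norm2 v] exceeded [L], then [dotv v u - f u] would grow linearly along the ray [u = s *: v]
    and the conjugate would be infinite; [s] is chosen to pass its presumed value. *)
Lemma edom_conjugate_bound (L : R) : 0 <= L ->
  (forall u u', `|f u - f u'| <= L * norm2 (u - u')) ->
  forall v, edom (conjugate f) v -> norm2 v <= L.
Proof.
move=> L0 fL v Yv; rewrite leNgt; apply/negP => lt.
have v0 : 0 < norm2 v := le_lt_trans L0 lt.
pose s := (f 0 + rconj v + 1) / (norm2 v * (norm2 v - L)).
pose s' := Num.max s 1.
have s'0 : 0 < s' by rewrite lt_max ltr01 orbT.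
have := fenchel_young (s' *: v) Yv.
rewrite dotvZr -norm2_sqr.
have := fL (s' *: v) 0; rewrite subr0 norm2Z (gtr0_norm s'0) => /ler_normlP[_].
have den : 0 < norm2 v * (norm2 v - L) by rewrite mulr_gt0// subr_gt0.
have : f 0 + rconj v + 1 <= s' * (norm2 v * (norm2 v - L)).
  by rewrite -ler_pdivrMr// le_max lexx.
nra.
Qed.

(** Along minus the j-th basis vector [f] stays below [f 0], so a negative coordinate of [v] would
    make the conjugate infinite. *)
Lemma edom_conjugate_ge0 : coord_nondecreasing f ->
  forall v, edom (conjugate f) v -> forall j, 0 <= v 0 j.
Proof.
move=> fm v Yv j; rewrite leNgt; apply/negP => lt.
pose s := (`|f 0 + rconj v| + 1) / - v 0 j.
have s0 : 0 <= s by rewrite divr_ge0 ?addr_ge0// oppr_ge0 ltW.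
have := fenchel_young (- s *: delta_mx 0 j) Yv.
rewrite dotvZr dotv_delta.
have : f (- s *: delta_mx 0 j) <= f 0.
  by apply: fm => i; rewrite !mxE !eqxx/=; case: (i == j); rewrite ?mulr1 ?mulr0 ?oppr_le0.
have -> : - s * v 0 j = `|f 0 + rconj v| + 1.
  by rewrite /s mulNr -mulrN -mulrA mulVf ?mulr1// oppr_eq0 lt_eqF.
have := ler_norm (f 0 + rconj v); lra.
Qed.

Hypothesis cf : forall u v (t : R), 0 <= t <= 1 ->
  f (t *: u + (1 - t) *: v) <= t * f u + (1 - t) * f v.

(* One-dimension-at-a-time Hahn-Banach extension. *)
Lemma subgradient_coords u j : (j <= k)%N ->
  exists v, forall z : 'rV[R]_k, (forall i : 'I_k, (j <= i)%N -> z 0 i = 0) ->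
    f u + dotv v z <= f (u + z).
Proof.
elim: j => [_|j IH jk].
  exists 0 => z z0; rewrite dot0v addr0.
  have -> : z = 0 by apply/rowP => i; rewrite mxE z0.
  by rewrite addr0.
have [v hv] := IH (ltnW jk).
pose jo := Ordinal jk; pose e : 'rV[R]_k := delta_mx 0 jo.
pose V := [set z : 'rV[R]_k | forall i : 'I_k, (j <= i)%N -> z 0 i = 0].
(* Slopes forced from the negative side of the new direction. By [key] each lies below every slope
   forced from the positive side, so the supremum is an admissible value on [e]. *)
pose low := [set r | exists z s, [/\ V z, 0 < s &
   r = (f u + dotv v z - f (u + z - s *: e)) / s]].
have key z1 z2 s1 s2 : V z1 -> V z2 -> 0 < s1 -> 0 < s2 ->
    (f u + dotv v z1 - f (u + z1 - s1 *: e)) / s1 <=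
    (f (u + z2 + s2 *: e) - f u - dotv v z2) / s2.
  move=> V1 V2 s10 s20.
  rewrite ler_pdivrMr// mulrAC ler_pdivlMr//.
  (* The weight for which the two displacements along [e] cancel. *)
  pose t := s2 / (s1 + s2).
  have s12 : 0 < s1 + s2 by rewrite addr_gt0.
  have tE : t * (s1 + s2) = s2 by rewrite /t divfK ?gt_eqF.
  have t01 : 0 <= t <= 1.
    by rewrite /t ler_pdivrMr// mul1r lerDr (ltW s10) divr_ge0// ltW.
  have := cf (u + z1 - s1 *: e) (u + z2 + s2 *: e) t01.
  have -> : t *: (u + z1 - s1 *: e) + (1 - t) *: (u + z2 + s2 *: e) =
            u + (t *: z1 + (1 - t) *: z2).
    have e0 : t * s1 = (1 - t) * s2 by lra.
    rewrite scalerBr !scalerDr !scalerA e0 scalerBl scale1r.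
    apply/rowP => i; rewrite !mxE; ring.
  have /hv : V (t *: z1 + (1 - t) *: z2).
    by move=> i ji; rewrite !mxE V1// V2// !mulr0 addr0.
  rewrite dotvDr !dotvZr.
  set A := f (u + z1 - _); set B := f (u + z2 + _).
  set w1 := dotv v z1; set w2 := dotv v z2 => h1 h2.
  have {h1 h2} h := le_trans h1 h2.
  have : (s1 + s2) * (f u + (t * w1 + (1 - t) * w2)) <= (s1 + s2) * (t * A + (1 - t) * B).
    by rewrite ler_pM2l.
  have mixE a b : (s1 + s2) * (t * a + (1 - t) * b) = s2 * a + s1 * b.
    transitivity (t * (s1 + s2) * a + ((s1 + s2) - t * (s1 + s2)) * b); first ring.
    by rewrite tE; ring.
  rewrite mulrDr !mixE; lra.
have V0 : V 0 by move=> i _; rewrite mxE.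
have hlow : has_sup low.
  split; first by exists ((f u + dotv v 0 - f (u + 0 - 1 *: e)) / 1), 0, 1.
  exists ((f (u + 0 + 1 *: e) - f u - dotv v 0) / 1) => _ [z [s [Vz s0 ->]]].
  exact: key.
pose c := sup low.
exists (v + (c - v 0 jo) *: e) => w Vw.
pose s := w 0 jo; pose z := w - s *: e.
have Vz : V z.
  move=> i; rewrite leq_eqVlt => /predU1P[ji|ji].
    have -> : i = jo by apply/val_inj.
    by rewrite !mxE !eqxx/= mulr1 subrr.
  rewrite !mxE Vw// sub0r eqxx/=; case: (i =P jo) => [E|_].
    by move: ji; rewrite E ltnn.
  by rewrite mulr0 oppr0.
have wE : w = z + s *: e by rewrite subrK.
have -> : dotv (v + (c - v 0 jo) *: e) w = dotv v z + s * c.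
  rewrite {1}wE dotvDr !(dotvDl, dotvZl, dotvZr) !dotv_delta.
  rewrite (dotvC e z) dotv_delta (Vz jo (leqnn _)) mxE !eqxx/=; ring.
rewrite wE (addrA u z).
have [s0|s0|s0] := ltgtP s 0.
- have := ub_le_sup hlow.2 (ex_intro _ z (ex_intro _ (- s) (And3 Vz _ erefl))).
  rewrite oppr_gt0 => /(_ s0); rewrite -/c ler_pdivrMr ?oppr_gt0// scaleNr opprK.
  lra.
- have : c <= (f (u + z + s *: e) - f u - dotv v z) / s.
    apply: ge_sup => [|_ [z' [s' [Vz' s'0 ->]]]]; last exact: key.
    exact: hlow.1.
  rewrite ler_pdivlMr//; lra.
- rewrite s0 mul0r scale0r !addr0; exact: hv.
Qed.

(** A subgradient of [f] at [u] attains the supremum in the biconjugate. This lets the value at the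
    dual best response replace [f] at the averaged iterate. *)
Lemma fenchel_equality u : exists2 v, edom (conjugate f) v &
  f u + rconj v <= dotv v u.
Proof.
have [v hv] := subgradient_coords u (leqnn k).
have [Yv le] : edom (conjugate f) v /\ rconj v <= dotv v u - f u.
  apply: rconj_le => w.
  have := hv (w - u); rewrite (addrC u) subrK dotvBr => h.
  have {}h : f u + (dotv v w - dotv v u) <= f w.
    by apply: h => i; rewrite leqNgt ltn_ord.
  lra.
by exists v => //; lra.
Qed.

End Conjugate.

(** * From the given norm to the Euclidean norm *)

Section Norms.
Context {R : realType} {m : nat}.
Variables (a b : R) (N : 'rV[R]_m -> R).
Hypotheses (a0 : 0 < a) (Nn : is_norm N) (Nab : norm_equiv a b N).
(** The maximum keeps the constant positive when [m = 0], where norm equivalence says nothing about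
    [b]. *)
Let beta := Num.max a b.

Lemma norm_equiv_beta_gt0 : 0 < beta. Proof. by rewrite lt_max a0. Qed.

Let N0 : N 0 = 0.
Proof. by case: Nn => _ NZ _; have := NZ 0 0; rewrite scale0r normr0 mul0r. Qed.

Lemma norm_le_beta u : N u <= beta * norm2 u.
Proof.
have /andP[_ h] := Nab u; apply: (le_trans h).
by rewrite ler_wpM2r ?norm2_ge0// le_max lexx orbT.
Qed.

Lemma norm2_le_inv u : norm2 u <= a^-1 * N u.
Proof. by rewrite mulrC ler_pdivlMr// mulrC; case/andP: (Nab u). Qed.

(** The real [sup] carries information only on nonempty bounded sets; the lower equivalence constant
    [a] bounds the unit ball of [N]. *)
Lemma dual_norm_has_sup u : has_sup [set dotv v u | v in [set v | N v <= 1]].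
Proof.
split; first by exists (dotv 0 u), 0 => //=; rewrite N0.
exists (a^-1 * norm2 u) => _ [v /= Nv <-].
apply: (le_trans (cauchy_schwarz _ _)); rewrite ler_wpM2r ?norm2_ge0//.
apply: (le_trans (norm2_le_inv v)).
by rewrite -[leRHS]mulr1 ler_wpM2l// invr_ge0 ltW.
Qed.

Lemma dual_norm_le u : dual_norm N u <= a^-1 * norm2 u.
Proof.
apply: ge_sup => [|_ [v /= Nv <-]]; first exact: (dual_norm_has_sup u).1.
apply: (le_trans (cauchy_schwarz _ _)); rewrite ler_wpM2r ?norm2_ge0//.
apply: (le_trans (norm2_le_inv v)).
by rewrite -[leRHS]mulr1 ler_wpM2l// invr_ge0 ltW.
Qed.

Lemma dual_norm_ge0 u : 0 <= dual_norm N u.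
Proof.
apply: (ub_le_sup (dual_norm_has_sup u).2).
by exists 0; rewrite /= ?N0// dot0v.
Qed.

Lemma norm2_le_dual_norm u : norm2 u <= beta * dual_norm N u.
Proof.
have b0 := norm_equiv_beta_gt0.
have [u0|u0] := eqVneq (norm2 u) 0.
  by rewrite u0 mulr_ge0 ?dual_norm_ge0// ltW.
have up : 0 < norm2 u by rewrite lt_neqAle eq_sym u0 norm2_ge0.
rewrite mulrC -ler_pdivrMr//.
apply: (ub_le_sup (dual_norm_has_sup u).2).
(* Rescaled into the unit ball of [N], the vector [u] is its own test vector. *)
exists ((beta * norm2 u)^-1 *: u) => /=.
  have /= := norm_le_beta ((beta * norm2 u)^-1 *: u).
  rewrite norm2Z gtr0_norm ?invr_gt0 ?mulr_gt0// mulrCA mulVf//.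
  by rewrite mulf_neq0// gt_eqF.
rewrite dotvZl -norm2_sqr invfM expr2; field.
by rewrite gt_eqF//= u0.
Qed.

Lemma dual_norm_sqr_ge u : norm2 u ^+ 2 <= beta ^+ 2 * dual_norm N u ^+ 2.
Proof.
have h := norm2_le_dual_norm u; have u0 := norm2_ge0 u.
by rewrite -exprMn lerXn2r ?nnegrE// (le_trans u0).
Qed.

(** A crude constant, used to see that the supremum defining the operator norm is finite. *)
Lemma norm2_mulmx_le d (A : 'M[R]_(m, d)) :
  exists2 c, 0 <= c & forall v, norm2 (v *m A) <= c * norm2 v.
Proof.
pose c : R := \sum_(i < m) norm2 (row i A).
exists c; first by apply: sumr_ge0 => i _; exact: norm2_ge0.
move=> v; rewrite mulmx_sum_row mulr_suml.
apply: (@le_trans _ _ (\sum_(i < m) norm2 (v 0 i *: row i A))).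
  elim/big_rec2: _ => [|i x y _ le]; first by rewrite norm20.
  by apply: (le_trans (norm2D _ _)); rewrite lerD2l.
apply: ler_sum => i _; rewrite norm2Z mulrC ler_wpM2l ?norm2_ge0//.
exact: coord_le_norm2.
Qed.

Lemma op_norm_has_sup d (A : 'M[R]_(m, d)) :
  has_sup [set norm2 (v *m A) | v in [set v | N v <= 1]].
Proof.
split; first by exists (norm2 (0 *m A)), 0 => //=; rewrite N0.
have [c c0 hc] := norm2_mulmx_le A.
exists (c * a^-1) => _ [v /= Nv <-].
apply: (le_trans (hc v)); rewrite ler_wpM2l//.
apply: (le_trans (norm2_le_inv v)).
by rewrite -[leRHS]mulr1 ler_wpM2l// invr_ge0 ltW.
Qed.

Lemma op_norm_ge0 d (A : 'M[R]_(m, d)) : 0 <= op_norm N A.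
Proof.
apply: (ub_le_sup (op_norm_has_sup A).2).
by exists 0; rewrite /= ?N0// mul0mx norm20.
Qed.

Lemma norm2_mulmx_op_norm d (A : 'M[R]_(m, d)) v :
  norm2 (v *m A) <= N v * op_norm N A.
Proof.
have Nv0 : 0 <= N v.
  have /andP[+ _] := Nab v; apply: le_trans.
  by rewrite mulr_ge0 ?norm2_ge0// ltW.
have [v0|v0] := eqVneq (N v) 0.
  by case: Nn => _ _ /(_ _ v0) ->; rewrite mul0mx norm20 N0 mul0r.
have vp : 0 < N v by rewrite lt_neqAle eq_sym v0.
rewrite mulrC -ler_pdivrMr//.
apply: (ub_le_sup (op_norm_has_sup A).2).
exists ((N v)^-1 *: v) => /=.
  by case: Nn => _ -> _; rewrite gtr0_norm ?invr_gt0// mulVf.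
by rewrite -scalemxAl norm2Z gtr0_norm ?invr_gt0// mulrC.
Qed.

Lemma op_norm_sqr_ge d (A : 'M[R]_(m, d)) v M : norm2 v <= M ->
  norm2 (v *m A) ^+ 2 <= (beta * M) ^+ 2 * op_norm N A ^+ 2.
Proof.
move=> vM.
have b0 := ltW norm_equiv_beta_gt0.
have M0 : 0 <= M := le_trans (norm2_ge0 v) vM.
rewrite -exprMn lerXn2r ?nnegrE ?norm2_ge0//.
  by rewrite !mulr_ge0 ?op_norm_ge0.
apply: (le_trans (norm2_mulmx_op_norm A v)); rewrite ler_wpM2r ?op_norm_ge0//.
by apply: (le_trans (norm_le_beta v)); rewrite ler_wpM2l.
Qed.

End Norms.

(** * Deterministic consequences of the standing assumptions *)

Section ProblemFacts.
Context {R : realType} {d m n : nat} (pb : fcco R d m n).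
Variables (a b mu Cf Cg Lg : R) (N : 'rV[R]_m -> R).
Hypotheses (a0 : 0 < a) (Lg0 : 0 < Lg) (Nn : is_norm N) (Nab : norm_equiv a b N).
Hypotheses (hdom : assumption_domain pb mu) (hin : assumption_inner pb N Cg).
Hypotheses (hout : assumption_outer pb N Cf) (hsm : smooth_inner pb N Lg).

(** Euclidean versions of the assumed constants. The assumptions fix no sign for [Cf] and [Cg], so
    absolute values keep these bounds nonnegative. *)
Definition dual_radius (a Cf : R) : R := `|Cf| / a.
Definition inner_lip (a b Cg : R) : R := Num.max a b * `|Cg|.
Definition inner_smooth (a b Lg : R) : R := Num.max a b * Lg.

Let M := dual_radius a Cf.
Let gam := inner_lip a b Cg.
Let lam := inner_smooth a b Lg.
Let beta0 : 0 < Num.max a b. Proof. by rewrite lt_max a0. Qed.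

Lemma dual_radius_ge0 : 0 <= M. Proof. by rewrite divr_ge0// ltW. Qed.
Lemma inner_lip_ge0 : 0 <= gam. Proof. by rewrite mulr_ge0// ltW. Qed.
Lemma inner_smooth_ge0 : 0 <= lam. Proof. by rewrite mulr_ge0// ltW. Qed.

Lemma fouter_convex i u v (t : R) : 0 <= t <= 1 ->
  fouter pb i (t *: u + (1 - t) *: v) <= t * fouter pb i u + (1 - t) * fouter pb i v.
Proof. by move=> t01; case: (hout i) => /rconvex_convex_function h _ _ _; exact: h. Qed.

Lemma fouter_lip i u u' : `|fouter pb i u - fouter pb i u'| <= M * norm2 (u - u').
Proof.
case: (hout i) => _ h _ _; apply: (le_trans (h u u')).
have d0 := dual_norm_ge0 a0 Nn Nab (u - u').
apply: (@le_trans _ _ (`|Cf| * dual_norm N (u - u'))).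
  by rewrite ler_wpM2r// ler_norm.
by rewrite /M /dual_radius -mulrA ler_wpM2l// (dual_norm_le a0 Nn Nab).
Qed.

Lemma Ydom_bound i v : Ydom pb i v -> norm2 v <= M.
Proof. exact: (edom_conjugate_bound dual_radius_ge0 (fouter_lip i)). Qed.

Lemma ginner_lip i x x' : X pb x -> X pb x' ->
  norm2 (ginner pb i x - ginner pb i x') <= gam * norm2 (x - x').
Proof.
move=> Xx Xx'; have [_ /(_ x x' Xx Xx') h] := hin i.
apply: (le_trans (norm2_le_dual_norm a0 Nn Nab _)).
rewrite /gam /inner_lip -mulrA ler_wpM2l ?(ltW beta0)// (le_trans h)//.
by rewrite ler_wpM2r ?norm2_ge0// ler_norm.
Qed.

Lemma ginner_smooth i x x' : X pb x -> X pb x' ->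
  norm2 (ginner pb i x - ginner pb i x' - (x - x') *m ginner' pb i x')
  <= lam / 2 * norm2 (x - x') ^+ 2.
Proof.
move=> Xx Xx'; have [_ /(_ x x' Xx Xx') h] := hsm i.
apply: (le_trans (norm2_le_dual_norm a0 Nn Nab _)).
by rewrite /lam /inner_smooth -!mulrA ler_wpM2l ?(ltW beta0)// mulrA.
Qed.

Lemma X_convex u v (t : R) : X pb u -> X pb v -> 0 <= t <= 1 ->
  X pb (t *: u + (1 - t) *: v).
Proof. by case: hdom => _ /rconvex_convex_set cX _ _ _; exact: cX. Qed.

(** On the segment towards [x'] the smoothness remainder is of order [s ^+ 2], so the Lipschitz
    bound passes to the derivative after division by [s]. Only directions between points of [X] are
    reached, as [X] may have empty interior. *)
Lemma ginner'_lip i x x' : X pb x -> X pb x' ->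
  norm2 ((x' - x) *m ginner' pb i x) <= gam * norm2 (x' - x).
Proof.
move=> Xx Xx'; rewrite -subr_ge0.
apply: (@affine_ge0_at0 _ _ (lam / 2 * norm2 (x' - x) ^+ 2)) => s s01.
case/andP: (s01) => s0 s1.
have s01' : 0 <= s <= 1 by rewrite ltW.
pose xs := s *: x' + (1 - s) *: x.
have Xs : X pb xs by exact: X_convex.
have E : xs - x = s *: (x' - x) by apply/rowP => j; rewrite !mxE; ring.
have h1 := ginner_lip i Xs Xx.
have h2 := ginner_smooth i Xs Xx.
rewrite E -scalemxAl norm2Z (gtr0_norm s0) in h2.
rewrite E norm2Z (gtr0_norm s0) in h1.
have h3 := norm2B_le (ginner pb i xs - ginner pb i x)
  (ginner pb i xs - ginner pb i x - s *: ((x' - x) *m ginner' pb i x)).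
rewrite opprB addrC subrK norm2Z (gtr0_norm s0) in h3.
rewrite -(pmulr_rge0 _ s0); rewrite exprMn in h2; lra.
Qed.

(* The lower linearisation [v . g(x') >= v . (g(x) + g'(x)(x' - x))] holds for
   nonnegative [v] by convexity; when [g_i] is affine [v] may have any sign. *)
Lemma ginner_lin_ge i v x x' : Ydom pb i v -> X pb x -> X pb x' ->
  oracle_subgradient pb ->
  dotv v (ginner pb i x) + dotv v ((x' - x) *m ginner' pb i x)
  <= dotv v (ginner pb i x').
Proof.
move=> Yv Xx Xx' hsub.
have [[A [c gA]]|naff] := pselect (affine_on (X pb) (ginner pb i)); last first.
  have [_ _ /(_ naff) fm _] := hout i.
  have v0 := edom_conjugate_ge0 fm Yv.
  rewrite -dotvDr; apply: ler_sum => j _; rewrite ler_wpM2l// mxE.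
  by have [h _] := hsub i x Xx; exact: h.
suff -> : (x' - x) *m ginner' pb i x = ginner pb i x' - ginner pb i x.
  by rewrite dotvBr addrC subrK.
apply/eqP; rewrite eq_sym -subr_eq0; apply/eqP.
set w := _ - _; apply: norm2_eq0; apply/eqP; rewrite eq_le norm2_ge0 andbT.
rewrite -oppr_ge0.
(* The remainder of an affine map is linear in [s], whereas smoothness bounds it by a multiple of
   [s ^+ 2]; hence it vanishes. *)
apply: (@affine_ge0_at0 _ _ (lam / 2 * norm2 (x' - x) ^+ 2)) => s s01.
case/andP: (s01) => s0 s1.
have s01' : 0 <= s <= 1 by rewrite ltW.
pose xs := s *: x' + (1 - s) *: x.
have Xs : X pb xs by exact: X_convex.
have E : xs - x = s *: (x' - x) by apply/rowP => j; rewrite !mxE; ring.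
have h2 := ginner_smooth i Xs Xx.
have E2 : ginner pb i xs - ginner pb i x - (xs - x) *m ginner' pb i x = s *: w.
  rewrite /w E !gA// -scalemxAl !scalerBr; congr (_ - _).
  by rewrite /xs mulmxDl -!scalemxAl; apply/rowP => j; rewrite !mxE; ring.
rewrite E2 E !norm2Z (gtr0_norm s0) exprMn in h2.
rewrite -(pmulr_rge0 _ s0); lra.
Qed.

Lemma ginner_lin_le i v x x' : norm2 v <= M -> X pb x -> X pb x' ->
  dotv v (ginner pb i x') <= dotv v (ginner pb i x)
    + dotv v ((x' - x) *m ginner' pb i x) + M * lam / 2 * norm2 (x' - x) ^+ 2.
Proof.
move=> vM Xx Xx'.
have := cauchy_schwarz v (ginner pb i x' - ginner pb i x - (x' - x) *m ginner' pb i x).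
have := ginner_smooth i Xx' Xx; set w := norm2 (_ - _ - _) => h1.
have w0 : 0 <= w by exact: norm2_ge0.
rewrite 2!dotvBr => h2.
have : norm2 v * w <= M * (lam / 2 * norm2 (x' - x) ^+ 2).
  by apply: ler_pM => //; exact: norm2_ge0.
lra.
Qed.

Definition rdom : set 'rV[R]_d := [set x | X pb x /\ (reg pb x < +oo)%E].
Definition rreg x : R := fine (reg pb x).

Lemma regE x : rdom x -> reg pb x = (rreg x)%:E.
Proof.
move=> [Xx rx]; rewrite fineK// fin_numE (lt_eqF rx) andbT; apply/eqP.
by case: hdom => _ _ [h _] _ _; apply/eqP; exact: h.
Qed.

(** Since [mu] is nonnegative, convexity of the squared norm lets the quadratic term be dropped. The
    same inequality shows that [reg] is finite at the intermediate point. *)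
Lemma rconvex_rreg : rconvex_on rdom rreg.
Proof.
move=> u v t Ku Kv t01; have [Xu _] := Ku; have [Xv _] := Kv.
case: hdom => _ _ _ _ [mu0 sc].
have := sc u v t Xu Xv t01; rewrite /= (regE Ku) (regE Kv).
set w := t *: u + _; have Xw : X pb w by exact: X_convex.
rewrite -!EFinB -!EFinM -EFinD => h.
have rw : (reg pb w < +oo)%E.
  by rewrite ltey; apply/eqP => rw; move: h; rewrite rw /= leye_eq.
have Kw : rdom w by [].
split=> //; move: h; rewrite regE// -EFinB lee_fin => h.
have : norm2 w ^+ 2 <= t * norm2 u ^+ 2 + (1 - t) * norm2 v ^+ 2.
  rewrite !norm2_sqr /w dotvvD !dotvZl !dotvZr.
  case/andP: t01 => t0 t1; have t1' : 0 <= 1 - t by rewrite subr_ge0.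
  have := mulr_ge0 (mulr_ge0 t0 t1') (dotvv_ge0 (u - v)); rewrite dotvvB; lra.
move=> /(ler_wpM2l mu0); lra.
Qed.

Definition robj x : R := n%:R^-1 * (\sum_(i < n) fouter pb i (ginner pb i x)) + rreg x.

Lemma objectiveE x : rdom x -> objective pb x = (robj x)%:E.
Proof. by move=> Kx; rewrite /objective regE. Qed.

Lemma argmin_objective_rdom xs : argmin_on (X pb) (objective pb) xs -> rdom xs.
Proof.
move=> [Xxs hmin]; split=> //.
case: hdom => _ _ [_ [x Xx rx]] _ _.
have Kx : rdom x by [].
have := hmin x Xx; rewrite (objectiveE Kx) /objective.
by rewrite ltey => h; apply/eqP => rw; move: h; rewrite rw /= leye_eq.
Qed.

(** The conjugate is a supremum of affine functions, so compactness of [Ydom] applies. Existence is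
    needed for unsampled blocks, for which a run supplies no proximal point. *)
Lemma Ydom_argmax_exists i (z gt : 'rV[R]_m) (c : R) : (exists v, Ydom pb i v) ->
  exists2 p, Ydom pb i p & forall v, Ydom pb i v ->
   rconj (fouter pb i) p + dotv (- gt) p + c / 2 * dotv (p - z) (p - z)
   <= rconj (fouter pb i) v + dotv (- gt) v + c / 2 * dotv (v - z) (v - z).
Proof.
move=> [v0 Yv0]; have [_ _ _ cY] := hout i.
apply: (@compact_min_sup_continuous _ _ _ 'rV[R]_m
  (fun u v => dotv v u - fouter pb i u + dotv v (- gt) + c / 2 * dotv (v - z) (v - z))
  _ v0 cY Yv0) => [u v|v u Yv|v e Yv lt].
- have h1 := cvgB (@continuous_dotvl _ _ u v)
    (@cvg_cst _ (fouter pb i u) _ (nbhs v) (nbhs_filter v)).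
  have h2 := cvgM (@cvg_cst _ (c / 2) _ (nbhs v) (nbhs_filter v)) (@continuous_dotvv _ _ z v).
  have F := nbhs_filter v.
  exact: (cvgD (cvgD (h1 F) (@continuous_dotvl _ _ (- gt) v)) (h2 F)).
- by rewrite (dotvC (- gt)) !lerD2r fenchel_young.
- have lt' : e - dotv (- gt) v - c / 2 * dotv (v - z) (v - z) < rconj (fouter pb i) v.
    by lra.
  have [u hu] := rconj_lt_ex Yv lt'; exists u; rewrite (dotvC v (- gt)); lra.
Qed.

End ProblemFacts.

Lemma ler_sum_telescope {R : realType} T (A B Phi : nat -> R) :
  (forall t, (t < T)%N -> A t <= Phi t - Phi t.+1 + B t) ->
  \sum_(t < T) A t <= Phi 0%N - Phi T + \sum_(t < T) B t.
Proof.
elim: T => [|T IH] h; first by rewrite !big_ord0 subrr addr0.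
rewrite !big_ord_recr/=.
have := IH (fun t tT => h t (ltnW tT)); have := h T (ltnSn T); lra.
Qed.

Lemma ler_sum_shift {R : realType} T (A : nat -> R) :
  (forall t, 0 <= A t) ->
  \sum_(t < T) (if (t : nat) is t'.+1 then A t' else 0) <= \sum_(t < T) A t.
Proof.
move=> A0; case: T => [|T]; first by rewrite !big_ord0.
rewrite big_ord_recl/= add0r big_ord_recr/= lerDl.
exact: A0.
Qed.

(** * Pathwise bound *)

Section DualStep.
Context {R : realType} {m : nat}.
Variables (yt y yb g1 g g0 gt : 'rV[R]_m) (sel : bool) (tau rho gam D1 D0 : R).
Hypotheses (tau0 : 0 < tau).
Hypotheses (hD1 : norm2 (g1 - g) <= gam * D1) (hD0 : norm2 (g - g0) <= gam * D0).
Let y' := if sel then yb else y.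
Let q := yb - y.
Let nu := gt - (g *+ 2 - g0).
Let xi := (1 - rho * sel%:R) *: q.

(** With [g1], [g], [g0] the inner values at times t+1, t, t-1, extrapolation turns [g1 - gt] into
    [(g1 - g) - (g - g0) - nu], so the inner products telescope up to [y' - yb] and [q]. The squared
    distances telescope along the sampled iterate [y'] once weighted by [rho]; [xi] is the resulting
    discrepancy. *)
Lemma dual_step :
  dotv (yt - yb) (g1 - gt) + tau / 2 *
     (dotv (yt - y) (yt - y) - dotv (yt - yb) (yt - yb) - dotv (yb - y) (yb - y))
  <= (tau / 2 * rho * dotv (yt - y) (yt - y) - dotv (yt - y) (g - g0))
     - (tau / 2 * rho * dotv (yt - y') (yt - y') - dotv (yt - y') (g1 - g))
     + (tau * dotv (yt - y) xi - dotv (yt - y) nu - tau / 4 * dotv q q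
        - tau / 2 * ((1 - rho * sel%:R) * dotv q q) + 2 / tau * dotv nu nu
        + 4 * gam ^+ 2 / tau * (D1 ^+ 2 + D0 ^+ 2)).
Proof.
have t0 : tau != 0 by rewrite gt_eqF.
have q0 := norm2_ge0 q.
have e1 : dotv (y' - yb) (g1 - g) <= norm2 q * norm2 (g1 - g).
  rewrite (le_trans (cauchy_schwarz _ _))// ler_wpM2r ?norm2_ge0// /y'.
  case: sel; first by rewrite subrr norm20 norm2_ge0.
  by rewrite norm2_distC.
(* Of the [tau / 2 * dotv q q] left over after the centred part is split off, two uses of this bound
   take [tau / 16] each and [en] takes [tau / 8]; [tau / 4] remains. *)
have young D : 0 <= norm2 q * (gam * D) ->
    norm2 q * (gam * D) <= tau / 16 * dotv q q + 4 * gam ^+ 2 / tau * D ^+ 2.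
  move=> _; rewrite -norm2_sqr -subr_ge0.
  have -> : tau / 16 * norm2 q ^+ 2 + 4 * gam ^+ 2 / tau * D ^+ 2 -
     norm2 q * (gam * D) = (tau * norm2 q / 4 - 2 * gam * D) ^+ 2 / tau by field.
  by rewrite divr_ge0 ?sqr_ge0// ltW.
have {}e1 : dotv (y' - yb) (g1 - g) <=
    tau / 16 * dotv q q + 4 * gam ^+ 2 / tau * D1 ^+ 2.
  have le : norm2 q * norm2 (g1 - g) <= norm2 q * (gam * D1) by rewrite ler_wpM2l.
  apply: (le_trans e1); apply: (le_trans le); apply: young.
  by apply: le_trans le; rewrite mulr_ge0 ?norm2_ge0.
have e0 : dotv q (g - g0) <=
    tau / 16 * dotv q q + 4 * gam ^+ 2 / tau * D0 ^+ 2.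
  have le : norm2 q * norm2 (g - g0) <= norm2 q * (gam * D0) by rewrite ler_wpM2l.
  apply: (le_trans (cauchy_schwarz _ _)); apply: (le_trans le); apply: young.
  by apply: le_trans le; rewrite mulr_ge0 ?norm2_ge0.
have en : dotv q nu <= tau / 8 * dotv q q + 2 / tau * dotv nu nu.
  have c0 : 0 < tau / 4 by rewrite divr_gt0.
  have := dotv_young q nu c0.
  have -> : tau / 4 / 2 = tau / 8 by field.
  by have -> : (2 * (tau / 4))^-1 = 2 / tau by field.
have -> : g1 - gt = (g1 - g) - (g - g0) - nu.
  by rewrite /nu; apply/rowP => j; rewrite !mxE; ring.
have -> : yt - yb = (yt - y) - q by rewrite /q opprB addrA subrK.
have E : (yt - y) - q = (yt - y') + (y' - yb).
  by rewrite /q; apply/rowP => j; rewrite !mxE; ring.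
rewrite 2!dotvBr {1}E dotvDl.
rewrite [dotv (_ - q) (g - g0)]dotvBl [dotv (_ - q) nu]dotvBl.
rewrite [dotv (_ - q) (_ - q)]dotvvB -/q.
have -> : dotv (yt - y') (yt - y') =
    dotv (yt - y) (yt - y) - 2 * (sel%:R * dotv (yt - y) q) + sel%:R * dotv q q.
  rewrite /y'; case: sel; last by rewrite !mul0r mulr0 subr0 addr0.
  by rewrite !mul1r -dotvvB /q; congr (dotv _ _); apply/rowP => j; rewrite !mxE; ring.
rewrite /xi dotvZr; move: e1 e0 en.
move: (dotv (yt - y') _) (dotv (y' - yb) _) (dotv q q) (dotv q nu) (dotv q (g - g0)).
move: (dotv nu nu) (dotv _ _) (dotv _ _) (dotv _ _) (dotv _ _).
move: (4 * gam ^+ 2 / tau) (2 / tau) (sel%:R : R) => *.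
lra.
Qed.

End DualStep.

Section DualSum.
Context {R : realType} {m : nat}.
Variables (T : nat) (yt y0 : 'rV[R]_m) (y yb nu : nat -> 'rV[R]_m).
Variables (sel : nat -> bool) (tau rho : R).
Hypotheses (tau0 : 0 < tau) (rho0 : 0 < rho).
Let q t := yb t - y t.
Let xi t := (1 - rho * (sel t)%:R) *: q t.

(* Young's inequality against the sums of the noise vectors: the comparator
   [yt] is correlated with the noise, so that only the centred parts
   [dotv (y t - y0) _] have zero mean. *)
Lemma dual_noise_sum :
  \sum_(t < T) (tau * dotv (yt - y t) (xi t) - dotv (yt - y t) (nu t)) <=
  (2 * tau * rho + tau / 2) * dotv (yt - y0) (yt - y0)
  + tau / (8 * rho) * dotv (\sum_(t < T) xi t) (\sum_(t < T) xi t)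
  + (2 * tau)^-1 * dotv (\sum_(t < T) nu t) (\sum_(t < T) nu t)
  - tau * \sum_(t < T) dotv (y t - y0) (xi t)
  + \sum_(t < T) dotv (y t - y0) (nu t).
Proof.
have -> : \sum_(t < T) (tau * dotv (yt - y t) (xi t) - dotv (yt - y t) (nu t)) =
   tau * dotv (yt - y0) (\sum_(t < T) xi t) - dotv (yt - y0) (\sum_(t < T) nu t)
  - tau * \sum_(t < T) dotv (y t - y0) (xi t)
  + \sum_(t < T) dotv (y t - y0) (nu t).
  rewrite !dotv_sumr !mulr_sumr -!sumrB -big_split/=; apply: eq_bigr => t _.
  have -> : yt - y t = (yt - y0) - (y t - y0) by rewrite opprB addrA subrK.
  rewrite !(dotvBl (yt - y0)); ring.
(* The second moment of the summed [xi] will be at most [rho] times the total squared movement. The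
   parameter [4 * rho] thus costs [tau / 8] of the [tau / 4] kept by [dual_step]. *)
have h1 := @dotv_young _ _ (4 * rho) (yt - y0) (\sum_(t < T) xi t)
  (mulr_gt0 (ltr0n _ 4) rho0).
have h2 := @dotv_young _ _ tau (yt - y0) (- \sum_(t < T) nu t) tau0.
move: h2; rewrite !dotvNr dotvNl opprK => h2.
have {h1} : tau * dotv (yt - y0) (\sum_(t < T) xi t) <=
  2 * tau * rho * dotv (yt - y0) (yt - y0)
  + tau / (8 * rho) * dotv (\sum_(t < T) xi t) (\sum_(t < T) xi t).
  move: h1; rewrite -(ler_pM2l tau0) => h1; apply: (le_trans h1).
  rewrite mulrDr !mulrA; apply: lerD.
    by rewrite le_eqVlt; apply/orP; left; apply/eqP; field.
  by rewrite le_eqVlt; apply/orP; left; apply/eqP; field; rewrite gt_eqF.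
lra.
Qed.

End DualSum.

Section Pathwise.
Context {R : realType} {d m n : nat} (pb : fcco R d m n).
Variables (M gam lam eta tau : R) (Sz T : nat) (xs : 'rV[R]_d).
Variables (x G : nat -> 'rV[R]_d) (y yb gt : nat -> 'I_n -> 'rV[R]_m).
Variables (sel : nat -> {set 'I_n}) (yt : 'I_n -> 'rV[R]_m).
Let g := ginner pb.
Let rc i := rconj (fouter pb i).
Let rr := rreg pb.
Let D t := norm2 (x t.+1 - x t).
Let rho : R := n%:R / Sz%:R.
Let q t i := yb t i - y t i.
Let xi t i := (1 - rho * (i \in sel t)%:R) *: q t i.
Let nu t i := gt t i - (g i (x t) *+ 2 - g i (x t.-1)).
Let e t := G t - n%:R^-1 *: \sum_(i < n) yb t i *m (ginner' pb i (x t))^T.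

Hypotheses (Sz0 : (0 < Sz)%N) (n0 : (0 < n)%N) (T0 : (0 < T)%N).
Hypotheses (M0 : 0 <= M) (gam0 : 0 <= gam) (eta0 : 0 < eta) (tau0 : 0 < tau).
Hypotheses (XK : forall u v (t : R), X pb u -> X pb v -> 0 <= t <= 1 ->
  X pb (t *: u + (1 - t) *: v)).
Hypotheses (glip : forall i u v, X pb u -> X pb v ->
  norm2 (g i u - g i v) <= gam * norm2 (u - v)).
Hypotheses (gge : forall i v u w, Ydom pb i v -> X pb u -> X pb w ->
  dotv v (g i u) + dotv v ((w - u) *m ginner' pb i u) <= dotv v (g i w)).
Hypotheses (gle : forall i v u w, norm2 v <= M -> X pb u -> X pb w ->
  dotv v (g i w) <= dotv v (g i u) + dotv v ((w - u) *m ginner' pb i u)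
    + M * lam / 2 * norm2 (w - u) ^+ 2).
Hypotheses (Ybd : forall i v, Ydom pb i v -> norm2 v <= M).
Hypotheses (cr : rconvex_on (rdom pb) rr).
Hypotheses (Kxs : rdom pb xs) (Xx : forall t, (t <= T)%N -> X pb (x t)).
Hypotheses (Kx : forall t, (t < T)%N -> rdom pb (x t.+1)).
Hypotheses (Yyt : forall i, Ydom pb i (yt i)).
Hypotheses (Yy : forall t i, (t <= T)%N -> Ydom pb i (y t i)).
Hypotheses (Yyb : forall t i, (t < T)%N -> Ydom pb i (yb t i)).
Hypotheses (ystep : forall t i, (t < T)%N ->
  y t.+1 i = if i \in sel t then yb t i else y t i).
Hypotheses (dual : forall t i v, (t < T)%N -> Ydom pb i v ->
  rc i (yb t i) + dotv (- gt t i) (yb t i)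
   + tau / 2 * dotv (yb t i - y t i) (yb t i - y t i)
   + tau / 2 * dotv (v - yb t i) (v - yb t i)
  <= rc i v + dotv (- gt t i) v + tau / 2 * dotv (v - y t i) (v - y t i)).
Hypotheses (primal : forall t, (t < T)%N ->
  rr (x t.+1) + dotv (G t) (x t.+1)
   + eta / 2 * dotv (x t.+1 - x t) (x t.+1 - x t)
   + eta / 2 * dotv (xs - x t.+1) (xs - x t.+1)
  <= rr xs + dotv (G t) xs + eta / 2 * dotv (xs - x t) (xs - x t)).
Hypotheses (absorb : 8 * gam ^+ 2 / tau + M * lam / 2 + eta / 16 <= eta / 4).

Let xb := T%:R^-1 *: \sum_(t < T) x t.+1.
Let h z := n%:R^-1 * \sum_(i < n) (dotv (yt i) (g i z) - rc i (yt i)) + rr z.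

(** Two lower linearisations at the intermediate point are averaged and their linear parts cancel.
    This route also covers affine [g i], where [yt i] may have negative coordinates. *)
Let rconvex_h : rconvex_on (rdom pb) h.
Proof.
apply: rconvex_add => // u v t Ku Kv t01.
have [Kw _] := cr Ku Kv t01; split=> //.
case: Ku Kv Kw => [Xu _] [Xv _] [Xw _].
rewrite !(mulrCA _ n%:R^-1) -mulrDr ler_wpM2l// !mulr_sumr -big_split/=.
apply: ler_sum => i _; set w := _ + _ in Xw *.
have := gge (Yyt i) Xw Xu; have := gge (Yyt i) Xw Xv.
case/andP: t01 => t0 t1; have t1' : 0 <= 1 - t by rewrite subr_ge0.
move=> /(ler_wpM2l t1') h1 /(ler_wpM2l t0) h2.
have : t * dotv (yt i) ((u - w) *m ginner' pb i w)
     + (1 - t) * dotv (yt i) ((v - w) *m ginner' pb i w) = 0.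
  rewrite -!dotvZr -dotvDr !scalemxAl -mulmxDl.
  have -> : t *: (u - w) + (1 - t) *: (v - w) = 0.
    by rewrite /w; apply/rowP => j; rewrite !mxE; ring.
  by rewrite mul0mx dotv0.
lra.
Qed.

Let Lag t := h (x t.+1)
  - (n%:R^-1 * (\sum_(i < n) (dotv (yb t i) (g i xs) - rc i (yb t i))) + rr xs).

Lemma xbar_rdom : rdom pb xb.
Proof. by have [] := jensen_mean T0 rconvex_h Kx. Qed.

Let gap_le_Lag :
  (forall i, fouter pb i (g i xb) <= dotv (yt i) (g i xb) - rc i (yt i)) ->
  T%:R * (robj pb xb - robj pb xs) <= \sum_(t < T) Lag t.
Proof.
move=> hyt; have [_ hj] := jensen_mean T0 rconvex_h Kx.
have TV : 0 < T%:R :> R by rewrite ltr0n.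
have h1 : robj pb xb <= h xb by rewrite lerD2r ler_wpM2l// ler_sum.
have h2 : T%:R * h xb <= \sum_(t < T) h (x t.+1).
  by move: hj; rewrite -(ler_pM2l TV) mulrA (divff (lt0r_neq0 TV)) mul1r.
have h3 t : (t < T)%N -> n%:R^-1 *
    (\sum_(i < n) (dotv (yb t i) (g i xs) - rc i (yb t i))) + rr xs <= robj pb xs.
  move=> tT; rewrite lerD2r ler_wpM2l// ler_sum// => i _.
  have := fenchel_young (g i xs) (Yyb i tT); rewrite -/(rc i) -/g; lra.
rewrite sumrB mulrBr; apply: lerB.
  by apply: le_trans h2; rewrite ler_wpM2l.
apply: (@le_trans _ _ (\sum_(t < T) robj pb xs)).
  by apply: ler_sum => t _; exact: h3.
by rewrite sumr_const card_ord mulr_natl.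
Qed.

(** The part of the one-step gap on block [i] that is left to [dual_step]. *)
Let L t i := dotv (yt i - yb t i) (g i (x t.+1) - gt t i) + tau / 2 *
  (dotv (yt i - y t i) (yt i - y t i) - dotv (yt i - yb t i) (yt i - yb t i)
   - dotv (yb t i - y t i) (yb t i - y t i)).

(** At [yb t i], convexity bounds the inner value at [xs] from below and smoothness bounds the one
    at [x t.+1] from above, both through the linearisation at [x t]. Averaging these over blocks
    produces exactly [G t - e t]. *)
Let Lag_le t : (t < T)%N ->
  Lag t <= n%:R^-1 * (\sum_(i < n) L t i) + M * lam / 2 * D t ^+ 2
   + dotv (e t) (xs - x t) + eta^-1 * dotv (e t) (e t) - eta / 4 * D t ^+ 2
   + eta / 2 * (dotv (xs - x t) (xs - x t) - dotv (xs - x t.+1) (xs - x t.+1)).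
Proof.
move=> tT; have [Xxs _] := Kxs.
have Xt := Xx (ltnW tT); have Xt1 := Xx tT.
pose ga i := dotv (yb t i *m (ginner' pb i (x t))^T) (x t.+1 - xs).
have hi i : (dotv (yt i) (g i (x t.+1)) - rc i (yt i))
    - (dotv (yb t i) (g i xs) - rc i (yb t i))
    <= L t i + M * lam / 2 * D t ^+ 2 + ga i.
  have h1 := dual tT (Yyt i).
  have h2 := gge (Yyb i tT) Xt Xxs.
  have h3 := gle i (Ybd (Yyb i tT)) Xt Xt1.
  have -> : ga i = dotv (yb t i) ((x t.+1 - x t) *m ginner' pb i (x t))
                 - dotv (yb t i) ((xs - x t) *m ginner' pb i (x t)).
    rewrite /ga dotv_mulmx -dotvBr -mulmxBl; congr (dotv _ (_ *m _)).
    by apply/rowP => j; rewrite !mxE; ring.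
  move: h1 h2 h3; rewrite /L !dotvNl !(dotvBl (yt i) (yb t i)) !dotvBr.
  rewrite (dotvC (gt t i)) (dotvC (gt t i)) /D.
  set E1 := _ * norm2 _ ^+ 2; lra.
have hs : n%:R^-1 * (\sum_(i < n) ((dotv (yt i) (g i (x t.+1)) - rc i (yt i))
    - (dotv (yb t i) (g i xs) - rc i (yb t i)))) <=
    n%:R^-1 * (\sum_(i < n) L t i) + M * lam / 2 * D t ^+ 2
    + n%:R^-1 * \sum_(i < n) ga i.
  have -> : n%:R^-1 * (\sum_(i < n) L t i) + M * lam / 2 * D t ^+ 2
    + n%:R^-1 * \sum_(i < n) ga i =
    n%:R^-1 * \sum_(i < n) (L t i + M * lam / 2 * D t ^+ 2 + ga i).
    rewrite !big_split/= !mulrDr sumr_const card_ord.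
    by rewrite -[X in _ = _ + _ * X + _]mulr_natl mulKf// pnatr_eq0 -lt0n.
  by rewrite ler_wpM2l// ler_sum.
have Ee : n%:R^-1 * (\sum_(i < n) ga i) = dotv (G t - e t) (x t.+1 - xs).
  by rewrite /e subKr dotvZl dotv_suml.
have hp := primal tT.
(* Half of the primal movement [eta / 2 * D t ^+ 2] pays for the direction error; [eta / 4] is kept
   for [absorb]. *)
have hy := @dotv_young _ _ (2 / eta) (e t) (x t - x t.+1) (divr_gt0 (ltr0n _ 2) eta0).
have E1 : 2 / eta / 2 = eta^-1 by field; rewrite gt_eqF.
have E2 : (2 * (2 / eta))^-1 = eta / 4 by field; rewrite gt_eqF.
rewrite E1 E2 (dotvv_distC (x t)) in hy.
rewrite Ee dotvBl in hs.
move: hs hp hy; rewrite /Lag /h sumrB mulrBr /D norm2_sqr.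
have -> : dotv (e t) (x t.+1 - xs) = - dotv (e t) (xs - x t) - dotv (e t) (x t - x t.+1).
  rewrite -dotvNr -dotvBr; congr (dotv _ _).
  by apply/rowP => j; rewrite !mxE; ring.
rewrite (dotvBr _ _ (G t)); lra.
Qed.

(** Noise terms are kept exact, so that means can be taken one by one afterwards. The factor
    [5 / 2 * tau * rho] is [2 * tau * rho] from [dual_noise_sum] plus the initial potential
    [tau / 2 * rho]. *)
Lemma pathwise_gap :
  (forall i, fouter pb i (g i xb) <= dotv (yt i) (g i xb) - rc i (yt i)) ->
  T%:R * (robj pb xb - robj pb xs) <=
  n%:R^-1 * \sum_(i < n) (
     (5 / 2 * tau * rho + tau / 2) * dotv (yt i - y 0%N i) (yt i - y 0%N i)
     + tau / (8 * rho) * dotv (\sum_(t < T) xi t i) (\sum_(t < T) xi t i)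
     + (2 * tau)^-1 * dotv (\sum_(t < T) nu t i) (\sum_(t < T) nu t i)
     - tau * \sum_(t < T) dotv (y t i - y 0%N i) (xi t i)
     + \sum_(t < T) dotv (y t i - y 0%N i) (nu t i)
     + \sum_(t < T) (- (tau / 4 * dotv (q t i) (q t i))
         - tau / 2 * ((1 - rho * (i \in sel t)%:R) * dotv (q t i) (q t i))
         + 2 / tau * dotv (nu t i) (nu t i)))
  + \sum_(t < T) (dotv (e t) (xs - x t) + eta^-1 * dotv (e t) (e t))
  + eta / 2 * dotv (xs - x 0%N) (xs - x 0%N) + 16 * M ^+ 2 * gam ^+ 2 / eta.
Proof.
move=> hyt; apply: (le_trans (gap_le_Lag hyt)).
have rho0 : 0 < rho by rewrite divr_gt0// ltr0n.
(* Since [0.-1 = 0], the movement preceding the first step is zero, matching x_{-1} = x_0. *)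
pose Dm (t : nat) := if t is t'.+1 then D t' else 0.
pose Phi i t := tau / 2 * rho * dotv (yt i - y t i) (yt i - y t i)
  - dotv (yt i - y t i) (g i (x t) - g i (x t.-1)).
pose B i t := tau * dotv (yt i - y t i) (xi t i) - dotv (yt i - y t i) (nu t i)
   + (- (tau / 4 * dotv (q t i) (q t i))
      - tau / 2 * ((1 - rho * (i \in sel t)%:R) * dotv (q t i) (q t i))
      + 2 / tau * dotv (nu t i) (nu t i))
   + 4 * gam ^+ 2 / tau * (D t ^+ 2 + Dm t ^+ 2).
have hL i t : (t < T)%N -> L t i <= Phi i t - Phi i t.+1 + B i t.
  move=> tT.
  have l1 : norm2 (g i (x t.+1) - g i (x t)) <= gam * D t.
    exact: (glip i (Xx tT) (Xx (ltnW tT))).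
  have l0 : norm2 (g i (x t) - g i (x t.-1)) <= gam * Dm t.
    case: t tT {l1} => [|t] tT /=; first by rewrite subrr norm20 mulr0.
    exact: (glip i (Xx (ltnW tT)) (Xx (ltnW (ltnW tT)))).
  have := dual_step (yt i) (y t i) (yb t i) (gt t i) (i \in sel t) rho tau0 l1 l0.
  rewrite /L /Phi /B (ystep i tT) /= -/(q t i) -/(nu t i) -/(xi t i); lra.
have SD0 : 0 <= \sum_(t < T) D t ^+ 2 by apply: sumr_ge0 => t _; rewrite sqr_ge0.
have SDm : \sum_(t < T) Dm t ^+ 2 <= \sum_(t < T) D t ^+ 2.
  have := @ler_sum_shift _ T (fun t => D t ^+ 2) (fun t => sqr_ge0 _).
  congr (_ <= _); apply: eq_bigr => -[[|t] tT] _ //=.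
  by rewrite /Dm/= expr0n.
have g2t : 0 <= 4 * gam ^+ 2 / tau by rewrite divr_ge0 ?mulr_ge0 ?sqr_ge0// ltW.
(* The inner product surviving at the end of the telescoping sum. The dual variables lie in a ball
   of radius [M], and the last movement is charged to [eta / 16] of the total. *)
have last i : dotv (yt i - y T i) (g i (x T) - g i (x T.-1)) <=
    eta / 16 * (\sum_(t < T) D t ^+ 2) + 16 * M ^+ 2 * gam ^+ 2 / eta.
  apply: (le_trans (cauchy_schwarz _ _)).
  have h1 : norm2 (yt i - y T i) <= 2 * M.
    apply: (le_trans (norm2B_le _ _)).
    have := Ybd (Yyt i); have := Ybd (Yy i (leqnn T)); lra.
  have [T' TE] : exists T', T = T'.+1 by exists T.-1; rewrite prednK.
  have h2 : norm2 (g i (x T) - g i (x T.-1)) <= gam * D T'.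
    by rewrite TE; apply: (glip i); apply: Xx; rewrite TE.
  have h3 : D T' ^+ 2 <= \sum_(t < T) D t ^+ 2.
    rewrite TE big_ord_recr/= lerDr; apply: sumr_ge0 => t _; exact: sqr_ge0.
  have h4 : norm2 (yt i - y T i) * norm2 (g i (x T) - g i (x T.-1)) <= 2 * M * (gam * D T').
    by apply: ler_pM => //; exact: norm2_ge0.
  apply: (le_trans h4).
  have h5 : eta / 16 * D T' ^+ 2 <= eta / 16 * \sum_(t < T) D t ^+ 2.
    by rewrite ler_wpM2l// divr_ge0// ltW.
  have h6 : 2 * M * (gam * D T') <= eta / 16 * D T' ^+ 2 + 16 * M ^+ 2 * gam ^+ 2 / eta.
    rewrite -subr_ge0.
    have -> : eta / 16 * D T' ^+ 2 + 16 * M ^+ 2 * gam ^+ 2 / eta - 2 * M * (gam * D T')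
      = (eta * D T' / 4 - 4 * M * gam) ^+ 2 / eta by field; rewrite gt_eqF.
    by rewrite divr_ge0 ?sqr_ge0// ltW.
  lra.
pose W i := (5 / 2 * tau * rho + tau / 2) * dotv (yt i - y 0%N i) (yt i - y 0%N i)
     + tau / (8 * rho) * dotv (\sum_(t < T) xi t i) (\sum_(t < T) xi t i)
     + (2 * tau)^-1 * dotv (\sum_(t < T) nu t i) (\sum_(t < T) nu t i)
     - tau * \sum_(t < T) dotv (y t i - y 0%N i) (xi t i)
     + \sum_(t < T) dotv (y t i - y 0%N i) (nu t i)
     + \sum_(t < T) (- (tau / 4 * dotv (q t i) (q t i))
         - tau / 2 * ((1 - rho * (i \in sel t)%:R) * dotv (q t i) (q t i))
         + 2 / tau * dotv (nu t i) (nu t i)).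
pose Q := (8 * gam ^+ 2 / tau + eta / 16) * (\sum_(t < T) D t ^+ 2)
          + 16 * M ^+ 2 * gam ^+ 2 / eta.
have hW i : \sum_(t < T) L t i <= W i + Q.
  apply: (le_trans (ler_sum_telescope (hL i))).
  have -> : \sum_(t < T) B i t =
      \sum_(t < T) (tau * dotv (yt i - y t i) (xi t i) - dotv (yt i - y t i) (nu t i))
      + \sum_(t < T) (- (tau / 4 * dotv (q t i) (q t i))
          - tau / 2 * ((1 - rho * (i \in sel t)%:R) * dotv (q t i) (q t i))
          + 2 / tau * dotv (nu t i) (nu t i))
      + 4 * gam ^+ 2 / tau * (\sum_(t < T) D t ^+ 2 + \sum_(t < T) Dm t ^+ 2).
    rewrite mulrDr !mulr_sumr -!big_split/=; apply: eq_bigr => t _.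
    by rewrite /B; ring.
  have noise : \sum_(t < T) (tau * dotv (yt i - y t i) (xi t i) - dotv (yt i - y t i) (nu t i))
    <= (2 * tau * rho + tau / 2) * dotv (yt i - y 0%N i) (yt i - y 0%N i)
     + tau / (8 * rho) * dotv (\sum_(t < T) xi t i) (\sum_(t < T) xi t i)
     + (2 * tau)^-1 * dotv (\sum_(t < T) nu t i) (\sum_(t < T) nu t i)
     - tau * \sum_(t < T) dotv (y t i - y 0%N i) (xi t i)
     + \sum_(t < T) dotv (y t i - y 0%N i) (nu t i).
    exact: (dual_noise_sum T (yt i) (y 0%N i) (y^~ i) (yb^~ i) (nu^~ i)
      (fun t => i \in sel t) tau0 rho0).
  move: noise; rewrite /Phi /= subrr dotv0 subr0.
  have := last i.
  have : 0 <= tau / 2 * rho * dotv (yt i - y T i) (yt i - y T i).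
    by rewrite !mulr_ge0 ?dotvv_ge0// ltW.
  have := ler_wpM2l g2t SDm.
  rewrite /W /Q.
  have -> : 8 * gam ^+ 2 / tau = 2 * (4 * gam ^+ 2 / tau) by field; rewrite gt_eqF.
  move: (4 * gam ^+ 2 / tau) => *; lra.
have hA t : (t < T)%N -> Lag t <= eta / 2 * dotv (xs - x t) (xs - x t)
   - eta / 2 * dotv (xs - x t.+1) (xs - x t.+1)
   + (n%:R^-1 * (\sum_(i < n) L t i) + (M * lam / 2 - eta / 4) * D t ^+ 2
      + (dotv (e t) (xs - x t) + eta^-1 * dotv (e t) (e t))).
  by move=> tT; have := Lag_le tT; lra.
apply: (le_trans (ler_sum_telescope
  (Phi := fun t => eta / 2 * dotv (xs - x t) (xs - x t)) hA)).
have -> : \sum_(t < T) (n%:R^-1 * (\sum_(i < n) L t i) + (M * lam / 2 - eta / 4) * D t ^+ 2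
      + (dotv (e t) (xs - x t) + eta^-1 * dotv (e t) (e t))) =
    n%:R^-1 * (\sum_(i < n) \sum_(t < T) L t i)
    + (M * lam / 2 - eta / 4) * (\sum_(t < T) D t ^+ 2)
    + \sum_(t < T) (dotv (e t) (xs - x t) + eta^-1 * dotv (e t) (e t)).
  by rewrite exchange_big/= !mulr_sumr -!big_split/=.
have hWs : n%:R^-1 * (\sum_(i < n) \sum_(t < T) L t i) <= n%:R^-1 * (\sum_(i < n) W i) + Q.
  have -> : n%:R^-1 * (\sum_(i < n) W i) + Q = n%:R^-1 * (\sum_(i < n) (W i + Q)).
    rewrite [in RHS]big_split/= mulrDr sumr_const card_ord.
    by rewrite -[X in _ = _ + _ * X]mulr_natl mulKf// pnatr_eq0 -lt0n.
  by rewrite ler_wpM2l// ler_sum.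
(* The movement kept at [eta / 4] pays for extrapolation ([8 * gam ^+ 2 / tau], each increment being
   used twice), for smoothness ([M * lam / 2]) and for the boundary term ([eta / 16]). *)
have := ler_wpM2r SD0 absorb.
have : 0 <= eta / 2 * dotv (xs - x T) (xs - x T).
  by rewrite mulr_ge0 ?dotvv_ge0// divr_ge0// ltW.
move: hWs; rewrite /Q -/(\sum_(i < n) W i); lra.
Qed.

End Pathwise.

Definition mx_measurable {R : realType} {dO} {Om : measurableType dO} p k
    (f : Om -> 'M[R]_(p, k)) :=
  forall l j, measurable_fun setT (fun w => f w l j).

(** * Measurability and moments *)

Section MatrixMeasurability.
Context {R : realType} {dO : measure_display} {Om : measurableType dO}.

Lemma mx_measurable_cst p k (M : 'M[R]_(p, k)) :
  mx_measurable (fun _ : Om => M).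
Proof. by move=> l j; exact: measurable_cst. Qed.

Lemma mx_measurableD p k (f g : Om -> 'M[R]_(p, k)) :
  mx_measurable f -> mx_measurable g -> mx_measurable (fun w => f w + g w).
Proof.
move=> mf mg l j; under eq_fun do rewrite mxE.
by apply: measurable_funD; [exact: mf|exact: mg].
Qed.

Lemma mx_measurableZ p k (c : Om -> R) (f : Om -> 'M[R]_(p, k)) :
  measurable_fun setT c -> mx_measurable f -> mx_measurable (fun w => c w *: f w).
Proof.
move=> mc mf l j; under eq_fun do rewrite mxE.
by apply: measurable_funM => //; exact: mf.
Qed.

Lemma mx_measurableZc p k (c : R) (f : Om -> 'M[R]_(p, k)) :
  mx_measurable f -> mx_measurable (fun w => c *: f w).
Proof. by move=> mf; apply: mx_measurableZ => //; exact: measurable_cst. Qed.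

Lemma mx_measurableN p k (f : Om -> 'M[R]_(p, k)) :
  mx_measurable f -> mx_measurable (fun w => - f w).
Proof.
by move=> mf; under eq_fun do rewrite -scaleN1r; exact: mx_measurableZc.
Qed.

Lemma mx_measurableB p k (f g : Om -> 'M[R]_(p, k)) :
  mx_measurable f -> mx_measurable g -> mx_measurable (fun w => f w - g w).
Proof. by move=> mf mg; apply: mx_measurableD => //; exact: mx_measurableN. Qed.

Lemma mx_measurable_sum p k (I : Type) (s : seq I) (f : I -> Om -> 'M[R]_(p, k)) :
  (forall i, mx_measurable (f i)) ->
  mx_measurable (fun w => \sum_(i <- s) f i w).
Proof.
move=> mf l j; under eq_fun do rewrite summxE.
by apply: measurable_sum => i; exact: mf.
Qed.

Lemma mx_measurable_tr p k (f : Om -> 'M[R]_(p, k)) :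
  mx_measurable f -> mx_measurable (fun w => (f w)^T).
Proof. by move=> mf l j; under eq_fun do rewrite mxE; exact: mf. Qed.

Lemma mx_measurableM p k r (f : Om -> 'M[R]_(p, k)) (g : Om -> 'M[R]_(k, r)) :
  mx_measurable f -> mx_measurable g -> mx_measurable (fun w => f w *m g w).
Proof.
move=> mf mg l j; under eq_fun do rewrite mxE.
by apply: measurable_sum => i; apply: measurable_funM; [exact: mf|exact: mg].
Qed.

Lemma measurable_dotv k (f g : Om -> 'rV[R]_k) :
  mx_measurable f -> mx_measurable g ->
  measurable_fun setT (fun w => dotv (f w) (g w)).
Proof.
move=> mf mg; apply: measurable_sum => i.
by apply: measurable_funM; [exact: mf|exact: mg].
Qed.

(** An open set is the union of the countably many boxes with rational centre and radius
    [1 / (N + 1)] that it contains, and the preimage of a box is a finite intersection of coordinate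
    conditions. *)
Lemma mx_measurable_open k (f : Om -> 'rV[R]_k) (U : set 'rV[R]_k) :
  mx_measurable f -> open U -> measurable (f @^-1` U).
Proof.
move=> mf oU.
pose box (qn : 'rV[rat]_k * nat) : set 'rV[R]_k :=
  [set v | forall j, ball (ratr (qn.1 0 j) : R) (qn.2.+1%:R^-1) (v 0 j)].
pose V qn := if pselect (box qn `<=` U) then box qn else set0.
suff -> : f @^-1` U = \bigcup_qn (f @^-1` V qn).
  apply: countable_bigcupT_measurable => // qn.
  rewrite /V; case: pselect => ? /=; last by rewrite preimage_set0.
  have -> : f @^-1` box qn = \bigcap_(j in [set: 'I_k])
      (fun w => f w 0 j) @^-1` ball (ratr (qn.1 0 j) : R) (qn.2.+1%:R^-1).
    by apply/seteqP; split=> [w bw j _|w bw j]; [exact: bw|exact: bw].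
  apply: fin_bigcap_measurable => // j _.
  have := mf 0 j measurableT _ (measurable_ball (ratr (qn.1 0 j) : R) (qn.2.+1%:R^-1)).
  by rewrite setTI.
apply/seteqP; split=> [w Uw|w [qn _]]; last first.
  by rewrite /V /preimage /=; case: pselect => //= sub; exact: sub.
have /nbhs_ballP[e /= e0 eU] : nbhs (f w) U by exact: open_nbhs_nbhs.
pose N := Num.truncn (2 / e).
have NV : N.+1%:R^-1 < e / 2.
  rewrite -[ltRHS]invrK ltf_pV2 ?posrE ?invr_gt0 ?divr_gt0//.
  by rewrite invf_div truncnS_gt.
have NV0 : 0 < N.+1%:R^-1 :> R by rewrite invr_gt0.
have qj j : {q : rat | ball (ratr q : R) (N.+1%:R^-1) (f w 0 j)}.
  apply: cid; have [|q] := @rat_in_itvoo R (f w 0 j - N.+1%:R^-1) (f w 0 j + N.+1%:R^-1).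
    by rewrite ltrBlDr -addrA ltrDl addr_gt0.
  rewrite in_itv/= => /andP[h1 h2]; exists q.
  rewrite -ball_normE /ball_/= ltr_norml ltrBrDr addrC h1 /=.
  by rewrite ltrBlDr addrC.
exists (\row_j sval (qj j), N) => //; rewrite /V.
case: pselect => /= [?|]; first by move=> j; rewrite mxE; exact: (svalP (qj j)).
case=> v bv; apply: eU; split=> // i j; rewrite ord1.
move: (svalP (qj j)) (bv j); rewrite mxE /=; move: (sval (qj j)) => r.
rewrite -!ball_normE /ball_/= => h1 h2.
have -> : f w 0 j - v 0 j = (f w 0 j - ratr r) + (ratr r - v 0 j).
  by rewrite addrA subrK.
apply: (le_lt_trans (ler_normD _ _)); rewrite distrC [ltRHS]splitr.
by rewrite ltrD// (lt_trans _ NV).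
Qed.

(* The outputs of a proximal step are Lipschitz in its inputs, without knowing
   that the proximal map is defined everywhere. *)
Lemma mx_measurable_nonexpansive k l (f : Om -> 'rV[R]_k) (g : Om -> 'rV[R]_l) :
  mx_measurable f ->
  (forall w w', norm2 (g w - g w') <= norm2 (f w - f w')) -> mx_measurable g.
Proof.
move=> mf fg l0 j; rewrite (ord1 l0).
apply: (measurability _ (RGenInftyO.measurableE R)) => _ [_ [r ->] <-].
rewrite setTI.
(* Around each input whose output is below [r], the ball of radius equal to the slack cannot reach
   [r]. The union may be uncountable, but it is open. *)
pose V := \bigcup_(w in [set w | g w 0 j < r])
  [set v | dotv (v - f w) (v - f w) < (r - g w 0 j) ^+ 2].
have -> : (fun w => g w 0 j) @^-1` `]-oo, r[ = f @^-1` V.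
  apply/seteqP; split=> w /=; rewrite in_itv/=.
    by move=> lt; exists w => //=; rewrite subrr dotv0 exprn_gt0// subr_gt0.
  move=> [w0 /= lt]; rewrite -norm2_sqr ltr_pXn2r ?nnegrE ?norm2_ge0//; last first.
    by rewrite subr_ge0 ltW.
  move=> lt'; have := le_lt_trans (fg w w0) lt'.
  have := coord_le_norm2 (g w - g w0) j; rewrite !mxE => h1 h2.
  have := le_lt_trans h1 h2; have := ler_norm (g w 0 j - g w0 0 j); lra.
apply: mx_measurable_open => //; apply: bigcup_open => w /= _.
apply: (@open_comp _ _ (fun v : 'rV[R]_k => dotv (v - f w) (v - f w))
  [set a | a < (r - g w 0 j) ^+ 2]); last exact: open_lt.
by move=> p _; exact: continuous_dotvv.
Qed.

End MatrixMeasurability.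

Section OracleMeasurability.
Context {R : realType} {d m n : nat} (pb : fcco R d m n).
Context {dO : measure_display} {Om : measurableType dO}.
Hypotheses (cX : closed (X pb)) (mor : oracle_measurable pb).
Variables (i : 'I_n) (x : Om -> 'rV[R]_d) (z : Om -> Z pb i).
Hypotheses (mx : mx_measurable x) (Xx : forall w, X pb (x w)).
Hypotheses (mz : measurable_fun setT z).

Let D := [set p : d.-tuple R * Z pb i | X pb (\row_j tnth p.1 j)].
Let phi w : d.-tuple R * Z pb i := ([tuple x w 0 j | j < d], z w).

Let mD : measurable D.
Proof.
rewrite -[D]setCK; apply: measurableC.
apply: (@mx_measurable_open _ _ _ _
  (fun p : d.-tuple R * Z pb i => \row_j tnth p.1 j) (~` X pb)); last first.
  exact: closed_openC.
move=> l j; under eq_fun do rewrite mxE.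
exact: (measurableT_comp (measurable_tnth j) measurable_fst).
Qed.

Let mphi : measurable_fun setT phi.
Proof.
apply/measurable_fun_pairP; split=> //.
apply/measurable_fun_tnthP => j; rewrite (_ : _ \o _ = fun w => x w 0 j)//.
by apply/funext => w /=; rewrite tnth_mktuple.
Qed.

Let rowphi w : \row_j tnth (phi w).1 j = x w.
Proof. by apply/rowP => j; rewrite !mxE tnth_mktuple. Qed.

Let phiD : [set phi w | w in [set: Om]] `<=` D.
Proof. by move=> _ [w _ <-]; rewrite /D /= rowphi. Qed.

Lemma measurable_soracle k : measurable_fun setT (fun w => soracle pb i (x w) (z w) 0 k).
Proof.
have [h _] := mor i.
have := measurable_comp mD phiD (h k) mphi; congr measurable_fun.
by apply/funext => w /=; rewrite rowphi.
Qed.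

Lemma measurable_soracle' l k :
  measurable_fun setT (fun w => soracle' pb i (x w) (z w) l k).
Proof.
have [_ h] := mor i.
have := measurable_comp mD phiD (h l k) mphi; congr measurable_fun.
by apply/funext => w /=; rewrite rowphi.
Qed.

Lemma mx_measurable_soracle : mx_measurable (fun w => soracle pb i (x w) (z w)).
Proof. by move=> l k; rewrite (ord1 l); exact: measurable_soracle. Qed.

Lemma mx_measurable_soracle' : mx_measurable (fun w => soracle' pb i (x w) (z w)).
Proof. exact: measurable_soracle'. Qed.

End OracleMeasurability.

(** The integral of a nonnegative function is a supremum over the simple functions below it. This
    form applies to dual norms, operator norms and the objective gap, whose measurability is not
    established. *)
Lemma ge0_le_integralT {d} {T : measurableType d} {R : realType}
    (mu : {measure set T -> \bar R}) (f g : T -> \bar R) :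
  (forall x, (0 <= f x)%E) -> (forall x, (f x <= g x)%E) ->
  (\int[mu]_x f x <= \int[mu]_x g x)%E.
Proof.
move=> f0 fg; have g0 x : (0 <= g x)%E by exact: le_trans (fg x).
rewrite !ge0_integralTE//; apply: le_ereal_sup => _ [h hf <-].
by exists h => // x; exact: le_trans (fg x).
Qed.

(** * Integrating out one independent sample *)

Section Freezing.
Context {R : realType} {d d' : measure_display} {Om : measurableType d}
  {Zt : measurableType d'}.
Variables (P : probability Om R) (mu : probability Zt R) (z : Om -> Zt).
Variable G : set (set Om).
Let GT : measurableType _ := g_sigma_algebraType G.
Hypotheses (Gm : G `<=` measurable) (GI : setI_closed G) (GTt : G setT).
Hypothesis mz : measurable_fun setT z.
Hypothesis ind : forall A C, G A -> measurable C ->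
  P (A `&` z @^-1` C) = (P A * mu C)%E.

Let idG : Om -> GT := fun w => w.

Let midG : measurable_fun setT idG.
Proof.
move=> _ A mA; rewrite setTI; move: A mA.
by apply: smallest_sub => //; exact: sigma_algebra_measurable.
Qed.

Let idGf : {mfun Om >-> GT} := mfun_Sub (mem_set midG).
Let PG : probability GT R := distribution P idGf.

(** For fixed [C] both sides are finite measures in [A] that agree on [G], which is stable under
    intersection and contains the whole space. *)
Let ind_sigma (A : set GT) C : measurable A -> measurable C ->
  P (A `&` z @^-1` C) = (P A * mu C)%E.
Proof.
move=> mA mC.
have mzC : measurable (z @^-1` C) by rewrite -[X in measurable X]setTI; exact: mz.
have muC0 : 0 <= fine (mu C) by rewrite fine_ge0.
pose m1 := distribution P idGf.
pose m1' : {measure set GT -> \bar R} := pushforward (mrestr P mzC) idGf.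
pose m2 : {measure set GT -> \bar R} := mscale (NngNum muC0) m1.
have E B : m1' midG B = P (B `&` z @^-1` C) by [].
have E2 B : m2 B = (P B * mu C)%E.
  rewrite /m2 /mscale/= muleC; congr (_ * _)%E.
  by rewrite fineK// fin_num_measure.
rewrite -E -E2.
apply: (@measure_unique _ R GT G (fun=> setT) _ _ _ _ (m1' midG) m2) => //.
- by rewrite bigcup_const.
- by move=> B GB; rewrite E E2 ind.
- move=> _; rewrite E setTI.
  by rewrite (le_lt_trans (probability_le1 _ _)) ?ltry.
Qed.

Let phi w : GT * Zt := (idG w, z w).

Let mphi : measurable_fun setT phi.
Proof. by apply/measurable_fun_pairP; split. Qed.

Let phif : {mfun Om >-> (GT * Zt)%type} := mfun_Sub (mem_set mphi).

Let joint X : measurable X -> (PG \x mu)%E X = distribution P phif X.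
Proof.
move=> mX.
exact: (@product_measure_unique _ _ _ _ R PG mu (distribution P phif)).
Qed.

Lemma freeze_measurable dY (Y : measurableType dY) (F : Om * Zt -> Y) :
  measurable_fun [set: GT * Zt] F -> measurable_fun setT (fun w => F (w, z w)).
Proof. by move=> mF; exact: (measurableT_comp mF mphi). Qed.

Lemma sub_sigma_measurable dY (Y : measurableType dY) (f : Om -> Y) :
  measurable_fun [set: GT] f -> measurable_fun setT f.
Proof. by move=> mf; exact: (measurableT_comp mf midG). Qed.

(** The pair of [w] and [z w] has a product law by [joint], so Tonelli integrates the sample first,
    with [w] frozen. *)
Lemma freeze_ge0 (F : Om * Zt -> \bar R) :
  measurable_fun [set: GT * Zt] F -> (forall x, (0 <= F x)%E) ->
  (\int[P]_w F (w, z w) = \int[P]_w \int[mu]_s F (w, s))%E.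
Proof.
move=> mF F0.
transitivity (\int[distribution P phif]_x F x)%E.
  by rewrite (@ge0_integral_pushforward _ _ _ _ _ _ mphi)//; exact: mF.
transitivity (\int[PG \x mu]_x F x)%E.
  by apply: eq_measure_integral => A mA _; apply: esym; exact: joint.
rewrite fubini_tonelli1// /fubini_F.
rewrite (@ge0_integral_pushforward _ _ _ _ _ _ midG)//.
- exact: (@measurable_fun_fubini_tonelli_F _ _ GT Zt R mu F mF F0).
- by move=> w _; exact: integral_ge0.
Qed.

Lemma freeze_le (F : Om * Zt -> \bar R) (c : Om -> \bar R) :
  measurable_fun [set: GT * Zt] F -> (forall x, (0 <= F x)%E) ->
  (forall w, (\int[mu]_s F (w, s) <= c w)%E) ->
  (\int[P]_w F (w, z w) <= \int[P]_w c w)%E.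
Proof.
move=> mF F0 Fc; rewrite freeze_ge0//; apply: ge0_le_integralT => // w.
exact: integral_ge0.
Qed.

Lemma freeze_eq0 (F : Om * Zt -> \bar R) :
  measurable_fun [set: GT * Zt] F ->
  P.-integrable setT (fun w => F (w, z w)) ->
  (forall w, (\int[mu]_s F (w, s) = 0)%E) ->
  (\int[P]_w F (w, z w) = 0)%E.
Proof.
move=> mF iF F0.
have iD : (distribution P phif).-integrable setT F.
  by apply: (integrable_pushforward mphi).
have iJ : (PG \x mu)%E.-integrable setT F.
  apply/integrableP; split=> //; move/integrableP : iD => [_]; apply: le_lt_trans.
  rewrite (eq_measure_integral (distribution P phif))// => A mA _; exact: joint.
transitivity (\int[distribution P phif]_x F x)%E.
  by rewrite (integral_pushforward mphi).
transitivity (\int[PG \x mu]_x F x)%E.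
  by apply: eq_measure_integral => A mA _; apply: esym; exact: joint.
rewrite -(integral12_prod_meas1 iJ) /fubini_F.
by rewrite integral0_eq.
Qed.

End Freezing.

(** * Means and square-integrable random vectors *)

Section SquareIntegrable.
Context {R : realType} {d : measure_display} {Om : measurableType d}.
Variable P : probability Om R.
Implicit Types (f g : Om -> R).

Definition rintegrable f := P.-integrable setT (EFin \o f).
Definition mean f : R := Rintegral P setT f.
Definition sqint f := measurable_fun setT f /\ rintegrable (fun w => f w ^+ 2).

Lemma rintegrable_measurable f : rintegrable f -> measurable_fun setT f.
Proof. by move=> /measurable_int /measurable_EFinP. Qed.

Lemma rintegrable_cst c : rintegrable (fun=> c).
Proof. exact: finite_measure_integrable_cst. Qed.

Lemma rintegrableD f g : rintegrable f -> rintegrable g ->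
  rintegrable (fun w => f w + g w).
Proof. by move=> hf hg; exact: (integrableD measurableT hf hg). Qed.

Lemma rintegrableZ c f : rintegrable f -> rintegrable (fun w => c * f w).
Proof. by move=> hf; exact: (integrableZl measurableT c hf). Qed.

Lemma rintegrableN f : rintegrable f -> rintegrable (fun w => - f w).
Proof. by move=> hf; under eq_fun do rewrite -mulN1r; exact: rintegrableZ. Qed.

Lemma rintegrableB f g : rintegrable f -> rintegrable g ->
  rintegrable (fun w => f w - g w).
Proof. by move=> hf hg; apply: rintegrableD => //; exact: rintegrableN. Qed.

Lemma rintegrable_sum (I : Type) (s : seq I) (F : I -> Om -> R) :
  (forall i, rintegrable (F i)) -> rintegrable (fun w => \sum_(i <- s) F i w).
Proof.
move=> h; elim: s => [|i s IH].
  by under eq_fun do rewrite big_nil; exact: rintegrable_cst.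
by under eq_fun do rewrite big_cons; exact: rintegrableD.
Qed.

Lemma rintegrable_le f g : measurable_fun setT f ->
  (forall w, `|f w| <= g w) -> rintegrable g -> rintegrable f.
Proof.
move=> mf fg; apply: le_integrable => //; first exact/measurable_EFinP.
by move=> w _ /=; rewrite lee_fin (le_trans (fg w))// ler_norm.
Qed.

Lemma rintegrable_bounded f c : measurable_fun setT f ->
  (forall w, `|f w| <= c) -> rintegrable f.
Proof. by move=> mf fc; apply: (rintegrable_le mf fc); exact: rintegrable_cst. Qed.

Lemma mean_cst c : mean (fun=> c) = c.
Proof.
have PT : fine (P setT) = 1 by rewrite probability_setT.
by rewrite /mean Rintegral_cst// -[RHS]mulr1 -PT.
Qed.

Lemma meanD f g : rintegrable f -> rintegrable g ->
  mean (fun w => f w + g w) = mean f + mean g.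
Proof. by move=> hf hg; rewrite /mean RintegralD. Qed.

Lemma meanZ c f : rintegrable f -> mean (fun w => c * f w) = c * mean f.
Proof. by move=> hf; rewrite /mean RintegralZl. Qed.

Lemma meanB f g : rintegrable f -> rintegrable g ->
  mean (fun w => f w - g w) = mean f - mean g.
Proof. by move=> hf hg; rewrite /mean RintegralB. Qed.

Lemma mean_sum (I : Type) (s : seq I) (F : I -> Om -> R) :
  (forall i, rintegrable (F i)) ->
  mean (fun w => \sum_(i <- s) F i w) = \sum_(i <- s) mean (F i).
Proof.
move=> h; elim: s => [|i s IH].
  by rewrite big_nil -[RHS](mean_cst 0); congr mean; apply/funext => w; rewrite big_nil.
rewrite big_cons -IH -meanD//; last exact: rintegrable_sum.
by congr mean; apply/funext => w; rewrite big_cons.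
Qed.

Lemma mean_le f g : rintegrable f -> rintegrable g -> (forall w, f w <= g w) ->
  mean f <= mean g.
Proof. by move=> hf hg h; apply: le_Rintegral. Qed.

Lemma mean_ge0 f : (forall w, 0 <= f w) -> 0 <= mean f.
Proof. by move=> h; apply: Rintegral_ge0. Qed.

Lemma meanE f : rintegrable f -> (\int[P]_w (f w)%:E = (mean f)%:E)%E.
Proof. by move=> hf; rewrite /mean /Rintegral fineK// integrable_fin_num. Qed.

Lemma ge0_rintegrable_le f c : measurable_fun setT f -> (forall w, 0 <= f w) ->
  (\int[P]_w (f w)%:E <= c%:E)%E -> rintegrable f /\ mean f <= c.
Proof.
move=> mf f0 fc; have rf : rintegrable f.
  apply/integrableP; split; first exact/measurable_EFinP.
  under eq_integral do rewrite /= ger0_norm//.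
  by rewrite (le_lt_trans fc)// ltry.
by split=> //; rewrite -lee_fin -meanE.
Qed.

Lemma sqint_mul f g : sqint f -> sqint g -> rintegrable (fun w => f w * g w).
Proof.
move=> [mf f2] [mg g2].
apply: (@rintegrable_le _ (fun w => f w ^+ 2 + g w ^+ 2)); last exact: rintegrableD.
  exact: measurable_funM.
move=> w; rewrite ler_norml; apply/andP; split.
  have := sqr_ge0 (f w + g w); nra.
have := sqr_ge0 (f w - g w); nra.
Qed.

Lemma sqintD f g : sqint f -> sqint g -> sqint (fun w => f w + g w).
Proof.
move=> [mf f2] [mg g2]; have mfg : measurable_fun setT (fun w => f w + g w).
  exact: measurable_funD.
split=> //.
apply: (@rintegrable_le _ (fun w => 2 * f w ^+ 2 + 2 * g w ^+ 2)).
- exact: measurable_funX.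
- move=> w; rewrite ger0_norm ?sqr_ge0//; have := sqr_ge0 (f w - g w); nra.
- by apply: rintegrableD; exact: rintegrableZ.
Qed.

Lemma sqint_bounded f c : measurable_fun setT f -> (forall w, `|f w| <= c) -> sqint f.
Proof.
move=> mf fc; split=> //; apply: (@rintegrable_bounded _ (c ^+ 2)).
  exact: measurable_funX.
move=> w; rewrite ger0_norm ?sqr_ge0// -[leLHS]real_normK ?num_real//.
by rewrite lerXn2r ?nnegrE// (le_trans _ (fc w)).
Qed.

Lemma sqint_cst c : sqint (fun=> c).
Proof. by apply: (@sqint_bounded _ `|c|). Qed.

Lemma sqint_bmul f g c : measurable_fun setT f -> (forall w, `|f w| <= c) ->
  sqint g -> sqint (fun w => f w * g w).
Proof.
move=> mf fc [mg g2]; split; first exact: measurable_funM.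
apply: (@rintegrable_le _ (fun w => c ^+ 2 * g w ^+ 2)); last exact: rintegrableZ.
  by apply: measurable_funX; exact: measurable_funM.
move=> w; rewrite ger0_norm ?sqr_ge0// exprMn ler_wpM2r ?sqr_ge0//.
rewrite -[leLHS]real_normK ?num_real//.
by rewrite lerXn2r ?nnegrE// (le_trans _ (fc w)).
Qed.

Lemma sqintZ c f : sqint f -> sqint (fun w => c * f w).
Proof. by move=> hf; apply: (@sqint_bmul _ _ `|c|) => //; exact: measurable_cst. Qed.

Lemma sqint_sum (I : Type) (s : seq I) (F : I -> Om -> R) :
  (forall i, sqint (F i)) -> sqint (fun w => \sum_(i <- s) F i w).
Proof.
move=> h; elim: s => [|i s IH].
  by under eq_fun do rewrite big_nil; exact: sqint_cst.
by under eq_fun do rewrite big_cons; exact: sqintD.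
Qed.

Definition vsqint k (f : Om -> 'rV[R]_k) := forall j, sqint (fun w => f w 0 j).

Section Vectors.
Context {k : nat}.
Implicit Types u v : Om -> 'rV[R]_k.

Lemma vsqintP u : mx_measurable u -> rintegrable (fun w => dotv (u w) (u w)) ->
  vsqint u.
Proof.
move=> mu iu j; split; first exact: mu.
apply: (rintegrable_le _ _ iu); first by apply: measurable_funX; exact: mu.
move=> w; rewrite ger0_norm ?sqr_ge0// -norm2_sqr -[leLHS]real_normK ?num_real//.
by rewrite lerXn2r ?nnegrE ?norm2_ge0// coord_le_norm2.
Qed.

Lemma vsqint_bounded u c : mx_measurable u -> (forall w, norm2 (u w) <= c) -> vsqint u.
Proof.
move=> mu uc j; apply: (@sqint_bounded _ c); first exact: mu.
by move=> w; rewrite (le_trans (coord_le_norm2 _ _)).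
Qed.

Lemma vsqint_cst (v : 'rV[R]_k) : vsqint (fun=> v).
Proof. by move=> j; exact: sqint_cst. Qed.

Lemma vsqint_dotv u v : vsqint u -> vsqint v -> rintegrable (fun w => dotv (u w) (v w)).
Proof. by move=> hu hv; apply: rintegrable_sum => j; exact: sqint_mul. Qed.

Lemma vsqintD u v : vsqint u -> vsqint v -> vsqint (fun w => u w + v w).
Proof.
by move=> hu hv j; under eq_fun do rewrite mxE; exact: sqintD.
Qed.

Lemma vsqintZ c u : vsqint u -> vsqint (fun w => c *: u w).
Proof. by move=> hu j; under eq_fun do rewrite mxE; exact: sqintZ. Qed.

Lemma vsqint_bscale (f : Om -> R) u c : measurable_fun setT f ->
  (forall w, `|f w| <= c) -> vsqint u -> vsqint (fun w => f w *: u w).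
Proof.
by move=> mf fc hu j; under eq_fun do rewrite mxE; exact: sqint_bmul fc _.
Qed.

Lemma vsqintB u v : vsqint u -> vsqint v -> vsqint (fun w => u w - v w).
Proof.
move=> hu hv; apply: vsqintD => //; under eq_fun do rewrite -scaleN1r.
exact: vsqintZ.
Qed.

Lemma vsqint_sum (I : Type) (s : seq I) (F : I -> Om -> 'rV[R]_k) :
  (forall i, vsqint (F i)) -> vsqint (fun w => \sum_(i <- s) F i w).
Proof.
move=> h j; under eq_fun do rewrite summxE.
by apply: sqint_sum => i; exact: h.
Qed.

Lemma mean_dotv_orthogonal_sum (I : finType) (F : I -> Om -> 'rV[R]_k) :
  (forall i, vsqint (F i)) ->
  (forall i j, i != j -> mean (fun w => dotv (F i w) (F j w)) = 0) ->
  mean (fun w => dotv (\sum_i F i w) (\sum_i F i w)) =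
  \sum_i mean (fun w => dotv (F i w) (F i w)).
Proof.
move=> hF orth.
transitivity (mean (fun w => \sum_i \sum_j dotv (F i w) (F j w))).
  by congr mean; apply/funext => w; rewrite dotv_suml; apply: eq_bigr => i _; rewrite dotv_sumr.
rewrite mean_sum => [|i]; last first.
  by apply: rintegrable_sum => j; exact: vsqint_dotv.
apply: eq_bigr => i _; rewrite mean_sum => [|j]; last exact: vsqint_dotv.
rewrite (bigD1 i)//= big1 ?addr0// => j ji.
by rewrite orth// eq_sym.
Qed.

Lemma mean_dotvvD_le u v : vsqint u -> vsqint v ->
  mean (fun w => dotv (u w + v w) (u w + v w)) <=
  2 * mean (fun w => dotv (u w) (u w)) + 2 * mean (fun w => dotv (v w) (v w)).
Proof.
move=> hu hv.
have iu := vsqint_dotv hu hu; have iv := vsqint_dotv hv hv.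
rewrite -!meanZ// -meanD; [|exact: rintegrableZ|exact: rintegrableZ].
apply: mean_le.
- by apply: vsqint_dotv; exact: vsqintD.
- by apply: rintegrableD; exact: rintegrableZ.
- by move=> w; exact: dotvv_distDle.
Qed.

End Vectors.

End SquareIntegrable.

Section HasMean.
Context {R : realType} {d : measure_display} {Zt : measurableType d}.
Variable mu : probability Zt R.

Definition hasmean (h : Zt -> R) (c : R) := rintegrable mu h /\ mean mu h = c.

Lemma hasmeanZ a h c : hasmean h c -> hasmean (fun s => a * h s) (a * c).
Proof. by move=> [i1 <-]; split; [exact: rintegrableZ|exact: meanZ]. Qed.

Lemma hasmean_cst c : hasmean (fun=> c) c.
Proof. by split; [exact: rintegrable_cst|exact: mean_cst]. Qed.

Lemma hasmeanB h1 h2 c1 c2 : hasmean h1 c1 -> hasmean h2 c2 ->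
  hasmean (fun s => h1 s - h2 s) (c1 - c2).
Proof. by move=> [i1 <-] [i2 <-]; split; [exact: rintegrableB|exact: meanB]. Qed.

Lemma hasmean_sum (I : Type) (s : seq I) (h : I -> Zt -> R) (c : I -> R) :
  (forall i, hasmean (h i) (c i)) ->
  hasmean (fun x => \sum_(i <- s) h i x) (\sum_(i <- s) c i).
Proof.
move=> hc; split; first by apply: rintegrable_sum => i; case: (hc i).
rewrite mean_sum => [|i]; last by case: (hc i).
by apply: eq_bigr => i _; case: (hc i).
Qed.

Lemma hasmean_integral h c : hasmean h c -> (\int[mu]_s (h s)%:E = c%:E)%E.
Proof. by move=> [i <-]; exact: meanE. Qed.

End HasMean.

(** Tonelli is applied to the positive and negative parts. With unbiasedness it turns measurability
    of the oracle into measurability of [ginner] and [ginner'] along a random point. *)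
Lemma measurable_integral_param {R : realType} {d d' : measure_display}
    {Om : measurableType d} {Zt : measurableType d'} (mu : probability Zt R)
    (F : Om * Zt -> R) (g : Om -> R) :
  measurable_fun setT F -> (forall w, (\int[mu]_s (F (w, s))%:E = (g w)%:E)%E) ->
  measurable_fun setT g.
Proof.
move=> mF Fg; apply/measurable_EFinP.
have mF' : measurable_fun setT (EFin \o F) by exact/measurable_EFinP.
have -> : EFin \o g = (fun w => \int[mu]_s ((EFin \o F)^\+ (w, s))
    - \int[mu]_s ((EFin \o F)^\- (w, s)))%E.
  apply/funext => w; rewrite [LHS]/= -Fg integralE.
  by congr (_ - _)%E; apply: eq_integral => s _; rewrite ?funeposE ?funenegE.
apply: emeasurable_funB.
  by apply: (@measurable_fun_fubini_tonelli_F _ _ Om Zt R mu ((EFin \o F)^\+)%E) => //;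
    exact: measurable_funepos.
by apply: (@measurable_fun_fubini_tonelli_F _ _ Om Zt R mu ((EFin \o F)^\-)%E) => //;
  exact: measurable_funeneg.
Qed.

(** * Means and variances of the oracle *)

Section OracleMoments.
Context {R : realType} {d m n : nat} (pb : fcco R d m n).
Variables (a b s0 s1 delta : R) (N : 'rV[R]_m -> R).
Hypotheses (a0 : 0 < a) (Nn : is_norm N) (Nab : norm_equiv a b N).
Hypotheses (cX : closed (X pb)) (hor : assumption_oracle pb N s0 s1 delta).

Let mor : oracle_measurable pb. Proof. by case: hor. Qed.

Lemma hasmean_soracle i x k : X pb x ->
  hasmean (zlaw pb i) (fun s => soracle pb i x s 0 k) (ginner pb i x 0 k).
Proof.
move=> Xx; case: hor => _ /(_ i x Xx)[/(_ k) [h1 h2] _] _ _; split=> //.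
by rewrite /mean /Rintegral h2.
Qed.

Lemma hasmean_soracle' i x l k : X pb x ->
  hasmean (zlaw pb i) (fun s => soracle' pb i x s l k) (ginner' pb i x l k).
Proof.
move=> Xx; case: hor => _ /(_ i x Xx)[_ /(_ l k) [h1 h2]] _ _; split=> //.
by rewrite /mean /Rintegral h2.
Qed.

Section Measurability.
Context {dO : measure_display} {Om : measurableType dO}.
Variables (x : Om -> 'rV[R]_d).
Hypotheses (mx : mx_measurable x) (Xx : forall w, X pb (x w)).

Let mx1 i : mx_measurable (fun p : Om * Z pb i => x p.1).
Proof.
by move=> l j; exact: (measurableT_comp (f := fun w => x w l j) (mx l j) measurable_fst).
Qed.

Lemma mx_measurable_ginner i : mx_measurable (fun w => ginner pb i (x w)).
Proof.
move=> l k; rewrite (ord1 l).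
apply: (@measurable_integral_param _ _ _ _ _ (zlaw pb i)
  (fun p => soracle pb i (x p.1) p.2 0 k)) => [|w].
  by apply: (measurable_soracle (z := fun p => p.2) cX mor (@mx1 i)) => //;
    exact: measurable_snd.
exact: (hasmean_integral (hasmean_soracle i k (Xx w))).
Qed.

Lemma mx_measurable_ginner' i : mx_measurable (fun w => ginner' pb i (x w)).
Proof.
move=> l k; apply: (@measurable_integral_param _ _ _ _ _ (zlaw pb i)
  (fun p => soracle' pb i (x p.1) p.2 l k)) => [|w].
  by apply: (measurable_soracle' (z := fun p => p.2) cX mor (@mx1 i)) => //; exact: measurable_snd.
exact: (hasmean_integral (hasmean_soracle' i l k (Xx w))).
Qed.

End Measurability.

Let msor i x : X pb x -> mx_measurable (fun s => soracle pb i x s).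
Proof.
by move=> Xx; apply: (mx_measurable_soracle (z := fun s => s) cX mor (mx_measurable_cst x)) => //;
  exact: measurable_id.
Qed.

Let msor' i x : X pb x -> mx_measurable (fun s => soracle' pb i x s).
Proof.
by move=> Xx; apply: (mx_measurable_soracle' (z := fun s => s) cX mor (mx_measurable_cst x)) => //;
  exact: measurable_id.
Qed.

Definition var_g (a b s0 : R) : R := (Num.max a b * s0) ^+ 2.
Definition var_g' (a b M s1 : R) : R := (Num.max a b * M * s1) ^+ 2.

(* The integrands of the variance assumption involve norms whose measurability
   is not known, so the comparison goes through the measurable 2-norm. *)
Let scaled_moment i (u : Z pb i -> R) (v : Z pb i -> R) (c r : R) :
  0 < c -> measurable_fun setT u -> (forall s, 0 <= u s) ->
  (forall s, u s <= c ^+ 2 * v s) ->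
  (\int[zlaw pb i]_s (v s)%:E <= (r ^+ 2)%:E)%E ->
  rintegrable (zlaw pb i) u /\ mean (zlaw pb i) u <= (c * r) ^+ 2.
Proof.
move=> c0 mu u0 uv vr.
have c2 : 0 < c ^+ 2 by rewrite exprn_gt0.
have [iu mu'] : rintegrable (zlaw pb i) (fun s => (c ^+ 2)^-1 * u s) /\
    mean (zlaw pb i) (fun s => (c ^+ 2)^-1 * u s) <= r ^+ 2.
  apply: ge0_rintegrable_le.
  - by apply: measurable_funM => //; exact: measurable_cst.
  - by move=> s; rewrite mulr_ge0// invr_ge0 ltW.
  - apply: le_trans vr; apply: ge0_le_integralT => s.
      by rewrite lee_fin mulr_ge0// invr_ge0 ltW.
    by rewrite lee_fin mulrC ler_pdivrMr// mulrC.
have E : u = (fun s => c ^+ 2 * ((c ^+ 2)^-1 * u s)).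
  by apply/funext => s; rewrite mulrA divff ?mul1r// gt_eqF.
rewrite E; split; first exact: rintegrableZ.
by rewrite meanZ// exprMn ler_pM2l.
Qed.

Lemma soracle_variance i x : X pb x ->
  rintegrable (zlaw pb i) (fun s => dotv (soracle pb i x s - ginner pb i x)
                                         (soracle pb i x s - ginner pb i x)) /\
  mean (zlaw pb i) (fun s => dotv (soracle pb i x s - ginner pb i x)
                                  (soracle pb i x s - ginner pb i x)) <= var_g a b s0.
Proof.
move=> Xx; case: hor => _ _ _ /(_ x Xx)[/(_ i) h _ _].
apply: (scaled_moment _ _ _ _ h); first exact: norm_equiv_beta_gt0.
- by apply: measurable_dotv; apply: mx_measurableB;
    [exact: msor|exact: mx_measurable_cst|exact: msor|exact: mx_measurable_cst].
- by move=> s; exact: dotvv_ge0.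
- move=> s; rewrite dotvv_distC -norm2_sqr.
  exact: dual_norm_sqr_ge.
Qed.

Lemma soracle'_variance i x (y : 'rV[R]_m) M : norm2 y <= M -> X pb x ->
  rintegrable (zlaw pb i) (fun s =>
    dotv (y *m (soracle' pb i x s - ginner' pb i x)^T)
         (y *m (soracle' pb i x s - ginner' pb i x)^T)) /\
  mean (zlaw pb i) (fun s =>
    dotv (y *m (soracle' pb i x s - ginner' pb i x)^T)
         (y *m (soracle' pb i x s - ginner' pb i x)^T)) <= var_g' a b M s1.
Proof.
move=> yM Xx; case: hor => _ _ _ /(_ x Xx)[_ /(_ i) h _].
have M0 : 0 <= M := le_trans (norm2_ge0 y) yM.
have my : mx_measurable (fun s => y *m (soracle' pb i x s - ginner' pb i x)^T).
  apply: mx_measurableM; first exact: mx_measurable_cst.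
  by apply: mx_measurable_tr; apply: mx_measurableB; [exact: msor'|exact: mx_measurable_cst].
(* The rescaling in [scaled_moment] needs a positive factor; for [M = 0] the vector [y] vanishes. *)
move: M0; rewrite le_eqVlt => /predU1P[M0|M0].
  have -> : y = 0 by apply: norm2_eq0; apply/eqP; rewrite eq_le norm2_ge0 M0 yM.
  under eq_fun do rewrite mul0mx dotv0.
  by split; [exact: rintegrable_cst|rewrite mean_cst sqr_ge0].
apply: (scaled_moment _ _ _ _ h); first by rewrite mulr_gt0// norm_equiv_beta_gt0.
- exact: measurable_dotv.
- by move=> s; exact: dotvv_ge0.
- move=> s; rewrite -norm2_sqr -norm2N -mulmxN linearB/= opprB.
  exact: op_norm_sqr_ge.
Qed.

End OracleMoments.

(** * Iterates and noise of a run *)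

Section ProxRun.
Context {R : realType} {d m n : nat} (pb : fcco R d m n) {Omega : Type}.
Variables (eta tau : R) (Sz Bz T : nat) (x0 : 'rV[R]_d) (y0 : 'I_n -> 'rV[R]_m).
Variables (sel : nat -> Omega -> {set 'I_n}).
Variables (bat : bool -> nat -> forall i, Omega -> 'I_Bz -> Z pb i).
Variables (x : nat -> Omega -> 'rV[R]_d) (y yb : nat -> Omega -> 'I_n -> 'rV[R]_m).

Definition extrapolation t w i : 'rV[R]_m :=
  minibatch (x t w) (bat false t i w) *+ 2 - minibatch (x t.-1 w) (bat false t i w).

(** This is G_t, because [yb t] is the updated dual variable on sampled blocks. Writing it with
    indicators separates the sampled set from quantities independent of it. *)
Definition direction t w : 'rV[R]_d :=
  Sz%:R^-1 *: \sum_(i < n)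
    (i \in sel t w)%:R *: (yb t w i *m (minibatch' (x t w) (bat true t i w))^T).

(* [yb t] is the dual update computed for every block, sampled or not. *)
Record prox_run : Prop := ProxRun {
  run_x0 : forall w, x 0%N w = x0 ;
  run_y0 : forall w, y 0%N w = y0 ;
  run_X : forall t w, (t <= T)%N -> X pb (x t w) ;
  run_Y : forall t w i, (t <= T)%N -> Ydom pb i (y t w i) ;
  run_y : forall t w i, (t < T)%N ->
    y t.+1 w i = if i \in sel t w then yb t w i else y t w i ;
  run_Yb : forall t w i, (t < T)%N -> Ydom pb i (yb t w i) ;
  run_yb : forall t w i v, (t < T)%N -> Ydom pb i v ->
    rconj (fouter pb i) (yb t w i) + dotv (- extrapolation t w i) (yb t w i)
      + tau / 2 * dotv (yb t w i - y t w i) (yb t w i - y t w i)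
    <= rconj (fouter pb i) v + dotv (- extrapolation t w i) v
      + tau / 2 * dotv (v - y t w i) (v - y t w i) ;
  run_K : forall t w, (t < T)%N -> rdom pb (x t.+1 w) ;
  run_x : forall t w v, (t < T)%N -> rdom pb v ->
    rreg pb (x t.+1 w) + dotv (direction t w) (x t.+1 w)
      + eta / 2 * dotv (x t.+1 w - x t w) (x t.+1 w - x t w)
    <= rreg pb v + dotv (direction t w) v
      + eta / 2 * dotv (v - x t w) (v - x t w) }.

End ProxRun.

Section IterateMeasurability.
Context {R : realType} {d m n : nat} (pb : fcco R d m n).
Context {dO : measure_display} {Om : measurableType dO}.
Variables (eta tau : R) (Sz Bz T : nat) (x0 : 'rV[R]_d) (y0 : 'I_n -> 'rV[R]_m).
Variables (sel : nat -> Om -> {set 'I_n}).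
Variables (bat : bool -> nat -> forall i, Om -> 'I_Bz -> Z pb i).
Variables (x : nat -> Om -> 'rV[R]_d) (y yb : nat -> Om -> 'I_n -> 'rV[R]_m).
Hypotheses (eta0 : 0 < eta) (tau0 : 0 < tau).
Hypotheses (cX : closed (X pb)) (mor : oracle_measurable pb).
Hypotheses (cr : rconvex_on (rdom pb) (rreg pb)).
Hypothesis run : prox_run eta tau Sz T x0 y0 sel bat x y yb.

Lemma mx_measurable_minibatch c t t' i : (t <= T)%N ->
  mx_measurable (x t) -> (forall b, measurable_fun setT (fun w => bat c t' i w b)) ->
  mx_measurable (fun w => minibatch (x t w) (bat c t' i w)).
Proof.
move=> tT mx mb; apply: mx_measurableZc; apply: mx_measurable_sum => b.
apply: (mx_measurable_soracle (z := fun w => bat c t' i w b) cX mor mx) => //.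
by move=> w; exact: (run_X run).
Qed.

Lemma mx_measurable_minibatch' c t t' i : (t <= T)%N ->
  mx_measurable (x t) -> (forall b, measurable_fun setT (fun w => bat c t' i w b)) ->
  mx_measurable (fun w => minibatch' (x t w) (bat c t' i w)).
Proof.
move=> tT mx mb; apply: mx_measurableZc; apply: mx_measurable_sum => b.
apply: (mx_measurable_soracle' (z := fun w => bat c t' i w b) cX mor mx) => //.
by move=> w; exact: (run_X run).
Qed.

Lemma mx_measurable_yb t i : (t < T)%N ->
  mx_measurable (x t) -> mx_measurable (x t.-1) -> mx_measurable (fun w => y t w i) ->
  (forall b, measurable_fun setT (fun w => bat false t i w b)) ->
  mx_measurable (fun w => yb t w i).
Proof.
move=> tT mx mx1 my mb.
have t1T : (t.-1 <= T)%N by rewrite (leq_trans (leq_pred t))// ltnW.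
apply: (@mx_measurable_nonexpansive _ _ _ m m
  (fun w => y t w i - tau^-1 *: (- extrapolation bat x t w i))).
  apply: mx_measurableB => //; apply: mx_measurableZc; apply: mx_measurableN.
  apply: mx_measurableB; last exact: mx_measurable_minibatch.
  rewrite (_ : (fun w => _) = (fun w => minibatch (x t w) (bat false t i w)
     + minibatch (x t w) (bat false t i w))); last by apply/funext => w; rewrite mulr2n.
  by apply: mx_measurableD; apply: mx_measurable_minibatch => //; exact: ltnW.
move=> w w'.
apply: (@prox_nonexpansive _ _ _ (rconj (fouter pb i)) tau) => //.
- exact: rconvex_rconj.
- exact: (run_Yb run).
- exact: (run_Yb run).
- by move=> v Yv; exact: (run_yb run).
- by move=> v Yv; exact: (run_yb run).
Qed.

Lemma measurable_selection t (Q : {set 'I_n} -> bool) :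
  (forall U, measurable (sel t @^-1` U)) ->
  measurable_fun setT (fun w => (Q (sel t w))%:R : R).
Proof.
move=> ms; rewrite (_ : (fun w => _) = \1_(sel t @^-1` [set U | Q U])).
  exact: measurable_indic.
apply/funext => w; rewrite indicE; congr (_%:R); congr nat_of_bool.
by apply/idP/idP => [h|]; [exact: mem_set|rewrite inE].
Qed.

Lemma mx_measurable_direction t : (t < T)%N ->
  mx_measurable (x t) -> (forall i, mx_measurable (fun w => yb t w i)) ->
  (forall U, measurable (sel t @^-1` U)) ->
  (forall i b, measurable_fun setT (fun w => bat true t i w b)) ->
  mx_measurable (direction Sz sel bat x yb t).
Proof.
move=> tT mx myb ms mb; apply: mx_measurableZc; apply: mx_measurable_sum => i.
apply: mx_measurableZ; first exact: (measurable_selection (fun U => i \in U)).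
apply: mx_measurableM => //; apply: mx_measurable_tr.
by apply: mx_measurable_minibatch' => //; exact: ltnW.
Qed.

Lemma mx_measurable_x_step t : (t < T)%N ->
  mx_measurable (x t) -> mx_measurable (direction Sz sel bat x yb t) ->
  mx_measurable (x t.+1).
Proof.
move=> tT mx mG.
apply: (@mx_measurable_nonexpansive _ _ _ d d
  (fun w => x t w - eta^-1 *: direction Sz sel bat x yb t w)).
  by apply: mx_measurableB => //; exact: mx_measurableZc.
move=> w w'.
apply: (@prox_nonexpansive _ _ (rdom pb) (rreg pb) eta) => //.
- exact: (run_K run).
- exact: (run_K run).
- by move=> v Kv; exact: (run_x run).
- by move=> v Kv; exact: (run_x run).
Qed.

(** The sigma-algebra on [Om] is arbitrary, so the lemma also applies to the one generated by all
    samples but one; this is how adaptedness is expressed. *)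
Lemma mx_measurable_iterates t : (t <= T)%N ->
  (forall t', (t' < t)%N -> (forall U, measurable (sel t' @^-1` U)) /\
     forall c i b, measurable_fun setT (fun w => bat c t' i w b)) ->
  forall s, (s <= t)%N ->
    mx_measurable (x s) /\ forall i, mx_measurable (fun w => y s w i).
Proof.
elim: t => [_ _ s|t IH tT ms s].
  rewrite leqn0 => /eqP ->; split.
    by rewrite (_ : x 0%N = fun=> x0); [exact: mx_measurable_cst|
      apply/funext => w; exact: (run_x0 run)].
  move=> i; rewrite (_ : (fun w => _) = fun=> y0 i); first exact: mx_measurable_cst.
  by apply/funext => w; rewrite (run_y0 run).
have {}IH := IH (ltnW tT) (fun t' t't => ms t' (ltnW t't)).
rewrite leq_eqVlt => /predU1P[->|]; last by rewrite ltnS; exact: IH.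
have [mst mbt] := ms t (ltnSn t).
have [mx my] := IH t (leqnn t).
have [mx1 _] := IH t.-1 (leq_pred t).
have myb i : mx_measurable (fun w => yb t w i) by exact: mx_measurable_yb.
split.
  by apply: mx_measurable_x_step => //; apply: mx_measurable_direction.
move=> i; rewrite (_ : (fun w => _) =
    fun w => y t w i + (i \in sel t w)%:R *: (yb t w i - y t w i)).
  apply: mx_measurableD => //; apply: mx_measurableZ; last exact: mx_measurableB.
  exact: (measurable_selection (fun U => i \in U)).
apply/funext => w; rewrite (run_y run)//; case: ifP => _.
  by rewrite scale1r addrC subrK.
by rewrite scale0r addr0.
Qed.

End IterateMeasurability.

(** * Events determined by all samples but one *)

Section SampleSigma.
Context {R : realType} {d m n : nat} (pb : fcco R d m n).
Context {dO : measure_display} {Omega : measurableType dO} (P : probability Omega R).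
Variables (T Bz : nat) (sel : nat -> Omega -> {set 'I_n}).
Variables (bat : bool -> nat -> forall i, Omega -> 'I_Bz -> Z pb i).
Hypotheses (msel : forall t U, (t < T)%N -> measurable (sel t @^-1` U)).
Hypotheses (mbat : forall c t i b, (t < T)%N ->
  measurable_fun setT (fun w => bat c t i w b)).
Hypothesis hind : mutually_independent P (@sample_events _ _ _ _ pb _ Omega T Bz sel bat).
Let K := @sample_index n T Bz.
Let ev : K -> set_system Omega := @sample_events _ _ _ _ pb _ Omega T Bz sel bat.

(** Intersections of one event per sample: a generating family stable under intersection, on which
    independence from sample [k] is a product formula. *)
Definition other_samples (k : K) : set (set Omega) :=
  [set A | exists F : K -> set Omega, [/\ forall j, ev j (F j), F k = setT
    & A = \bigcap_(j in [set: K]) F j]].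

Let evT j : ev j setT.
Proof.
case: j => [t|[[[c t] i] b]]; first by exists setT.
by exists setT => //; rewrite setTI.
Qed.

Let evI j A B : ev j A -> ev j B -> ev j (A `&` B).
Proof.
case: j => [t|[[[c t] i] b]].
  by move=> [U _ <-] [V _ <-]; exists (U `&` V).
move=> [U mU <-] [V mV <-]; exists (U `&` V); first exact: measurableI.
by rewrite !setTI.
Qed.

Let evm j A : ev j A -> measurable A.
Proof.
case: j => [t|[[[c t] i] b]]; first by move=> [U _ <-]; exact: msel.
by move=> [U mU <-]; exact: (@mbat c t i b (ltn_ord t) measurableT _ mU).
Qed.

Lemma other_samples_setT k : other_samples k setT.
Proof. by exists (fun=> setT); split=> //; rewrite bigcapT. Qed.

Lemma other_samples_setI k : setI_closed (other_samples k).
Proof.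
move=> _ _ [F [eF Fk ->]] [F' [eF' F'k ->]].
exists (fun j => F j `&` F' j); split=> [j||]; first exact: evI.
  by rewrite Fk F'k setTI.
by rewrite bigcapI.
Qed.

Lemma other_samples_measurable k : other_samples k `<=` measurable.
Proof.
move=> _ [F [eF _ ->]]; apply: fin_bigcap_measurable => // j _.
exact: evm (eF j).
Qed.

Lemma other_samples_event k j A : j != k -> ev j A -> other_samples k A.
Proof.
move=> jk ejA; exists (fun j' => if j' == j then A else setT); split.
- by move=> j'; case: eqP => [->|].
- by rewrite eq_sym (negbTE jk).
- apply/seteqP; split=> [w Aw j' _|w h]; first by case: eqP.
  by have := h j I; rewrite eqxx.
Qed.

Lemma other_samples_indep k A C : other_samples k A -> ev k C ->
  P (A `&` C) = (P A * P C)%E.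
Proof.
move=> [F [eF Fk ->]] eC.
pose F' j := if j == k then C else F j.
have eF' j : ev j (F' j) by rewrite /F'; case: eqP => [->|].
have capE H : \bigcap_(j in [set` [set: K]%SET]) H j = \bigcap_(j in [set: K]) H j :> set Omega.
  by congr bigcap; apply/seteqP; split=> j //= _; rewrite inE.
have mF : measurable (\bigcap_(j in [set: K]) F j).
  by apply: fin_bigcap_measurable => // j _; exact: evm (eF j).
have mC := evm eC.
have E : (\bigcap_(j in [set: K]) F j) `&` C = \bigcap_(j in [set: K]) F' j.
  apply/seteqP; split=> [w [Fw Cw] j _|w F'w].
    by rewrite /F'; case: eqP => // _; exact: Fw.
  split; last by have := F'w k I; rewrite /F' eqxx.
  move=> j _; have := F'w j I; rewrite /F'; case: eqP => // -> _.
  by rewrite Fk.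
(* The two products over all samples differ in the factor of [k] only: [P C] in one, 1 in the
   other. *)
have h1 := @hind [set: K]%SET F' (fun j _ => eF' j).
have h2 := @hind [set: K]%SET F (fun j _ => eF j).
rewrite capE -E in h1; rewrite capE in h2.
rewrite -[LHS]fineK; last by rewrite fin_num_measure//; exact: measurableI.
rewrite h1 (bigD1 k) ?inE//= /F' eqxx.
rewrite -[X in (X * _)%E]fineK ?fin_num_measure// h2 -[X in (_ * X)%E]fineK ?fin_num_measure//.
rewrite -EFinM [in RHS](bigD1 k) ?inE//= Fk probability_setT mul1r mulrC.
by congr ((_ * _)%:E); apply: eq_bigr => j /andP[_ /negbTE ->].
Qed.

End SampleSigma.

(** * From a run of ALEXR to proximal inequalities *)

Lemma gradient_half_sqnorm {R : realType} k (v : 'rV[R]_k) :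
  gradient (@half_sqnorm R k) v = v.
Proof.
apply/rowP => j; rewrite mxE /derive.
apply: cvg_lim => //.
have h : (fun h : R => v 0 j + 2^-1 * h) h @[h --> 0^'] --> v 0 j.
  rewrite -[X in _ --> X]addr0 -[X in _ --> _ + X](mulr0 2^-1).
  apply: cvgD; first exact: cvg_cst.
  by apply: cvgM; [exact: cvg_cst|exact: cvg_within].
apply: cvg_trans h; apply: near_eq_cvg; near=> h.
have h0 : h != 0 by near: h; exact: nbhs_dnbhs_neq.
rewrite /half_sqnorm /= !norm2_sqr dotvvD !dotvZl !dotvZr !(dotvC _ v) !dotv_delta.
rewrite mxE !eqxx/= /GRing.scale/=; field.
Unshelve. all: by end_near. Qed.

Lemma bregman_half_sqnorm {R : realType} k (u v : 'rV[R]_k) :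
  bregman (@half_sqnorm R k) u v = 2^-1 * dotv (u - v) (u - v).
Proof.
rewrite /bregman gradient_half_sqnorm /half_sqnorm !norm2_sqr dotvvB dotvBr.
by rewrite (dotvC v u); field.
Qed.

Section RunOfAlexr.
Context {R : realType} {d m n : nat} (pb : fcco R d m n).
Context {dO : measure_display} {Omega : measurableType dO} (P : probability Omega R).
Variables (a b mu Cf eta tau : R) (N : 'rV[R]_m -> R).
Variables (Sz Bz T : nat) (x0 : 'rV[R]_d) (y0 : 'I_n -> 'rV[R]_m).
Variables (sel : nat -> Omega -> {set 'I_n}).
Variables (bat : bool -> nat -> forall i, Omega -> 'I_Bz -> Z pb i).
Variables (x : nat -> Omega -> 'rV[R]_d) (y : nat -> Omega -> 'I_n -> 'rV[R]_m).
Hypotheses (hdom : assumption_domain pb mu) (hout : assumption_outer pb N Cf).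
Hypotheses (Xx0 : X pb x0) (Yy0 : forall i, Ydom pb i (y0 i)).
Hypothesis run : alexr_run P (fun=> @half_sqnorm R m) eta tau 1 Sz T x0 y0 sel bat x y.

Definition dual_prox t w i (p : 'rV[R]_m) := Ydom pb i p /\
  forall v, Ydom pb i v ->
    rconj (fouter pb i) p + dotv (- extrapolation bat x t w i) p
      + tau / 2 * dotv (p - y t w i) (p - y t w i)
    <= rconj (fouter pb i) v + dotv (- extrapolation bat x t w i) v
      + tau / 2 * dotv (v - y t w i) (v - y t w i).

(** The case distinction creates no dependence on [sel t]: for positive [tau] the proximal point is
    determined by [y t w i] and the extrapolated value, as nonexpansiveness shows. The default 0 is
    never taken for [t < T], by compactness. *)
Definition full_dual_update t w i : 'rV[R]_m :=
  if i \in sel t w then y t.+1 w i else xget 0 (dual_prox t w i).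

Let dual_prox_sampled t w i : (t < T)%N -> i \in sel t w ->
  dual_prox t w i (y t.+1 w i).
Proof.
move=> tT isel; have [Yp hp] := y_step run tT isel; split=> // v Yv.
have := hp v Yv; rewrite !conjugateE// !bregman_half_sqnorm.
rewrite -!EFinB lee_fin scale1r.
set g := _ + (_ - _); have -> : extrapolation bat x t w i = g.
  by rewrite /extrapolation /g mulr2n addrA.
rewrite !dotvNl !(dotvC g) -/(rconj _ _) -/(rconj _ _); lra.
Qed.

Let dual_proxP t w i : (t < T)%N -> dual_prox t w i (full_dual_update t w i).
Proof.
move=> tT; rewrite /full_dual_update; case: ifPn => [isel|_].
  exact: dual_prox_sampled.
have [p Yp hp] := Ydom_argmax_exists hout (y t w i) (extrapolation bat x t w i) tau
  (ex_intro _ (y0 i) (Yy0 i)).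
by apply: (@xgetPex _ 0 (dual_prox t w i)); exists p.
Qed.

Let y_step_full t w i : (t < T)%N ->
  y t.+1 w i = if i \in sel t w then full_dual_update t w i else y t w i.
Proof.
move=> tT; rewrite /full_dual_update; case: ifPn => isel; first by rewrite isel.
exact: (y_keep run tT isel).
Qed.

Let primal_prox t w : (t < T)%N -> let G := direction Sz sel bat x full_dual_update t w in
  rdom pb (x t.+1 w) /\ forall v, rdom pb v ->
  rreg pb (x t.+1 w) + dotv G (x t.+1 w)
      + eta / 2 * dotv (x t.+1 w - x t w) (x t.+1 w - x t w)
    <= rreg pb v + dotv G v + eta / 2 * dotv (v - x t w) (v - x t w).
Proof.
move=> tT G; have [Xp hp] := x_step run w tT.
have EG : Sz%:R^-1 *: \sum_(i in sel t w)
    y t.+1 w i *m (minibatch' (x t w) (bat true t i w))^T = G.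
  rewrite /G /direction big_mkcond/=; congr (_ *: _); apply: eq_bigr => i _.
  case: (boolP (i \in sel t w)) => isel; last by rewrite scale0r.
  by rewrite y_step_full// isel scale1r.
rewrite EG in hp.
have Kp : rdom pb (x t.+1 w).
  split=> //; case: hdom => _ _ [_ [v Xv rv]] _ _.
  have := hp v Xv; rewrite (regE hdom (conj Xv rv)) => h.
  by rewrite ltey; apply/eqP => rw; move: h; rewrite rw /= leye_eq.
split=> // v Kv; have := hp v (proj1 Kv).
rewrite (regE hdom Kp) (regE hdom Kv) -!EFinD lee_fin !norm2_sqr; lra.
Qed.

Lemma prox_run_of_alexr :
  prox_run eta tau Sz T x0 y0 sel bat x y full_dual_update.
Proof.
split.
- exact: (x_init run).
- by move=> w; exact: (y_init run).
- move=> [|t] w tT; first by rewrite (x_init run).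
  by have [[]] := primal_prox w tT.
- move=> t w i; elim: t => [_|t IH tT]; first by rewrite (y_init run).
  rewrite y_step_full//; case: ifP => _; last exact/IH/ltnW.
  by have [] := dual_proxP w i tT.
- by move=> t w i; exact: y_step_full.
- by move=> t w i tT; have [] := dual_proxP w i tT.
- by move=> t w i v tT; have [_] := dual_proxP w i tT; exact.
- by move=> t w tT; have [] := primal_prox w tT.
- by move=> t w v tT; have [_] := primal_prox w tT; exact.
Qed.

End RunOfAlexr.

Lemma measurable_fun_fst {d1 d2 d3} (T1 : measurableType d1) (T2 : measurableType d2)
    (T3 : measurableType d3) (f : T1 -> T3) :
  measurable_fun setT f -> measurable_fun [set: T1 * T2] (fun p => f p.1).
Proof. by move=> mf; exact: (measurableT_comp mf measurable_fst). Qed.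

Lemma mx_measurable_fst {R : realType} {d1 d2} (T1 : measurableType d1)
    (T2 : measurableType d2) p q (f : T1 -> 'M[R]_(p, q)) :
  mx_measurable f -> mx_measurable (fun w : T1 * T2 => f w.1).
Proof. by move=> mf l j; exact: (@measurable_fun_fst _ _ _ T1 T2 _ _ (mf l j)). Qed.

(** * Uniform sampling of blocks *)

Section Selection.
Context {R : realType} {n : nat}.
Context {dO : measure_display} {Omega : measurableType dO} (P : probability Omega R).
Variables (Sz : nat) (sel : Omega -> {set 'I_n}).
Hypotheses (Sz0 : (0 < Sz)%N) (Szn : (Sz <= n)%N).
Hypotheses (msel : forall U, measurable (sel @^-1` U)) (csel : forall w, #|sel w| = Sz).
Hypothesis usel : forall U : {set 'I_n}, #|U| = Sz ->
  P [set w | sel w = U] = (('C(n, Sz))%:R^-1)%:E.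

Lemma measurable_sel (Q : {set 'I_n} -> bool) :
  measurable_fun setT (fun w => (Q (sel w))%:R : R).
Proof.
rewrite (_ : (fun w => _) = \1_(sel @^-1` [set U | Q U])); first exact: measurable_indic.
apply/funext => w; rewrite indicE; congr (_%:R); congr nat_of_bool.
by apply/idP/idP => [h|]; [exact: mem_set|rewrite inE].
Qed.

Lemma rintegrable_sel (Q : {set 'I_n} -> bool) :
  rintegrable P (fun w => (Q (sel w))%:R).
Proof.
apply: (@rintegrable_bounded _ _ _ _ _ 1); first exact: measurable_sel.
by move=> w; rewrite normr_nat; case: (Q _).
Qed.

Lemma mean_sel (Q : {set 'I_n} -> bool) :
  mean P (fun w => (Q (sel w))%:R) =
  (\sum_(U : {set 'I_n} | #|U| == Sz) (Q U)%:R) / ('C(n, Sz))%:R.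
Proof.
transitivity (mean P (fun w => \sum_(U : {set 'I_n}) (Q U)%:R * (sel w == U)%:R)).
  congr mean; apply/funext => w; rewrite (bigD1 (sel w))//= eqxx mulr1 big1 ?addr0//.
  by move=> U; rewrite eq_sym => /negbTE ->; rewrite mulr0.
rewrite mean_sum => [|U]; last first.
  by apply: rintegrableZ; exact: (rintegrable_sel (fun V => V == U)).
rewrite mulr_suml [RHS]big_mkcond/=; apply: eq_bigr => U _.
rewrite meanZ; last exact: (rintegrable_sel (fun V => V == U)).
have E : mean P (fun w => (sel w == U)%:R) = fine (P [set w | sel w = U]).
  rewrite /mean /Rintegral; congr fine.
  rewrite (_ : (fun w => _) = (fun w => (\1_[set w | sel w = U] w)%:E)).
    by rewrite integral_indic ?setIT//; exact: (msel [set U]).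
  apply/funext => w; rewrite indicE; congr ((_%:R)%:E); congr nat_of_bool.
  by apply/eqP/idP => [h|]; [exact: mem_set|rewrite inE].
rewrite E; case: eqP => [cU|cU]; first by rewrite usel.
rewrite (_ : [set w | sel w = U] = set0) ?measure0 ?mulr0//.
by apply/seteqP; split=> // w /= sU; apply: cU; rewrite -sU.
Qed.

Let draws (Q : {set 'I_n} -> bool) : R := \sum_(U : {set 'I_n} | #|U| == Sz) (Q U)%:R.

(** Relabelling the blocks permutes the sets of size [Sz]; all inclusion probabilities below are
    obtained from this symmetry. *)
Let draws_perm (s : {perm 'I_n}) (Q : {set 'I_n} -> bool) :
  draws (fun U => Q (s @: U)) = draws Q.
Proof.
rewrite /draws [RHS](reindex (fun U : {set 'I_n} => s @: U)); last first.
  exists (fun U : {set 'I_n} => s @^-1: U) => U _.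
    by apply/setP => j; rewrite inE mem_imset//; exact: perm_inj.
  apply/setP => j; apply/imsetP/idP => [[k]|jU]; first by rewrite inE => ? ->.
  by exists ((s^-1)%g j); rewrite ?inE permKV.
by apply: eq_bigl => U; rewrite card_imset//; exact: perm_inj.
Qed.

Let draws_mem i j : draws (fun U => i \in U) = draws (fun U => j \in U).
Proof.
rewrite -(draws_perm (tperm i j) (fun U => j \in U)); apply: eq_bigr => U _.
by have := mem_imset U i (@perm_inj _ (tperm i j)); rewrite tpermL => ->.
Qed.

(** The probabilities are equal by symmetry and add up to the size of the sampled set. *)
Lemma mean_mem i : mean P (fun w => (i \in sel w)%:R) = Sz%:R / n%:R.
Proof.
have n0 : n%:R != 0 :> R by rewrite pnatr_eq0 -lt0n (leq_trans Sz0).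
have S : \sum_(j < n) mean P (fun w => (j \in sel w)%:R) = Sz%:R.
  rewrite -mean_sum => [|j]; last exact: (rintegrable_sel (fun U => j \in U)).
  rewrite -[RHS](mean_cst P); congr mean; apply/funext => w.
  by rewrite -natr_sum -big_mkcond/= sum1_card csel.
have : \sum_(j < n) mean P (fun w => (j \in sel w)%:R) =
       n%:R * mean P (fun w => (i \in sel w)%:R).
  rewrite (eq_bigr (fun=> mean P (fun w => (i \in sel w)%:R))).
    by rewrite sumr_const card_ord mulr_natl.
  move=> j _; rewrite (mean_sel (fun U => j \in U)) (mean_sel (fun U => i \in U)).
  by congr (_ / _); exact: draws_mem.
by rewrite S => ->; rewrite mulrC mulKf.
Qed.

(** The common value is left implicit: the variance of block sampling uses only that it is the same
    for all pairs and nonnegative. *)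
Lemma mean_mem2 : exists2 c : R, 0 <= c & forall i j : 'I_n, i != j ->
  mean P (fun w => ((i \in sel w) && (j \in sel w))%:R) = c.
Proof.
have [[[i0 j0] /= ij0]|no] := pselect (exists ij : 'I_n * 'I_n, ij.1 != ij.2); last first.
  by exists 0 => // i j ij; case: no; exists (i, j).
exists (mean P (fun w => ((i0 \in sel w) && (j0 \in sel w))%:R)).
  by apply: mean_ge0 => w; exact: ler0n.
move=> i j ij.
rewrite (mean_sel (fun U => (i \in U) && (j \in U)))
  (mean_sel (fun U => (i0 \in U) && (j0 \in U))); congr (_ / _).
(* The permutation sends [i] to [i0] first, then the image [j1] of [j] to [j0] without moving
   [i0]. *)
pose j1 := tperm i i0 j.
have j1i0 : j1 != i0 by rewrite /j1 -{2}(tpermL i i0) (inj_eq perm_inj) eq_sym.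
pose s := (tperm i i0 * tperm j1 j0)%g.
have si : s i = i0 by rewrite permM tpermL tpermD// eq_sym.
have sj : s j = j0 by rewrite permM -/j1 tpermL.
rewrite -[RHS](draws_perm s (fun U => (i0 \in U) && (j0 \in U))).
apply: eq_bigr => U _.
have := mem_imset U i (@perm_inj _ s); have := mem_imset U j (@perm_inj _ s).
by rewrite si sj => -> ->.
Qed.

End Selection.

(** * Centring and second moments given the other samples *)

Section SampleFreezing.
Context {R : realType} {d m n : nat} (pb : fcco R d m n).
Context {dO : measure_display} {Omega : measurableType dO} (P : probability Omega R).
Variables (T Bz : nat) (sel : nat -> Omega -> {set 'I_n}).
Variables (bat : bool -> nat -> forall i, Omega -> 'I_Bz -> Z pb i).
Hypotheses (msel : forall t U, (t < T)%N -> measurable (sel t @^-1` U)).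
Hypotheses (mbat : forall c t i b, (t < T)%N ->
  measurable_fun setT (fun w => bat c t i w b)).
Hypotheses (lbat : forall c t i b (A : set (Z pb i)), (t < T)%N -> measurable A ->
  P [set w | A (bat c t i w b)] = zlaw pb i A).
Hypothesis hind : mutually_independent P (@sample_events _ _ _ _ pb _ Omega T Bz sel bat).
Let K := @sample_index n T Bz.

(* The sigma-algebra generated by all samples except [k]. *)
Definition others_type (k : K) : measurableType _ :=
  g_sigma_algebraType (@other_samples _ _ _ _ pb _ Omega T Bz sel bat k).

Lemma others_sel k (t : 'I_T) U : inl t != k ->
  @measurable _ (others_type k) (sel t @^-1` U).
Proof.
move=> tk; apply: sub_sigma_algebra; apply: other_samples_event tk _.
by exists U.
Qed.

Lemma others_bat k c (t : 'I_T) i b : inr (c, t, i, b) != k ->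
  measurable_fun [set: others_type k] (fun w => bat c t i w b).
Proof.
move=> tk _ A mA; apply: sub_sigma_algebra; apply: other_samples_event tk _.
by exists A.
Qed.

Let others_m k := other_samples_measurable (k := k) msel mbat.
Let others_I k := @other_samples_setI _ _ _ _ pb _ Omega T Bz sel bat k.
Let others_T k := @other_samples_setT _ _ _ _ pb _ Omega T Bz sel bat k.

Lemma others_measurable k dY (Y : measurableType dY) (f : Omega -> Y) :
  measurable_fun [set: others_type k] f -> measurable_fun setT f.
Proof. exact: (sub_sigma_measurable (@others_m k)). Qed.

Lemma others_mx_measurable k p q (f : Omega -> 'M[R]_(p, q)) :
  mx_measurable (Om := others_type k) f -> mx_measurable f.
Proof. by move=> mf l j; exact: (others_measurable (mf l j)). Qed.

Section Batch.
Variables (c : bool) (t : 'I_T) (i : 'I_n) (b : 'I_Bz).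
Let k : K := inr (c, t, i, b).
Let z w := bat c t i w b.
Let mz : measurable_fun setT z. Proof. exact: mbat. Qed.

Let ind A C : other_samples sel bat k A -> measurable C ->
  P (A `&` z @^-1` C) = (P A * zlaw pb i C)%E.
Proof.
move=> oA mC; rewrite -(lbat c b (ltn_ord t) mC).
apply: (other_samples_indep msel mbat hind oA).
by exists C => //; rewrite setTI.
Qed.

Lemma bat_mx_measurable p q (h : Omega * Z pb i -> 'M[R]_(p, q)) :
  mx_measurable (Om := (others_type k * Z pb i)%type) h ->
  mx_measurable (fun w => h (w, z w)).
Proof. by move=> mh l j; exact: (freeze_measurable (@others_m k) mz (mh l j)). Qed.

(** With all samples but [k] frozen, [p] is constant and [h] is a centred function of the one
    remaining sample. *)
Lemma bat_centred r (p : Omega -> 'rV[R]_r) (h : Omega * Z pb i -> 'rV[R]_r) :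
  mx_measurable (Om := others_type k) p ->
  mx_measurable (Om := (others_type k * Z pb i)%type) h ->
  vsqint P p -> vsqint P (fun w => h (w, z w)) ->
  (forall w j, hasmean (zlaw pb i) (fun s => h (w, s) 0 j) 0) ->
  mean P (fun w => dotv (p w) (h (w, z w))) = 0.
Proof.
move=> mp mh ip ih h0; rewrite mean_sum => [|j]; last exact: sqint_mul.
rewrite big1// => j _; apply: EFin_inj; rewrite -meanE; last exact: sqint_mul.
apply: (freeze_eq0 (@others_m k) (@others_I k) (@others_T k) mz ind
  (F := fun ws => (p ws.1 0 j * h ws 0 j)%:E)).
- apply/measurable_EFinP; apply: measurable_funM; last exact: mh.
  exact: (@measurable_fun_fst _ _ _ (others_type k) (Z pb i) R _ (mp 0 j)).
- exact: sqint_mul.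
- move=> w /=; have [i1 e1] := hasmeanZ (p w 0 j) (h0 w j).
  by rewrite meanE// e1 mulr0.
Qed.

Lemma bat_second_moment r (h : Omega * Z pb i -> 'rV[R]_r) C :
  mx_measurable (Om := (others_type k * Z pb i)%type) h ->
  (forall w, rintegrable (zlaw pb i) (fun s => dotv (h (w, s)) (h (w, s))) /\
     mean (zlaw pb i) (fun s => dotv (h (w, s)) (h (w, s))) <= C) ->
  vsqint P (fun w => h (w, z w)) /\
  mean P (fun w => dotv (h (w, z w)) (h (w, z w))) <= C.
Proof.
move=> mh hC.
have mhz := bat_mx_measurable mh.
have [ih mhC] : rintegrable P (fun w => dotv (h (w, z w)) (h (w, z w))) /\
    mean P (fun w => dotv (h (w, z w)) (h (w, z w))) <= C.
  apply: ge0_rintegrable_le.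
  - exact: measurable_dotv.
  - by move=> w; exact: dotvv_ge0.
  - rewrite -[leRHS](_ : \int[P]_w C%:E = C%:E)%E; last first.
      by rewrite (meanE (rintegrable_cst P C)) mean_cst.
    apply: (freeze_le (@others_m k) (@others_I k) (@others_T k) mz ind
      (F := fun ws => (dotv (h ws) (h ws))%:E)).
    + by apply/measurable_EFinP; exact: measurable_dotv.
    + by move=> ws; rewrite lee_fin dotvv_ge0.
    + by move=> w; have [i1 le] := hC w; rewrite meanE// lee_fin.
by split=> //; exact: vsqintP.
Qed.

End Batch.

(** The sample integrated out is the Boolean [Q (sel t w)]; minus its mean [p], it is centred
    against any [h] that does not see [sel t]. *)
Lemma sel_indep (t : 'I_T) (Q : {set 'I_n} -> bool) (h : Omega -> R) :
  measurable_fun [set: others_type (inl t)] h -> rintegrable P h ->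
  mean P (fun w => (Q (sel t w))%:R * h w) =
  mean P (fun w => (Q (sel t w))%:R) * mean P h.
Proof.
move=> mh ih; pose z w := Q (sel t w).
have msel' U : measurable (sel t @^-1` U) by exact: msel.
have zE C : z @^-1` C = sel t @^-1` [set U | C (Q U)] by [].
have mz : measurable_fun setT z by move=> _ C _; rewrite setTI zE.
pose zf : {mfun Omega >-> bool} := mfun_Sub (mem_set mz).
have ind A C : other_samples sel bat (inl t : K) A -> measurable C ->
    P (A `&` z @^-1` C) = (P A * distribution P zf C)%E.
  move=> oA mC; apply: (other_samples_indep msel mbat hind oA).
  by exists [set U | C (Q U)].
pose p := mean P (fun w => (z w)%:R).
have iz : rintegrable P (fun w => (z w)%:R) by exact: (rintegrable_sel P msel').
have iQ : rintegrable P (fun w => (z w)%:R * h w).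
  apply: (@rintegrable_le _ _ _ _ _ (fun w => `|h w|)).
  - by apply: measurable_funM;
      [exact: (measurable_sel msel')|exact: rintegrable_measurable ih].
  - by move=> w; rewrite normrM normr_nat; case: (z w); rewrite ?mul1r ?mul0r.
  - exact: integrable_norm.
have ip : rintegrable P (fun w => p * h w) by exact: rintegrableZ.
have mb : measurable_fun setT (fun s : bool => (s%:R : R)) by [].
have ib : rintegrable (distribution P zf) (fun s : bool => (s%:R : R)).
  by apply: (@rintegrable_bounded _ _ _ _ _ 1) => // -[]; rewrite ?normr1 ?normr0.
have pb0 : mean (distribution P zf) (fun s : bool => (s%:R : R)) = p.
  apply: EFin_inj; rewrite -!meanE//.
  by rewrite (integral_pushforward mz)//; apply/measurable_EFinP.
have : mean P (fun w => (z w)%:R * h w - p * h w) = 0.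
  apply: EFin_inj; rewrite -meanE; last exact: rintegrableB.
  apply: (freeze_eq0 (@others_m (inl t)) (@others_I (inl t)) (@others_T (inl t)) mz ind
    (F := fun ws => (ws.2%:R * h ws.1 - p * h ws.1)%:E)).
  - have mh1 : measurable_fun [set: (others_type (inl t) * bool)%type] (fun ws => h ws.1).
      exact: (@measurable_fun_fst _ _ _ (others_type (inl t)) bool R _ mh).
    apply/measurable_EFinP; apply: measurable_funB; apply: measurable_funM => //.
    exact: (measurableT_comp mb measurable_snd).
  - exact: rintegrableB.
  - move=> w /=.
    have [i1 e1] : hasmean (distribution P zf) (fun s : bool => s%:R * h w - p * h w) 0.
      rewrite -(subrr (p * h w)); apply: hasmeanB; last exact: hasmean_cst.
      under eq_fun do rewrite mulrC; rewrite mulrC; exact: hasmeanZ.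
    by rewrite meanE// e1.
by rewrite meanB// (meanZ _ ih) => /eqP; rewrite subr_eq0 => /eqP.
Qed.

End SampleFreezing.

(** [D0] and [D1] are the distances to the minimiser before and after a step, [Dl] the step length,
    [eps] the size of the direction error. The factor 8 compounds over the steps, but only
    square-integrability is drawn from it. *)
Lemma prox_step_growth {R : realType} (eta K eps D0 D1 Dl : R) :
  0 < eta -> 0 <= D0 -> 0 <= D1 -> 0 <= Dl -> 0 <= K -> 0 <= eps -> D1 <= D0 + Dl ->
  eta / 2 * Dl ^+ 2 <= K * D1 + eps * D1 + K * D0 + K * Dl + eta / 2 * D0 ^+ 2 ->
  D1 ^+ 2 <= 8 * D0 ^+ 2 + 128 * K ^+ 2 / eta ^+ 2 + 32 / eta ^+ 2 * eps ^+ 2.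
Proof.
move=> eta0 D00 D10 Dl0 K0 e0 tri h.
have e2 : 0 < eta ^+ 2 by rewrite exprn_gt0.
pose c := 2 * K + eps.
have c0 : 0 <= c by rewrite /c; lra.
have h1 : eta / 2 * Dl ^+ 2 <= c * (D0 + Dl) + eta / 2 * D0 ^+ 2.
  have := ler_wpM2l (addr_ge0 K0 e0) tri; rewrite /c; nra.
have y1 : 4 * eta * c * Dl <= eta ^+ 2 * Dl ^+ 2 + 4 * c ^+ 2.
  by have := sqr_ge0 (eta * Dl - 2 * c); nra.
have y2 : 4 * eta * c * D0 <= eta ^+ 2 * D0 ^+ 2 + 4 * c ^+ 2.
  by have := sqr_ge0 (eta * D0 - 2 * c); nra.
have h2 : eta ^+ 2 * Dl ^+ 2 <= 3 * eta ^+ 2 * D0 ^+ 2 + 8 * c ^+ 2.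
  have := ler_wpM2l (ltW eta0) h1; nra.
have h3 : D1 ^+ 2 <= 2 * D0 ^+ 2 + 2 * Dl ^+ 2.
  have := sqr_ge0 (D0 - Dl).
  have : D1 ^+ 2 <= (D0 + Dl) ^+ 2 by rewrite lerXn2r ?nnegrE// addr_ge0.
  nra.
have h4 : c ^+ 2 <= 8 * K ^+ 2 + 2 * eps ^+ 2.
  by rewrite /c; have := sqr_ge0 (2 * K - eps); nra.
rewrite -(ler_pM2l e2).
have -> : eta ^+ 2 * (8 * D0 ^+ 2 + 128 * K ^+ 2 / eta ^+ 2 + 32 / eta ^+ 2 * eps ^+ 2)
  = 8 * (eta ^+ 2 * D0 ^+ 2) + 128 * K ^+ 2 + 32 * eps ^+ 2 by field; rewrite gt_eqF.
have := ler_wpM2l (ltW e2) h3; nra.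
Qed.

(** * Moments of the dual, inner-value and direction noises *)

Section Moments.
Context {R : realType} {d m n : nat} (pb : fcco R d m n).
Context {dO : measure_display} {Omega : measurableType dO} (P : probability Omega R).
Variables (a b M s0 s1 delta eta tau : R) (N : 'rV[R]_m -> R).
Variables (Sz Bz T : nat) (x0 : 'rV[R]_d) (y0 : 'I_n -> 'rV[R]_m).
Variables (sel : nat -> Omega -> {set 'I_n}).
Variables (bat : bool -> nat -> forall i, Omega -> 'I_Bz -> Z pb i).
Variables (x : nat -> Omega -> 'rV[R]_d) (y yb : nat -> Omega -> 'I_n -> 'rV[R]_m).
Hypotheses (Sz0 : (0 < Sz)%N) (Szn : (Sz <= n)%N) (Bz0 : (0 < Bz)%N).
Hypotheses (eta0 : 0 < eta) (tau0 : 0 < tau).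
Hypotheses (a0 : 0 < a) (Nn : is_norm N) (Nab : norm_equiv a b N).
Hypotheses (cX : closed (X pb)) (hor : assumption_oracle pb N s0 s1 delta).
Hypotheses (cr : rconvex_on (rdom pb) (rreg pb)).
Hypotheses (Ybd : forall i v, Ydom pb i v -> norm2 v <= M).
Hypothesis run : prox_run eta tau Sz T x0 y0 sel bat x y yb.
Hypotheses (msel : forall t U, (t < T)%N -> measurable (sel t @^-1` U)).
Hypotheses (csel : forall t w, (t < T)%N -> #|sel t w| = Sz).
Hypotheses (usel : forall t (U : {set 'I_n}), (t < T)%N -> #|U| = Sz ->
    P [set w | sel t w = U] = (('C(n, Sz))%:R^-1)%:E).
Hypotheses (mbat : forall c t i b, (t < T)%N ->
  measurable_fun setT (fun w => bat c t i w b)).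
Hypotheses (lbat : forall c t i b (A : set (Z pb i)), (t < T)%N -> measurable A ->
  P [set w | A (bat c t i w b)] = zlaw pb i A).
Hypothesis hind : mutually_independent P (@sample_events _ _ _ _ pb _ Omega T Bz sel bat).

Let K := @sample_index n T Bz.
Let OT (k : K) := others_type sel bat k.
Let g := ginner pb.
Let g' := ginner' pb.
Let mor : oracle_measurable pb. Proof. by case: hor. Qed.
Let n0 : (0 < n)%N. Proof. exact: leq_trans Szn. Qed.
Let nR0 : n%:R != 0 :> R. Proof. by rewrite pnatr_eq0 -lt0n. Qed.
Let SR0 : Sz%:R != 0 :> R. Proof. by rewrite pnatr_eq0 -lt0n. Qed.
Let BR0 : Bz%:R != 0 :> R. Proof. by rewrite pnatr_eq0 -lt0n. Qed.
Let rho : R := n%:R / Sz%:R.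
Let Xx t w : (t <= T)%N -> X pb (x t w). Proof. exact: (run_X run). Qed.

Let q t w i := yb t w i - y t w i.
Let ind t w i : R := (i \in sel t w)%:R.
Let xi t w i := (1 - rho * ind t w i) *: q t w i.
Let nu t w i := extrapolation bat x t w i - (g i (x t w) *+ 2 - g i (x t.-1 w)).
Let e t w := direction Sz sel bat x yb t w
  - n%:R^-1 *: \sum_(i < n) yb t w i *m (g' i (x t w))^T.

Definition sample_time (k : K) : 'I_T :=
  match k with inl t => t | inr (_, t, _, _) => t end.

(** An iterate of index at most the time of [k] is computed from samples of strictly earlier
    times. *)
Lemma others_iterates k s : (s <= sample_time k)%N ->
  mx_measurable (Om := OT k) (x s) /\
  forall i, mx_measurable (Om := OT k) (fun w => y s w i).
Proof.
move=> st; apply: (mx_measurable_iterates (Om := OT k) eta0 tau0 cX mor cr run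
  (t := sample_time k)) => //; first exact: ltnW.
move=> t' t't.
have t'T : (t' < T)%N := ltn_trans t't (ltn_ord _).
pose tt := Ordinal t'T.
have ne : tt != sample_time k by rewrite neq_ltn t't.
split=> [U|c i b0].
  by apply: (@others_sel _ _ _ _ _ _ _ _ _ _ _ _ tt); apply: contra ne => /eqP <-.
by apply: (@others_bat _ _ _ _ _ _ _ _ _ _ _ _ _ tt); apply: contra ne => /eqP <-.
Qed.

(** Among the samples of time [t], [yb t] sees only the inner-value batch of its own block. In
    particular [k] may be the block selection or a gradient sample of time [t]. *)
Lemma others_yb k (t : 'I_T) i : (t <= sample_time k)%N ->
  (forall b0, inr (false, t, i, b0) != k) ->
  mx_measurable (Om := OT k) (fun w => yb t w i).
Proof.
move=> tk ne; have [mx my] := others_iterates tk.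
have [mx1 _] := others_iterates (leq_trans (leq_pred t) tk).
apply: (mx_measurable_yb (Om := OT k) tau0 cX mor run) => // b0.
exact: others_bat.
Qed.

Let iterates t : (t <= T)%N ->
  mx_measurable (x t) /\ forall i, mx_measurable (fun w => y t w i).
Proof.
move=> tT; apply: (mx_measurable_iterates eta0 tau0 cX mor cr run tT) => // t' t't.
have t'T := leq_trans t't tT.
by split=> [U|c i b0]; [exact: msel|exact: mbat].
Qed.

Let mx_yb t i : (t < T)%N -> mx_measurable (fun w => yb t w i).
Proof.
move=> tT; have [mx my] := iterates (ltnW tT).
have [mx1 _] := iterates (leq_trans (leq_pred t) (ltnW tT)).
by apply: (mx_measurable_yb tau0 cX mor run) => // b0; exact: mbat.
Qed.

Lemma vsqint_y t i : (t <= T)%N -> vsqint P (fun w => y t w i - y0 i).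
Proof.
move=> tT; have [_ my] := iterates tT.
apply: (@vsqint_bounded _ _ _ _ _ _ (M + M)).
  by apply: mx_measurableB => //; exact: mx_measurable_cst.
move=> w; apply: (le_trans (norm2B_le _ _)); apply: lerD; apply: Ybd.
  exact: (run_Y run).
by rewrite -(run_y0 run w); exact: (run_Y run).
Qed.

Lemma vsqint_q t i : (t < T)%N -> vsqint P (fun w => q t w i).
Proof.
move=> tT; have [_ my] := iterates (ltnW tT).
apply: (@vsqint_bounded _ _ _ _ _ _ (M + M)).
  by apply: mx_measurableB => //; exact: mx_yb.
move=> w; apply: (le_trans (norm2B_le _ _)); apply: lerD; apply: Ybd.
  exact: (run_Yb run).
by apply: (run_Y run); exact: ltnW.
Qed.

(** Contribution of one sample to [nu]. The same draw enters at both points, so the two errors are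
    correlated and treated as one centred vector. *)
Let nhat t i (ws : Omega * Z pb i) : 'rV[R]_m :=
  2 *: (soracle pb i (x t ws.1) ws.2 - g i (x t ws.1))
  - (soracle pb i (x t.-1 ws.1) ws.2 - g i (x t.-1 ws.1)).

Arguments nhat : clear implicits.

Let nsample t i b0 w := nhat t i (w, bat false t i w b0).

Let nuE t w i : nu t w i = Bz%:R^-1 *: \sum_(b0 < Bz) nsample t i b0 w.
Proof.
pose A b0 := soracle pb i (x t w) (bat false t i w b0).
pose C b0 := soracle pb i (x t.-1 w) (bat false t i w b0).
have -> : \sum_(b0 < Bz) nsample t i b0 w =
    2 *: (\sum_(b0 < Bz) A b0) - \sum_(b0 < Bz) C b0
    - Bz%:R *: (g i (x t w) *+ 2 - g i (x t.-1 w)).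
  have -> : Bz%:R *: (g i (x t w) *+ 2 - g i (x t.-1 w)) =
      \sum_(b0 < Bz) (g i (x t w) *+ 2 - g i (x t.-1 w)).
    by rewrite sumr_const card_ord scaler_nat.
  rewrite scaler_sumr -!sumrB.
  by apply: eq_bigr => b0 _; apply/rowP => j; rewrite /nsample /nhat !mxE; ring.
rewrite !scalerBr !scalerA mulVf// !scale1r /nu /extrapolation /minibatch.
by apply/rowP => j; rewrite !mxE; ring.
Qed.

Let mx_residual {d1} {Om' : measurableType d1} (x' : Om' -> 'rV[R]_d) i :
  mx_measurable x' -> (forall w, X pb (x' w)) ->
  mx_measurable (fun ws : Om' * Z pb i =>
    soracle pb i (x' ws.1) ws.2 - ginner pb i (x' ws.1)).
Proof.
move=> mx' Xx'; apply: mx_measurableB.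
  apply: (mx_measurable_soracle (z := fun ws : Om' * Z pb i => ws.2) cX mor) => //.
    exact: (@mx_measurable_fst _ _ _ Om' (Z pb i) _ _ _ mx').
  exact: measurable_snd.
have mg := mx_measurable_ginner cX hor mx' Xx' i.
exact: (@mx_measurable_fst _ _ _ Om' (Z pb i) _ _ _ mg).
Qed.

Let mx_nhat k t i : (t <= sample_time k)%N ->
  mx_measurable (Om := (OT k * Z pb i)%type) (nhat t i).
Proof.
move=> tk; have tT : (t <= T)%N := leq_trans tk (ltnW (ltn_ord _)).
have [mx _] := others_iterates tk.
have [mx1 _] := others_iterates (leq_trans (leq_pred t) tk).
apply: mx_measurableB; last first.
  apply: (@mx_residual _ (OT k)) => // w; apply: Xx.
  exact: leq_trans (leq_pred t) tT.
by apply: mx_measurableZc; apply: (@mx_residual _ (OT k)) => // w; exact: Xx.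
Qed.

Let nhat_centred t i w j : (t <= T)%N ->
  hasmean (zlaw pb i) (fun s => nhat t i (w, s) 0 j) 0.
Proof.
move=> tT; have t1T := leq_trans (leq_pred t) tT.
rewrite (_ : (fun s => _) = fun s =>
   2 * (soracle pb i (x t w) s 0 j - ginner pb i (x t w) 0 j)
   - (soracle pb i (x t.-1 w) s 0 j - ginner pb i (x t.-1 w) 0 j)); last first.
  by apply/funext => s; rewrite !mxE.
have z u : X pb u ->
    hasmean (zlaw pb i) (fun s => soracle pb i u s 0 j - ginner pb i u 0 j) 0.
  move=> Xu; rewrite -(subrr (ginner pb i u 0 j)).
  by apply: hasmeanB; [exact: hasmean_soracle hor _ _ _ Xu|exact: hasmean_cst].
have := hasmeanB (hasmeanZ 2 (z _ (Xx w tT))) (z _ (Xx w t1T)).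
by rewrite mulr0 subr0.
Qed.

(** The 10 is 8 + 2: the squared norm of [2 *: u - v] is at most 8 times that of [u] plus 2 times
    that of [v]. *)
Let nhat_second t i w : (t <= T)%N ->
  rintegrable (zlaw pb i) (fun s => dotv (nhat t i (w, s)) (nhat t i (w, s))) /\
  mean (zlaw pb i) (fun s => dotv (nhat t i (w, s)) (nhat t i (w, s)))
    <= 10 * var_g a b s0.
Proof.
move=> tT; have t1T := leq_trans (leq_pred t) tT.
have [i1 m1] := soracle_variance a0 Nn Nab cX hor i (Xx w tT).
have [i2 m2] := soracle_variance a0 Nn Nab cX hor i (Xx w t1T).
have mn : mx_measurable (fun s => nhat t i (w, s)).
  have mr u : X pb u -> mx_measurable (fun s => soracle pb i u s - ginner pb i u).
    move=> Xu; apply: mx_measurableB; last exact: mx_measurable_cst.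
    by apply: (mx_measurable_soracle (z := fun s => s) cX mor (mx_measurable_cst u)) => //;
      exact: measurable_id.
  apply: mx_measurableB; last exact: (mr _ (Xx w t1T)).
  by apply: mx_measurableZc; exact: (mr _ (Xx w tT)).
have i8 := rintegrableZ 8 i1; have i2' := rintegrableZ 2 i2.
have le s : dotv (nhat t i (w, s)) (nhat t i (w, s)) <=
   8 * dotv (soracle pb i (x t w) s - ginner pb i (x t w))
            (soracle pb i (x t w) s - ginner pb i (x t w))
   + 2 * dotv (soracle pb i (x t.-1 w) s - ginner pb i (x t.-1 w))
              (soracle pb i (x t.-1 w) s - ginner pb i (x t.-1 w)).
  apply: (le_trans (dotvv_distDle _ _)).
  by rewrite dotvNl dotvNr opprK dotvZl dotvZr /=; lra.
have isum := rintegrableD i8 i2'.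
have ih : rintegrable (zlaw pb i) (fun s => dotv (nhat t i (w, s)) (nhat t i (w, s))).
  apply: (rintegrable_le _ _ isum); first exact: measurable_dotv.
  by move=> s; rewrite ger0_norm ?dotvv_ge0.
split=> //; apply: (le_trans (mean_le ih isum le)).
rewrite meanD// !meanZ//; lra.
Qed.

Let kN (t : 'I_T) i b0 : K := inr (false, t, i, b0).

Let nsample_second (t : 'I_T) i b0 : vsqint P (nsample t i b0) /\
  mean P (fun w => dotv (nsample t i b0 w) (nsample t i b0 w)) <= 10 * var_g a b s0.
Proof.
apply: (bat_second_moment msel mbat lbat hind (t := t) (h := nhat t i)).
  exact: (@mx_nhat (kN t i b0)).
by move=> w; apply: nhat_second; exact: ltnW.
Qed.

Let mx_nsample k (t : 'I_T) i b0 : (t <= sample_time k)%N -> kN t i b0 != k ->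
  mx_measurable (Om := OT k) (nsample t i b0).
Proof.
move=> tk ne; have tT : (t <= T)%N := ltnW (ltn_ord _).
have t1T := leq_trans (leq_pred t) tT.
have [mx _] := others_iterates tk.
have [mx1 _] := others_iterates (leq_trans (leq_pred t) tk).
have mz := others_bat ne.
have mr s : (s <= T)%N -> mx_measurable (Om := OT k) (x s) ->
    mx_measurable (Om := OT k)
      (fun w => soracle pb i (x s w) (bat false t i w b0) - ginner pb i (x s w)).
  move=> sT mxs; have Xs w : X pb (x s w) by exact: Xx.
  apply: mx_measurableB; last exact: (mx_measurable_ginner cX hor (Om := OT k)).
  exact: (mx_measurable_soracle cX mor (Om := OT k)).
by apply: mx_measurableB; [apply: mx_measurableZc|]; apply: mr.
Qed.

Let nsample_centred (t : 'I_T) i b0 (p : Omega -> 'rV[R]_m) :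
  mx_measurable (Om := OT (kN t i b0)) p -> vsqint P p ->
  mean P (fun w => dotv (p w) (nsample t i b0 w)) = 0.
Proof.
move=> mp ip; apply: (bat_centred msel mbat lbat hind (t := t) (h := nhat t i) mp) => //.
- exact: (@mx_nhat (kN t i b0)).
- by have [] := nsample_second t i b0.
- by move=> w j; apply: nhat_centred; exact: ltnW.
Qed.

Let vsqint_nsample_sum (t : 'I_T) i : vsqint P (fun w => \sum_(b0 < Bz) nsample t i b0 w).
Proof. by apply: vsqint_sum => b0; have [] := nsample_second t i b0. Qed.

Let nuEfun t i : (fun w => nu t w i) = (fun w => Bz%:R^-1 *: \sum_(b0 < Bz) nsample t i b0 w).
Proof. by apply/funext => w; exact: nuE. Qed.

Lemma vsqint_nu (t : 'I_T) i : vsqint P (fun w => nu t w i).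
Proof. rewrite nuEfun; apply: vsqintZ; exact: vsqint_nsample_sum. Qed.

Let nu_centred (t : 'I_T) i (p : Omega -> 'rV[R]_m) :
  (forall b0, mx_measurable (Om := OT (kN t i b0)) p) -> vsqint P p ->
  mean P (fun w => dotv (p w) (nu t w i)) = 0.
Proof.
move=> mp ip.
rewrite (_ : (fun w => _) = fun w =>
   Bz%:R^-1 * \sum_(b0 < Bz) dotv (p w) (nsample t i b0 w)); last first.
  by apply/funext => w; rewrite nuE dotvZr dotv_sumr.
have i1 b0 : rintegrable P (fun w => dotv (p w) (nsample t i b0 w)).
  by apply: vsqint_dotv => //; have [] := nsample_second t i b0.
rewrite meanZ; last exact: rintegrable_sum.
by rewrite mean_sum// big1 ?mulr0// => b0 _; exact: nsample_centred.
Qed.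

(** Errors of distinct samples of a mini-batch are orthogonal, which produces the factor 1/B. *)
Lemma mean_nu_sqr (t : 'I_T) i :
  mean P (fun w => dotv (nu t w i) (nu t w i)) <= 10 * var_g a b s0 / Bz%:R.
Proof.
rewrite (_ : (fun w => _) = fun w => (Bz%:R^-1 ^+ 2) *
   dotv (\sum_(b0 < Bz) nsample t i b0 w) (\sum_(b0 < Bz) nsample t i b0 w)); last first.
  by apply/funext => w; rewrite nuE dotvZl dotvZr mulrA expr2.
rewrite meanZ; last by apply: vsqint_dotv; exact: vsqint_nsample_sum.
rewrite mean_dotv_orthogonal_sum; first last.
- move=> b0 b1 b01; apply: nsample_centred; last by have [] := nsample_second t i b0.
  by apply: mx_nsample => //; apply: contra b01 => /eqP[->].
- by move=> b0; have [] := nsample_second t i b0.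
rewrite -[10 * _ in leRHS]mulr1.
apply: (@le_trans _ _ (Bz%:R^-1 ^+ 2 * \sum_(b0 < Bz) 10 * var_g a b s0)).
  rewrite ler_wpM2l ?sqr_ge0//; apply: ler_sum => b0 _.
  by have [] := nsample_second t i b0.
by rewrite sumr_const card_ord -mulr_natl le_eqVlt; apply/orP; left; apply/eqP; field.
Qed.

Lemma mx_nu k (t : 'I_T) i : (t <= sample_time k)%N ->
  (forall b0, kN t i b0 != k) -> mx_measurable (Om := OT k) (fun w => nu t w i).
Proof.
move=> tk ne; rewrite nuEfun; apply: mx_measurableZc; apply: mx_measurable_sum => b0.
exact: mx_nsample.
Qed.

Lemma mean_nu_sum_sqr i :
  mean P (fun w => dotv (\sum_(t < T) nu t w i) (\sum_(t < T) nu t w i))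
  <= T%:R * (10 * var_g a b s0 / Bz%:R).
Proof.
have lt0 (s t : 'I_T) : (s < t)%N -> mean P (fun w => dotv (nu s w i) (nu t w i)) = 0.
  move=> st; apply: nu_centred; last exact: vsqint_nu.
  move=> b0; apply: mx_nu; first exact: ltnW.
  by move=> b1; apply/eqP => -[E _]; move: st; rewrite E ltnn.
rewrite mean_dotv_orthogonal_sum => [|t|s t]; last first.
- rewrite neq_ltn => /orP[|ts]; first exact: lt0.
  by under eq_fun do rewrite dotvC; exact: lt0.
- exact: vsqint_nu.
apply: (@le_trans _ _ (\sum_(t < T) (10 * var_g a b s0 / Bz%:R))).
  by apply: ler_sum => t _; exact: mean_nu_sqr.
by rewrite sumr_const card_ord -[leLHS]mulr_natl.
Qed.

Lemma mean_y_nu (t : 'I_T) i : mean P (fun w => dotv (y t w i - y0 i) (nu t w i)) = 0.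
Proof.
apply: nu_centred; last by apply: vsqint_y; exact: ltnW.
move=> b0; apply: mx_measurableB; last exact: mx_measurable_cst.
by have [_] := @others_iterates (kN t i b0) t (leqnn _).
Qed.

Let ind_bound t w i : `|ind t w i| <= 1.
Proof. by rewrite /ind normr_nat; case: (_ \in _). Qed.

Let mind (t : 'I_T) i : measurable_fun setT (fun w => ind t w i).
Proof.
by apply: (@measurable_sel _ _ _ _ (sel t) _ (fun U => i \in U)) => U; exact: msel.
Qed.

Let others_ind k (t : 'I_T) i : inl t != k ->
  measurable_fun [set: OT k] (fun w => ind t w i).
Proof.
move=> ne; apply: (@measurable_sel _ _ _ (OT k) (sel t) _ (fun U => i \in U)) => U.
exact: others_sel.
Qed.

Let mean_ind (t : 'I_T) i : mean P (fun w => ind t w i) = Sz%:R / n%:R.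
Proof.
exact: (mean_mem Sz0 Szn (fun U => @msel t U (ltn_ord t))
  (fun w => @csel t w (ltn_ord t)) (fun U => @usel t U (ltn_ord t))).
Qed.

Let mean_ind_mul (t : 'I_T) i (h : Omega -> R) :
  measurable_fun [set: OT (inl t)] h -> rintegrable P h ->
  rintegrable P (fun w => ind t w i * h w) /\
  mean P (fun w => ind t w i * h w) = Sz%:R / n%:R * mean P h.
Proof.
move=> mh ih; split; last first.
  by rewrite (sel_indep msel mbat hind (fun U => i \in U) mh ih) -(mean_ind t i).
apply: (@rintegrable_le _ _ _ _ _ (fun w => `|h w|)).
- by apply: measurable_funM; [exact: mind|exact: rintegrable_measurable ih].
- by move=> w; rewrite normrM ler_piMl.
- exact: integrable_norm.
Qed.

(** [rho] is the inverse inclusion probability, so [1 - rho * ind t w i] is centred and independent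
    of [h]. *)
Let mean_unsampled (t : 'I_T) i (h : Omega -> R) :
  measurable_fun [set: OT (inl t)] h -> rintegrable P h ->
  rintegrable P (fun w => (1 - rho * ind t w i) * h w) /\
  mean P (fun w => (1 - rho * ind t w i) * h w) = 0.
Proof.
move=> mh ih; have [i1 m1] := mean_ind_mul i mh ih.
have E : (fun w => (1 - rho * ind t w i) * h w) = (fun w => h w - rho * (ind t w i * h w)).
  by apply/funext => w; ring.
have i2 := rintegrableZ rho i1.
rewrite E; split; first exact: rintegrableB.
by rewrite meanB// meanZ// m1 /rho; field; rewrite SR0 nR0.
Qed.

Let others_q (t : 'I_T) i : mx_measurable (Om := OT (inl t)) (fun w => q t w i).
Proof.
have [_ my] := @others_iterates (inl t) t (leqnn _).
by apply: mx_measurableB => //; exact: others_yb.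
Qed.

Lemma vsqint_xi (t : 'I_T) i : vsqint P (fun w => xi t w i).
Proof.
apply: (@vsqint_bscale _ _ _ _ _ _ _ (1 + `|rho|)); last exact: vsqint_q.
- apply: measurable_funB; first exact: measurable_cst.
  by apply: measurable_funM; [exact: measurable_cst|exact: mind].
- move=> w; apply: (le_trans (ler_normB _ _)); rewrite normr1 lerD2l normrM.
  by rewrite ler_piMr.
Qed.

Let xi_centred (t : 'I_T) i (p : Omega -> 'rV[R]_m) :
  mx_measurable (Om := OT (inl t)) p -> vsqint P p ->
  mean P (fun w => dotv (p w) (xi t w i)) = 0.
Proof.
move=> mp ip; under eq_fun do rewrite dotvZr.
have [] // := @mean_unsampled t i (fun w => dotv (p w) (q t w i)).
  by apply: measurable_dotv => //; exact: others_q.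
by apply: vsqint_dotv => //; exact: vsqint_q.
Qed.

Lemma mean_y_xi (t : 'I_T) i : mean P (fun w => dotv (y t w i - y0 i) (xi t w i)) = 0.
Proof.
apply: xi_centred; last by apply: vsqint_y; exact: ltnW.
apply: mx_measurableB; last exact: mx_measurable_cst.
by have [_] := @others_iterates (inl t) t (leqnn _).
Qed.

Let rintegrable_qq (t : 'I_T) i : rintegrable P (fun w => dotv (q t w i) (q t w i)).
Proof. by apply: vsqint_dotv; exact: vsqint_q. Qed.

Lemma mean_unsampled_qq (t : 'I_T) i :
  rintegrable P (fun w => (1 - rho * ind t w i) * dotv (q t w i) (q t w i)) /\
  mean P (fun w => (1 - rho * ind t w i) * dotv (q t w i) (q t w i)) = 0.
Proof.
apply: mean_unsampled; last exact: rintegrable_qq.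
by apply: measurable_dotv; exact: others_q.
Qed.

Lemma mean_xi_sqr (t : 'I_T) i :
  mean P (fun w => dotv (xi t w i) (xi t w i)) <=
  rho * mean P (fun w => dotv (q t w i) (q t w i)).
Proof.
have [i1 m1] := mean_unsampled_qq t i.
have i2 := rintegrable_qq t i.
(* Because [ind] is idempotent, the square of [1 - rho * ind] is affine in it: a multiple of the
   centred factor plus [rho - 1]. *)
rewrite (_ : (fun w => _) = fun w =>
  (2 - rho) * ((1 - rho * ind t w i) * dotv (q t w i) (q t w i))
  + (rho - 1) * dotv (q t w i) (q t w i)); last first.
  apply/funext => w; rewrite dotvZl dotvZr /ind; case: (_ \in _) => /=; ring.
rewrite meanD; [|exact: rintegrableZ|exact: rintegrableZ].
rewrite !meanZ// m1 mulr0 add0r ler_wpM2r ?gerBl//.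
by apply: mean_ge0 => w; exact: dotvv_ge0.
Qed.

Lemma mean_xi_sum_sqr i :
  mean P (fun w => dotv (\sum_(t < T) xi t w i) (\sum_(t < T) xi t w i))
  <= rho * \sum_(t < T) mean P (fun w => dotv (q t w i) (q t w i)).
Proof.
have lt0 (s t : 'I_T) : (s < t)%N -> mean P (fun w => dotv (xi s w i) (xi t w i)) = 0.
  move=> st; apply: xi_centred; last exact: vsqint_xi.
  have ne : inl s != inl t :> K by apply/eqP => -[E]; move: st; rewrite E ltnn.
  apply: mx_measurableZ.
    apply: measurable_funB; first exact: measurable_cst.
    by apply: measurable_funM; [exact: measurable_cst|exact: others_ind].
  have [_ my] := @others_iterates (inl t) s (ltnW st).
  by apply: mx_measurableB => //; apply: others_yb => //; exact: ltnW.
rewrite mean_dotv_orthogonal_sum => [|t|s t]; last first.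
- rewrite neq_ltn => /orP[|ts]; first exact: lt0.
  by under eq_fun do rewrite dotvC; exact: lt0.
- exact: vsqint_xi.
by rewrite mulr_sumr; apply: ler_sum => t _; exact: mean_xi_sqr.
Qed.

Let mhat t i (ws : Omega * Z pb i) : 'rV[R]_d :=
  yb t ws.1 i *m (soracle' pb i (x t ws.1) ws.2 - g' i (x t ws.1))^T.
Arguments mhat : clear implicits.

Let msample t i b0 w := mhat t i (w, bat true t i w b0).
Let usample t i b0 w := ind t w i *: msample t i b0 w.
Let kG (t : 'I_T) i b0 : K := inr (true, t, i, b0).
Let C1 := var_g' a b M s1.

Let mx_mhat k (t : 'I_T) i : (t <= sample_time k)%N ->
  (forall b0, kN t i b0 != k) ->
  mx_measurable (Om := (OT k * Z pb i)%type) (mhat t i).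
Proof.
move=> tk ne; have tT : (t <= T)%N := ltnW (ltn_ord _).
have Xt w : X pb (x t w) by exact: Xx.
have [mx _] := others_iterates tk.
have my := others_yb tk ne.
have mg := mx_measurable_ginner' cX hor mx Xt i.
apply: mx_measurableM.
  exact: (@mx_measurable_fst _ _ _ (OT k) (Z pb i) _ _ _ my).
apply: mx_measurable_tr; apply: mx_measurableB.
  apply: (mx_measurable_soracle' (Om := (OT k * Z pb i)%type)
    (z := fun ws : OT k * Z pb i => ws.2) cX mor) => //.
    exact: (@mx_measurable_fst _ _ _ (OT k) (Z pb i) _ _ _ mx).
  exact: measurable_snd.
exact: (@mx_measurable_fst _ _ _ (OT k) (Z pb i) _ _ _ mg).
Qed.

Let mx_msample k (t : 'I_T) i b0 : (t <= sample_time k)%N ->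
  (forall b1, kN t i b1 != k) -> kG t i b0 != k ->
  mx_measurable (Om := OT k) (msample t i b0).
Proof.
move=> tk ne neG; have tT : (t <= T)%N := ltnW (ltn_ord _).
have Xt w : X pb (x t w) by exact: Xx.
have [mx _] := others_iterates tk.
have my := others_yb tk ne.
have mg := mx_measurable_ginner' cX hor mx Xt i.
apply: mx_measurableM => //; apply: mx_measurable_tr; apply: mx_measurableB => //.
exact: (mx_measurable_soracle' (Om := OT k) cX mor mx Xt (others_bat neG)).
Qed.

Let mhat_centred (t : 'I_T) i w l :
  hasmean (zlaw pb i) (fun s => mhat t i (w, s) 0 l) 0.
Proof.
have Xt : X pb (x t w) by apply: Xx; exact: ltnW.
rewrite (_ : (fun s => _) = fun s => \sum_(j < m) yb t w i 0 j *
  (soracle' pb i (x t w) s l j - ginner' pb i (x t w) l j)); last first.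
  by apply/funext => s; rewrite mxE; apply: eq_bigr => j _; rewrite !mxE.
have h j : hasmean (zlaw pb i) (fun s => yb t w i 0 j *
    (soracle' pb i (x t w) s l j - ginner' pb i (x t w) l j)) 0.
  have := hasmeanZ (yb t w i 0 j) (hasmeanB (hasmean_soracle' hor i l j Xt)
    (hasmean_cst (zlaw pb i) (ginner' pb i (x t w) l j))).
  by rewrite subrr mulr0.
have := hasmean_sum (index_enum 'I_m) h.
by rewrite big1.
Qed.

Let msample_second (t : 'I_T) i b0 : vsqint P (msample t i b0) /\
  mean P (fun w => dotv (msample t i b0 w) (msample t i b0 w)) <= C1.
Proof.
apply: (bat_second_moment msel mbat lbat hind (t := t) (h := mhat t i)).
  exact: (@mx_mhat (kG t i b0)).
move=> w; have ybM : norm2 (yb t w i) <= M.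
  by apply: (Ybd (i := i)); exact: (run_Yb run).
exact: (soracle'_variance a0 Nn Nab cX hor i ybM (Xx w (ltnW (ltn_ord t)))).
Qed.

Let vsqint_usample (t : 'I_T) i b0 : vsqint P (usample t i b0).
Proof.
apply: (@vsqint_bscale _ _ _ _ _ _ _ 1); [exact: mind|by move=> w; exact: ind_bound|].
by have [] := msample_second t i b0.
Qed.

Let usample_centred (t : 'I_T) i b0 (p : Omega -> 'rV[R]_d) :
  mx_measurable (Om := OT (kG t i b0)) p -> vsqint P p ->
  mean P (fun w => dotv (p w) (usample t i b0 w)) = 0.
Proof.
move=> mp ip; apply: (bat_centred msel mbat lbat hind (t := t)
  (h := fun ws => ind t ws.1 i *: mhat t i ws) mp) => //.
- apply: mx_measurableZ; last exact: (@mx_mhat (kG t i b0)).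
  apply: (@measurable_fun_fst _ _ _ (OT (kG t i b0)) (Z pb i) R (fun w => ind t w i)).
  exact: others_ind.
- exact: vsqint_usample.
- move=> w j; under eq_fun do rewrite mxE.
  by have := hasmeanZ (ind t w i) (mhat_centred t i w j); rewrite mulr0.
Qed.

Let mx_usample k (t : 'I_T) i b0 : (t <= sample_time k)%N ->
  (forall b1, kN t i b1 != k) -> kG t i b0 != k -> inl t != k ->
  mx_measurable (Om := OT k) (usample t i b0).
Proof.
move=> tk ne neG neS; apply: mx_measurableZ; last exact: mx_msample.
exact: others_ind.
Qed.

Let ind_sqr t w i : ind t w i * ind t w i = ind t w i.
Proof. by rewrite /ind; case: (_ \in _); rewrite ?mulr1 ?mulr0. Qed.

Let usample_second (t : 'I_T) i b0 :
  mean P (fun w => dotv (usample t i b0 w) (usample t i b0 w)) <= Sz%:R / n%:R * C1.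
Proof.
have [im mm] := msample_second t i b0.
rewrite (_ : (fun w => _) = fun w => ind t w i * dotv (msample t i b0 w) (msample t i b0 w)).
  have [_ ->] := @mean_ind_mul t i (fun w => dotv (msample t i b0 w) (msample t i b0 w))
    (measurable_dotv (mx_msample (k := inl t) (leqnn _) (fun=> isT) isT)
       (mx_msample (k := inl t) (leqnn _) (fun=> isT) isT))
    (vsqint_dotv im im).
  by rewrite ler_wpM2l ?divr_ge0.
by apply/funext => w; rewrite dotvZl dotvZr mulrA ind_sqr.
Qed.

(** Part of the direction error due to the gradient samples of the selected blocks; [e2] below is
    the part due to block selection. *)
Let e1 t w : 'rV[R]_d := (Sz%:R * Bz%:R)^-1 *:
  \sum_(ib : 'I_n * 'I_Bz) usample t ib.1 ib.2 w.

Let vsqint_e1 (t : 'I_T) : vsqint P (e1 t).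
Proof. by apply: vsqintZ; apply: vsqint_sum => ib; exact: vsqint_usample. Qed.

Let C10 : 0 <= C1. Proof. exact: sqr_ge0. Qed.

Let mean_e1_sqr (t : 'I_T) : mean P (fun w => dotv (e1 t w) (e1 t w)) <= C1 / Sz%:R.
Proof.
have isum : vsqint P (fun w => \sum_(ib : 'I_n * 'I_Bz) usample t ib.1 ib.2 w).
  by apply: vsqint_sum => ib; exact: vsqint_usample.
rewrite (_ : (fun w => _) = fun w => (Sz%:R * Bz%:R)^-1 ^+ 2 *
  dotv (\sum_(ib : 'I_n * 'I_Bz) usample t ib.1 ib.2 w)
       (\sum_(ib : 'I_n * 'I_Bz) usample t ib.1 ib.2 w)); last first.
  by apply/funext => w; rewrite dotvZl dotvZr mulrA expr2.
rewrite meanZ; last exact: vsqint_dotv.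
rewrite mean_dotv_orthogonal_sum; first last.
- move=> [i b0] [j b1] /= ne; apply: usample_centred; last exact: vsqint_usample.
  by apply: mx_usample => //; apply: contra ne => /eqP[-> ->].
- by move=> ib; exact: vsqint_usample.
apply: (@le_trans _ _ ((Sz%:R * Bz%:R)^-1 ^+ 2 *
   \sum_(ib : 'I_n * 'I_Bz) (Sz%:R / n%:R * C1))).
  by rewrite ler_wpM2l ?sqr_ge0//; apply: ler_sum => ib _; exact: usample_second.
rewrite sumr_const card_prod !card_ord -[_ *+ (n * Bz)%N]mulr_natl natrM.
have -> : (Sz%:R * Bz%:R)^-1 ^+ 2 * (n%:R * Bz%:R * (Sz%:R / n%:R * C1)) =
    C1 / Sz%:R * Bz%:R^-1 :> R by field; rewrite BR0 SR0 nR0.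
(* The factor [Bz%:R^-1] is bounded by 1; the selection error [e2] is estimated without a gain in
   the batch size either. *)
rewrite -[leRHS]mulr1 ler_wpM2l ?divr_ge0//.
by rewrite invf_le1 ?ltr0n// ler1n.
Qed.

Let mean_e1_centred (t : 'I_T) (p : Omega -> 'rV[R]_d) :
  (forall i b0, mx_measurable (Om := OT (kG t i b0)) p) -> vsqint P p ->
  mean P (fun w => dotv (p w) (e1 t w)) = 0.
Proof.
move=> mp ip.
rewrite (_ : (fun w => _) = fun w => (Sz%:R * Bz%:R)^-1 *
   \sum_(ib : 'I_n * 'I_Bz) dotv (p w) (usample t ib.1 ib.2 w)); last first.
  by apply/funext => w; rewrite dotvZr dotv_sumr.
have i1 (ib : 'I_n * 'I_Bz) : rintegrable P (fun w => dotv (p w) (usample t ib.1 ib.2 w)).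
  by apply: vsqint_dotv => //; exact: vsqint_usample.
rewrite meanZ; last exact: rintegrable_sum.
by rewrite mean_sum// big1 ?mulr0// => ib _; exact: usample_centred.
Qed.

(* The blocks [yb_i g_i'(x)^T] need not be integrable when [X] has empty
   interior, so block sampling is handled through the centred blocks. *)
Let cblock t w i : 'rV[R]_d := yb t w i *m (g' i (x t w))^T
  - n%:R^-1 *: \sum_(j < n) yb t w j *m (g' j (x t w))^T.

Let cblock_sum t w : \sum_(i < n) cblock t w i = 0.
Proof.
rewrite sumrB sumr_const card_ord -scaler_nat scalerA divff// scale1r subrr//.
Qed.

Let cblock_sqr t w : (t < T)%N ->
  \sum_(i < n) dotv (cblock t w i) (cblock t w i) <= n%:R * delta ^+ 2.
Proof.
move=> tT; case: hor => _ _ _ /(_ (x t w) (Xx w (ltnW tT)))[_ _].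
move=> /(_ (yb t w) (fun i => run_Yb run w i tT)).
rewrite mulrC ler_pdivrMr ?ltr0n// mulrC; under eq_bigr do rewrite norm2_sqr.
by [].
Qed.

Let others_cblock (t : 'I_T) i : mx_measurable (Om := OT (inl t)) (fun w => cblock t w i).
Proof.
have Xt w : X pb (x t w) by apply: Xx; exact: ltnW.
have [mx _] := @others_iterates (inl t) t (leqnn _).
have ma j : mx_measurable (Om := OT (inl t)) (fun w => yb t w j *m (g' j (x t w))^T).
  apply: mx_measurableM; first exact: others_yb.
  by apply: mx_measurable_tr; exact: (mx_measurable_ginner' cX hor (Om := OT (inl t))).
by apply: mx_measurableB => //; apply: mx_measurableZc; exact: mx_measurable_sum.
Qed.

Let vsqint_cblock (t : 'I_T) i : vsqint P (fun w => cblock t w i).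
Proof.
apply: (@vsqint_bounded _ _ _ _ _ _ (Num.sqrt (n%:R * delta ^+ 2))).
  exact: (others_mx_measurable msel mbat (k := inl t) (@others_cblock t i)).
move=> w; apply: ler_wsqrtr; apply: le_trans (cblock_sqr w (ltn_ord t)).
rewrite (bigD1 i)//= lerDl; apply: sumr_ge0 => j _; exact: dotvv_ge0.
Qed.

Let e2 t w : 'rV[R]_d := Sz%:R^-1 *: \sum_(i < n) ind t w i *: cblock t w i.

Let vsqint_icblock (t : 'I_T) i : vsqint P (fun w => ind t w i *: cblock t w i).
Proof.
apply: (@vsqint_bscale _ _ _ _ _ _ _ 1); [exact: mind|by move=> w; exact: ind_bound|].
exact: vsqint_cblock.
Qed.

Let vsqint_e2 (t : 'I_T) : vsqint P (e2 t).
Proof. by apply: vsqintZ; apply: vsqint_sum => i; exact: vsqint_icblock. Qed.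

Let mean_e2_centred (t : 'I_T) (p : Omega -> 'rV[R]_d) :
  mx_measurable (Om := OT (inl t)) p -> vsqint P p ->
  mean P (fun w => dotv (p w) (e2 t w)) = 0.
Proof.
move=> mp ip.
have ipc i : rintegrable P (fun w => dotv (p w) (cblock t w i)).
  by apply: vsqint_dotv => //; exact: vsqint_cblock.
have mpc i : measurable_fun [set: OT (inl t)] (fun w => dotv (p w) (cblock t w i)).
  by apply: measurable_dotv => //; exact: others_cblock.
rewrite (_ : (fun w => _) = fun w => Sz%:R^-1 *
   \sum_(i < n) ind t w i * dotv (p w) (cblock t w i)); last first.
  by apply/funext => w; rewrite dotvZr dotv_sumr; under eq_bigr do rewrite dotvZr.
have ii i := (mean_ind_mul i (mpc i) (ipc i)).1.
rewrite meanZ; last exact: rintegrable_sum.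
rewrite mean_sum//.
under eq_bigr => i _ do rewrite (mean_ind_mul i (mpc i) (ipc i)).2.
rewrite -mulr_sumr -mean_sum//.
rewrite (_ : (fun w => _) = fun=> 0) ?mean_cst ?mulr0//.
by apply/funext => w; rewrite -dotv_sumr cblock_sum dotv0.
Qed.

(** All pairs of distinct blocks carry the same weight [c]. As the centred blocks sum to zero, the
    cross terms equal [- c] times the diagonal; since [c] is nonnegative they only lower the
    diagonal weight S/n. *)
Let mean_e2_sqr (t : 'I_T) : mean P (fun w => dotv (e2 t w) (e2 t w)) <= delta ^+ 2 / Sz%:R.
Proof.
have tT := ltn_ord t.
have [c c0 hc] := mean_mem2 (P := P) (fun U => @msel t U tT)
  (fun w => @csel t w tT) (fun U => @usel t U tT).
pose cc i j w := dotv (cblock t w i) (cblock t w j).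
have icc i j : rintegrable P (cc i j) by apply: vsqint_dotv; exact: vsqint_cblock.
have mcc i j : measurable_fun [set: OT (inl t)] (cc i j).
  by apply: measurable_dotv; exact: others_cblock.
have iic i j : rintegrable P
    (fun w => dotv (ind t w i *: cblock t w i) (ind t w j *: cblock t w j)).
  by apply: vsqint_dotv; exact: vsqint_icblock.
have mii i : mean P (fun w => dotv (ind t w i *: cblock t w i) (ind t w i *: cblock t w i))
    = Sz%:R / n%:R * mean P (cc i i).
  rewrite -(mean_ind_mul i (mcc i i) (icc i i)).2; congr mean.
  by apply/funext => w; rewrite dotvZl dotvZr mulrA ind_sqr.
have mij i j : i != j ->
    mean P (fun w => dotv (ind t w i *: cblock t w i) (ind t w j *: cblock t w j))
    = c * mean P (cc i j).
  move=> ij; rewrite -(hc i j ij).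
  rewrite -(sel_indep msel mbat hind (fun U => (i \in U) && (j \in U)) (mcc i j) (icc i j)).
  congr mean; apply/funext => w; rewrite dotvZl dotvZr mulrA; congr (_ * _).
  by rewrite /ind; do 2!case: (_ \in _); rewrite ?mulr1 ?mulr0.
have sc i : \sum_(j < n) mean P (cc i j) = 0.
  rewrite -mean_sum// (_ : (fun w => _) = fun=> 0) ?mean_cst//.
  by apply/funext => w; rewrite -dotv_sumr cblock_sum dotv0.
rewrite (_ : (fun w => _) = fun w => Sz%:R^-1 ^+ 2 *
  \sum_(i < n) \sum_(j < n) dotv (ind t w i *: cblock t w i) (ind t w j *: cblock t w j));
    last first.
  apply/funext => w; rewrite dotvZl dotvZr mulrA expr2 dotv_suml.
  by congr (_ * _); apply: eq_bigr => i _; rewrite dotv_sumr.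
rewrite meanZ; last by apply: rintegrable_sum => i; exact: rintegrable_sum.
rewrite mean_sum; last by move=> i; exact: rintegrable_sum.
have -> : \sum_(i < n) mean P (fun w => \sum_(j < n)
    dotv (ind t w i *: cblock t w i) (ind t w j *: cblock t w j)) =
    (Sz%:R / n%:R - c) * \sum_(i < n) mean P (cc i i).
  rewrite mulr_sumr; apply: eq_bigr => i _; rewrite mean_sum// (bigD1 i)//= mii.
  rewrite (eq_bigr (fun j => c * mean P (cc i j))); last by move=> j ji; rewrite mij// eq_sym.
  have := sc i; rewrite (bigD1 i)//= -mulr_sumr => /eqP; rewrite addr_eq0 => /eqP h.
  by rewrite mulrBl [X in _ = _ - _ * X]h; ring.
have sc0 : 0 <= \sum_(i < n) mean P (cc i i).
  by apply: sumr_ge0 => i _; apply: mean_ge0 => w; exact: dotvv_ge0.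
have sd : \sum_(i < n) mean P (cc i i) <= n%:R * delta ^+ 2.
  rewrite -mean_sum// -[leRHS](mean_cst P); apply: mean_le.
  - exact: rintegrable_sum.
  - exact: rintegrable_cst.
  - by move=> w; exact: cblock_sqr.
apply: (@le_trans _ _ (Sz%:R^-1 ^+ 2 * (Sz%:R / n%:R * (n%:R * delta ^+ 2)))).
  rewrite ler_wpM2l ?sqr_ge0//.
  apply: (@le_trans _ _ (Sz%:R / n%:R * \sum_(i < n) mean P (cc i i))).
    by rewrite ler_wpM2r// gerBl.
  by rewrite ler_wpM2l// divr_ge0.
by rewrite le_eqVlt; apply/orP; left; apply/eqP; field; rewrite SR0 nR0.
Qed.

Let sum_ind t w : (t < T)%N -> \sum_(i < n) ind t w i = Sz%:R.
Proof. by move=> tT; rewrite -natr_sum -big_mkcond/= sum1_card csel. Qed.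

Let eE t w : (t < T)%N -> e t w = e1 t w + e2 t w.
Proof.
move=> tT; rewrite /e /e1 /e2.
set abar := n%:R^-1 *: _.
have -> : \sum_(i < n) ind t w i *: cblock t w i =
    \sum_(i < n) ind t w i *: (yb t w i *m (g' i (x t w))^T) - Sz%:R *: abar.
  rewrite -(sum_ind w tT) scaler_suml -sumrB; apply: eq_bigr => i _.
  by rewrite /cblock scalerBr.
have -> : \sum_(ib : 'I_n * 'I_Bz) usample t ib.1 ib.2 w =
    Bz%:R *: (\sum_(i < n) ind t w i *:
      (yb t w i *m (minibatch' (x t w) (bat true t i w))^T))
    - Bz%:R *: (\sum_(i < n) ind t w i *: (yb t w i *m (g' i (x t w))^T)).
  rewrite -(pair_bigA _ (fun i b0 => usample t i b0 w))/= -scalerBr -sumrB scaler_sumr.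
  apply: eq_bigr => i _; rewrite /usample -scaler_sumr -scalerBr scalerA mulrC -scalerA.
  congr (_ *: _); rewrite /msample /mhat /= -mulmx_sumr -raddf_sum/= sumrB.
  rewrite sumr_const card_ord -mulmxBr -linearB/= scalemxAr -linearZ/= scalerBr.
  by rewrite /minibatch' scalerA divff// scale1r scaler_nat.
have SB : (Sz%:R * Bz%:R)^-1 * Bz%:R = Sz%:R^-1 :> R by field; rewrite SR0 BR0.
clearbody abar.
by rewrite /direction !scalerBr !scalerA SB mulVf// scale1r addrA subrK.
Qed.

Lemma vsqint_e (t : 'I_T) : vsqint P (e t).
Proof.
rewrite (_ : e t = fun w => e1 t w + e2 t w); last by apply/funext => w; exact: eE.
exact: vsqintD.
Qed.

Lemma mean_e_sqr (t : 'I_T) : mean P (fun w => dotv (e t w) (e t w)) <=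
  2 * (C1 + delta ^+ 2) / Sz%:R.
Proof.
rewrite (_ : (fun w => _) = fun w => dotv (e1 t w + e2 t w) (e1 t w + e2 t w)); last first.
  by apply/funext => w; rewrite eE.
apply: (le_trans (mean_dotvvD_le (vsqint_e1 t) (vsqint_e2 t))).
have := mean_e1_sqr t; have := mean_e2_sqr t; lra.
Qed.

Section PrimalIterates.
Variables (xs : 'rV[R]_d) (gam : R).
Hypotheses (M0 : 0 <= M) (gam0 : 0 <= gam).
Hypotheses (Kxs : rdom pb xs) (minxs : forall v, rdom pb v -> robj pb xs <= robj pb v).
Hypotheses (flip : forall i u u',
  `|fouter pb i u - fouter pb i u'| <= M * norm2 (u - u')).
Hypotheses (glip : forall i u v, X pb u -> X pb v ->
  norm2 (ginner pb i u - ginner pb i v) <= gam * norm2 (u - v)).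
Hypotheses (g'lip : forall i u v, X pb u -> X pb v ->
  norm2 ((v - u) *m ginner' pb i u) <= gam * norm2 (v - u)).

(** Minimality of [xs] for the whole objective bounds the increase of the regulariser from [x t.+1]
    to [xs] by the Lipschitz variation of the composite part. The mean direction [Gb] is tested only
    along differences of points of [X], where [g'lip] applies. *)
Let growth t w : (t < T)%N -> norm2 (xs - x t.+1 w) ^+ 2 <=
  8 * norm2 (xs - x t w) ^+ 2 + 128 * (M * gam) ^+ 2 / eta ^+ 2
  + 32 / eta ^+ 2 * norm2 (e t w) ^+ 2.
Proof.
move=> tT; have Xt := Xx w (ltnW tT); have Xt1 := Xx w tT; have [Xxs _] := Kxs.
have MG : 0 <= M * gam by rewrite mulr_ge0.
apply: (@prox_step_growth _ eta (M * gam) (norm2 (e t w)) _ _ (norm2 (x t.+1 w - x t w)));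
  rewrite ?norm2_ge0//.
  have -> : xs - x t.+1 w = (xs - x t w) - (x t.+1 w - x t w).
    by apply/rowP => j; rewrite !mxE; ring.
  exact: norm2B_le.
have h1 := run_x run w tT Kxs.
pose Gb := n%:R^-1 *: \sum_(i < n) yb t w i *m (g' i (x t w))^T.
have GE : direction Sz sel bat x yb t w = e t w + Gb by rewrite subrK.
have Gb_le v : X pb v -> `|dotv Gb (v - x t w)| <= M * gam * norm2 (v - x t w).
  move=> Xv; rewrite dotvZl dotv_suml normrM ger0_norm ?invr_ge0//.
  rewrite mulrC ler_pdivrMr ?ltr0n//.
  apply: (le_trans (ler_norm_sum _ _ _)).
  apply: (@le_trans _ _ (\sum_(i < n) M * gam * norm2 (v - x t w))).
    apply: ler_sum => i _; rewrite dotv_mulmx.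
    apply: (le_trans (norm_dotv_le _ _)); rewrite -mulrA; apply: ler_pM.
    - exact: norm2_ge0.
    - exact: norm2_ge0.
    - by apply: (Ybd (i := i)); exact: (run_Yb run).
    - exact: g'lip.
  by rewrite sumr_const card_ord -[leLHS]mulr_natr.
have /ler_normlP[_ b1] := Gb_le xs Xxs.
have /ler_normlP[b2 _] := Gb_le (x t.+1 w) Xt1.
have b3 := cauchy_schwarz (e t w) (xs - x t.+1 w).
have h2 : rreg pb xs - rreg pb (x t.+1 w) <= M * gam * norm2 (xs - x t.+1 w).
  have := minxs (run_K run w tT); rewrite /robj.
  have : n%:R^-1 * (\sum_(i < n) fouter pb i (ginner pb i (x t.+1 w)))
     - n%:R^-1 * (\sum_(i < n) fouter pb i (ginner pb i xs))
     <= M * gam * norm2 (xs - x t.+1 w).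
    rewrite -mulrBr -sumrB mulrC ler_pdivrMr ?ltr0n//.
    apply: (@le_trans _ _ (\sum_(i < n) M * gam * norm2 (xs - x t.+1 w))).
      apply: ler_sum => i _; apply: (le_trans (ler_norm _)).
      apply: (le_trans (flip _ _ _)); rewrite -mulrA ler_wpM2l//.
      by rewrite norm2_distC; exact: glip.
    by rewrite sumr_const card_ord -[leLHS]mulr_natr.
  lra.
have EG : dotv (direction Sz sel bat x yb t w) xs
    - dotv (direction Sz sel bat x yb t w) (x t.+1 w)
    = dotv (e t w) (xs - x t.+1 w) + dotv Gb (xs - x t w) - dotv Gb (x t.+1 w - x t w).
  rewrite GE !dotvDl !dotvBr; ring.
rewrite !norm2_sqr.
have := dotvv_ge0 (xs - x t.+1 w); lra.
Qed.

Lemma vsqint_x t : (t <= T)%N -> vsqint P (fun w => xs - x t w).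
Proof.
elim: t => [_|t IH tT].
  rewrite (_ : (fun w => _) = fun=> xs - x0); first exact: vsqint_cst.
  by apply/funext => w; rewrite (run_x0 run).
have {}IH := IH (ltnW tT); have [mx _] := iterates tT.
have ie := vsqint_e (Ordinal tT).
have mD : mx_measurable (fun w => xs - x t.+1 w).
  by apply: mx_measurableB => //; exact: mx_measurable_cst.
apply: vsqintP => //.
apply: (@rintegrable_le _ _ _ _ _ (fun w => 8 * dotv (xs - x t w) (xs - x t w)
  + 128 * (M * gam) ^+ 2 / eta ^+ 2 + 32 / eta ^+ 2 * dotv (e t w) (e t w))).
- exact: measurable_dotv.
- by move=> w; rewrite ger0_norm ?dotvv_ge0// -!norm2_sqr; exact: growth.
- apply: rintegrableD; last by apply: rintegrableZ; exact: vsqint_dotv.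
  apply: rintegrableD; last exact: rintegrable_cst.
  by apply: rintegrableZ; exact: vsqint_dotv.
Qed.

Lemma mean_e_x (t : 'I_T) : mean P (fun w => dotv (e t w) (xs - x t w)) = 0.
Proof.
have mx k : t = sample_time k -> mx_measurable (Om := OT k) (fun w => xs - x t w).
  move=> tk; apply: mx_measurableB; first exact: mx_measurable_cst.
  by have [] := @others_iterates k t; rewrite tk.
have ix := vsqint_x (ltnW (ltn_ord t)).
rewrite (_ : (fun w => _) = fun w =>
   dotv (xs - x t w) (e1 t w) + dotv (xs - x t w) (e2 t w)); last first.
  by apply/funext => w; rewrite dotvC eE// dotvDr.
rewrite meanD; [|exact: vsqint_dotv|exact: vsqint_dotv].
rewrite mean_e1_centred//; last by move=> i b0; exact: mx.
by rewrite mean_e2_centred ?addr0//; exact: mx.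
Qed.

End PrimalIterates.

End Moments.

(** * Expected gap *)

Section MeanBounds.
Context {R : realType} {d : measure_display} {Om : measurableType d}.
Variable P : probability Om R.

Definition mean_bound (f : Om -> R) (c : R) := rintegrable P f /\ mean P f <= c.

Lemma mean_boundD f g c c' : mean_bound f c -> mean_bound g c' ->
  mean_bound (fun w => f w + g w) (c + c').
Proof. by move=> [i1 h1] [i2 h2]; split; [exact: rintegrableD|rewrite meanD// lerD]. Qed.

Lemma mean_boundZ k f c : 0 <= k -> mean_bound f c -> mean_bound (fun w => k * f w) (k * c).
Proof.
by move=> k0 [i1 h1]; split; [exact: rintegrableZ|rewrite meanZ// ler_wpM2l].
Qed.

Lemma mean_bound_le f c c' : mean_bound f c -> c <= c' -> mean_bound f c'.
Proof. by move=> [i1 h1] cc'; split=> //; exact: le_trans cc'. Qed.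

Lemma mean_bound_cst c : mean_bound (fun=> c) c.
Proof. by split; [exact: rintegrable_cst|rewrite mean_cst]. Qed.

Lemma mean_bound_sum (I : Type) (s : seq I) (f : I -> Om -> R) (c : I -> R) :
  (forall i, mean_bound (f i) (c i)) ->
  mean_bound (fun w => \sum_(i <- s) f i w) (\sum_(i <- s) c i).
Proof.
move=> h; split; first by apply: rintegrable_sum => i; case: (h i).
rewrite mean_sum => [|i]; last by case: (h i).
by apply: ler_sum => i _; case: (h i).
Qed.

Lemma mean_bound_scale_eq k f c : rintegrable P f -> mean P f = c ->
  mean_bound (fun w => k * f w) (k * c).
Proof. by move=> i1 <-; split; [exact: rintegrableZ|rewrite meanZ]. Qed.

End MeanBounds.

Section Assembly.
Context {R : realType} {d m n : nat} (pb : fcco R d m n).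
Context {dO : measure_display} {Omega : measurableType dO} (P : probability Omega R).
Variables (a b mu Cf Cg Lg s0 s1 delta eta tau D : R) (N : 'rV[R]_m -> R).
Variables (Sz Bz T : nat) (x0 xs : 'rV[R]_d) (y0 : 'I_n -> 'rV[R]_m).
Variables (sel : nat -> Omega -> {set 'I_n}).
Variables (bat : bool -> nat -> forall i, Omega -> 'I_Bz -> Z pb i).
Variables (x : nat -> Omega -> 'rV[R]_d) (y : nat -> Omega -> 'I_n -> 'rV[R]_m).
Variable yt : Omega -> 'I_n -> 'rV[R]_m.
Let M := dual_radius a Cf.
Let gam := inner_lip a b Cg.
Let lam := inner_smooth a b Lg.
Let rho : R := n%:R / Sz%:R.
Hypotheses (Sz0 : (0 < Sz)%N) (Szn : (Sz <= n)%N) (Bz0 : (0 < Bz)%N) (T0 : (0 < T)%N).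
Hypotheses (eta0 : 0 < eta) (tau0 : 0 < tau).
Hypotheses (a0 : 0 < a) (Nn : is_norm N) (Nab : norm_equiv a b N).
Hypotheses (hdom : assumption_domain pb mu) (hin : assumption_inner pb N Cg).
Hypotheses (hout : assumption_outer pb N Cf) (hor : assumption_oracle pb N s0 s1 delta).
Hypotheses (hsm : smooth_inner pb N Lg).
Hypotheses (hmin : argmin_on (X pb) (objective pb) xs).
Hypotheses (Xx0 : X pb x0) (hD : norm2 (x0 - xs) <= D) (Yy0 : forall i, Ydom pb i (y0 i)).
Hypothesis absorb : 8 * gam ^+ 2 / tau + M * lam / 2 + eta / 16 <= eta / 4.
Hypothesis arun : alexr_run P (fun=> @half_sqnorm R m) eta tau 1 Sz T x0 y0 sel bat x y.
Hypothesis hyt : dual_best_response pb x T yt.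

Let yb := full_dual_update tau sel bat x y.
Let run : prox_run eta tau Sz T x0 y0 sel bat x y yb.
Proof. exact: (prox_run_of_alexr hdom hout Xx0 Yy0 arun). Qed.

Let n0 : (0 < n)%N. Proof. exact: leq_trans Szn. Qed.
Let nR0 : n%:R != 0 :> R. Proof. by rewrite pnatr_eq0 -lt0n. Qed.
Let SR0 : Sz%:R != 0 :> R. Proof. by rewrite pnatr_eq0 -lt0n. Qed.
Let rho0 : 0 < rho. Proof. by rewrite divr_gt0// ltr0n. Qed.
Let cX : closed (X pb). Proof. by case: hdom. Qed.
Let cr : rconvex_on (rdom pb) (rreg pb). Proof. exact: rconvex_rreg hdom. Qed.
Let hsub : oracle_subgradient pb. Proof. by case: hor. Qed.
Let M0 : 0 <= M. Proof. exact: dual_radius_ge0. Qed.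
Let gam0 : 0 <= gam. Proof. exact: inner_lip_ge0. Qed.
Let Ybd i v : Ydom pb i v -> norm2 v <= M.
Proof. exact: (Ydom_bound a0 Nn Nab hout). Qed.
Let flip i u u' : `|fouter pb i u - fouter pb i u'| <= M * norm2 (u - u').
Proof. exact: (fouter_lip a0 Nn Nab hout). Qed.
Let glip i u v : X pb u -> X pb v ->
  norm2 (ginner pb i u - ginner pb i v) <= gam * norm2 (u - v).
Proof. exact: (ginner_lip a0 Nn Nab hin). Qed.
Let g'lip i u v : X pb u -> X pb v ->
  norm2 ((v - u) *m ginner' pb i u) <= gam * norm2 (v - u).
Proof. exact: (ginner'_lip a0 Nn Nab hdom hin hsm). Qed.
Let Kxs : rdom pb xs. Proof. exact: (argmin_objective_rdom hdom hmin). Qed.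
Let minxs v : rdom pb v -> robj pb xs <= robj pb v.
Proof.
move=> Kv; rewrite -lee_fin -(objectiveE hdom Kxs) -(objectiveE hdom Kv).
by apply: (proj2 hmin); case: Kv.
Qed.

Let q t w i := yb t w i - y t w i.
Let ind t w i : R := (i \in sel t w)%:R.
Let xi t w i := (1 - rho * ind t w i) *: q t w i.
Let nu t w i := extrapolation bat x t w i
  - (ginner pb i (x t w) *+ 2 - ginner pb i (x t.-1 w)).
Let e t w := direction Sz sel bat x yb t w
  - n%:R^-1 *: \sum_(i < n) yb t w i *m (ginner' pb i (x t w))^T.

Let W i w := (5 / 2 * tau * rho + tau / 2) * dotv (yt w i - y0 i) (yt w i - y0 i)
     + tau / (8 * rho) * dotv (\sum_(t < T) xi t w i) (\sum_(t < T) xi t w i)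
     + (2 * tau)^-1 * dotv (\sum_(t < T) nu t w i) (\sum_(t < T) nu t w i)
     + (- tau) * \sum_(t < T) dotv (y t w i - y0 i) (xi t w i)
     + \sum_(t < T) dotv (y t w i - y0 i) (nu t w i)
     + \sum_(t < T) (- (tau / 4) * dotv (q t w i) (q t w i)
         + - (tau / 2) * ((1 - rho * ind t w i) * dotv (q t w i) (q t w i))
         + 2 / tau * dotv (nu t w i) (nu t w i)).

Let Wall w := n%:R^-1 * (\sum_(i < n) W i w)
  + \sum_(t < T) (dotv (e t w) (xs - x t w) + eta^-1 * dotv (e t w) (e t w))
  + (eta / 2 * dotv (xs - x0) (xs - x0) + 16 * M ^+ 2 * gam ^+ 2 / eta).

Let Yyt w i : Ydom pb i (yt w i).
Proof. by have [_ /(_ w i)[]] := hyt. Qed.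

Let best_response w i : fouter pb i (ginner pb i (xbar x T w)) <=
  dotv (yt w i) (ginner pb i (xbar x T w)) - rconj (fouter pb i) (yt w i).
Proof.
have [_ /(_ w i)[_ h]] := hyt.
have cf u v t : 0 <= t <= 1 -> _ := @fouter_convex _ _ _ _ _ _ _ hout i u v t.
(* The maximiser [yt] does at least as well as this subgradient. *)
have [v Yv le] := fenchel_equality cf (ginner pb i (xbar x T w)).
have := h v Yv; rewrite /= (conjugateE Yv) (conjugateE (Yyt w i)) -!EFinB lee_fin.
rewrite -/(rconj _ _) -/(rconj _ _); lra.
Qed.

Let lin_ge i v u w : Ydom pb i v -> X pb u -> X pb w ->
  dotv v (ginner pb i u) + dotv v ((w - u) *m ginner' pb i u) <= dotv v (ginner pb i w).
Proof.
by move=> Yv Xu Xw; exact: (ginner_lin_ge a0 Nn Nab hdom hout hsm Yv Xu Xw hsub).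
Qed.

Let lin_le i v u w : norm2 v <= M -> X pb u -> X pb w ->
  dotv v (ginner pb i w) <= dotv v (ginner pb i u)
    + dotv v ((w - u) *m ginner' pb i u) + M * lam / 2 * norm2 (w - u) ^+ 2.
Proof. by move=> vM Xu Xw; exact: (ginner_lin_le a0 Nn Nab hsm i vM Xu Xw). Qed.

Let xbar_dom w : rdom pb (xbar x T w).
Proof.
apply: (@xbar_rdom _ _ _ _ pb T (fun t => x t w) (yt w) T0) => //.
by move=> t tT; exact: (run_K run).
Qed.

Let gap_le w : T%:R * (robj pb (xbar x T w) - robj pb xs) <= Wall w.
Proof.
have h := @pathwise_gap _ _ _ _ pb M gam lam eta tau Sz T xs (fun t => x t w)
  (fun t => direction Sz sel bat x yb t w) (fun t i => y t w i) (fun t i => yb t w i)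
  (fun t i => extrapolation bat x t w i) (fun t => sel t w) (yt w) Sz0 n0 T0.
rewrite /= (run_y0 run) (run_x0 run) in h.
have ystep t i : (t < T)%N -> y t.+1 w i = if i \in sel t w then yb t w i else y t w i.
  exact: (run_y run).
have dual t i v : (t < T)%N -> Ydom pb i v ->
    rconj (fouter pb i) (yb t w i) + dotv (- extrapolation bat x t w i) (yb t w i)
    + tau / 2 * dotv (yb t w i - y t w i) (yb t w i - y t w i)
    + tau / 2 * dotv (v - yb t w i) (v - yb t w i) <=
    rconj (fouter pb i) v + dotv (- extrapolation bat x t w i) v
    + tau / 2 * dotv (v - y t w i) (v - y t w i).
  move=> tT; apply: (prox_three_point
    (rconvex_add_dotv (- extrapolation bat x t w i) (rconvex_rconj (f := fouter pb i)))).
    exact: (run_Yb run).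
  by move=> u Yu; exact: (run_yb run).
have primal t : (t < T)%N ->
    rreg pb (x t.+1 w) + dotv (direction Sz sel bat x yb t w) (x t.+1 w)
    + eta / 2 * dotv (x t.+1 w - x t w) (x t.+1 w - x t w)
    + eta / 2 * dotv (xs - x t.+1 w) (xs - x t.+1 w) <=
    rreg pb xs + dotv (direction Sz sel bat x yb t w) xs
    + eta / 2 * dotv (xs - x t w) (xs - x t w).
  move=> tT; apply: (prox_three_point
    (rconvex_add_dotv (direction Sz sel bat x yb t w) cr)) Kxs.
    exact: (run_K run).
  by move=> u Ku; exact: (run_x run).
have {}h := h gam0 eta0 tau0 glip lin_ge lin_le Ybd cr Kxs
  (fun t => run_X run (t := t) w) (fun t => run_K run (t := t) w) (Yyt w)
  (fun t i => run_Y run (t := t) w i) (fun t i => run_Yb run (t := t) w i)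
  ystep dual primal absorb (best_response w).
apply: (le_trans h); rewrite /Wall addrA !lerD2r ler_wpM2l ?invr_ge0// ler_sum// => i _.
rewrite /W mulNr; apply: lerD => //; apply: ler_sum => t _.
by rewrite /q /ind /nu !mulNr.
Qed.

Let msel t U : (t < T)%N -> measurable (sel t @^-1` U).
Proof. by move=> tT; exact: (sel_measurable arun). Qed.
Let csel t w : (t < T)%N -> #|sel t w| = Sz.
Proof. exact: (sel_card arun). Qed.
Let usel t (U : {set 'I_n}) : (t < T)%N -> #|U| = Sz ->
  P [set w | sel t w = U] = (('C(n, Sz))%:R^-1)%:E.
Proof. exact: (sel_uniform arun). Qed.
Let mbat c t i k : (t < T)%N -> measurable_fun setT (fun w => bat c t i w k).
Proof. exact: (bat_measurable arun). Qed.
Let lbat c t i k (A : set (Z pb i)) : (t < T)%N -> measurable A ->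
  P [set w | A (bat c t i w k)] = zlaw pb i A.
Proof. exact: (bat_law arun). Qed.
Let hind := samples_independent arun.

Let V := 10 * var_g a b s0 / Bz%:R.
Let sqyt i w := dotv (yt w i - y0 i) (yt w i - y0 i).
Let Q i := \sum_(t < T) mean P (fun w => dotv (q t w i) (q t w i)).

Lemma rintegrable_best_response i : rintegrable P (fun w => dotv (yt w i - y0 i) (yt w i - y0 i)).
Proof.
apply: vsqint_dotv; apply: vsqintB; try exact: vsqint_cst.
all: apply: (@vsqint_bounded _ _ _ _ _ _ M) => [l j|w]; last exact: Ybd (Yyt w i).
all: by rewrite (ord1 l); case: hyt.
Qed.

Let W_mean i : mean_bound P (W i)
  ((5 / 2 * tau * rho + tau / 2) * mean P (sqyt i) + T%:R * (5 / 2 * (V / tau))).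
Proof.
have iq (t : 'I_T) : vsqint P (fun w => q t w i).
  exact: (vsqint_q P eta0 tau0 cX hor cr Ybd run msel mbat).
have ixi (t : 'I_T) : vsqint P (fun w => xi t w i).
  exact: (vsqint_xi P eta0 tau0 cX hor cr Ybd run msel mbat).
have inu (t : 'I_T) : vsqint P (fun w => nu t w i).
  exact: (vsqint_nu Bz0 eta0 tau0 a0 Nn Nab cX hor cr run msel mbat lbat hind).
have iy (t : 'I_T) : vsqint P (fun w => y t w i - y0 i).
  exact: (vsqint_y P eta0 tau0 cX hor cr Ybd run msel mbat i (ltnW (ltn_ord t))).
have h : mean_bound P (W i)
  ((5 / 2 * tau * rho + tau / 2) * mean P (sqyt i) + tau / (8 * rho) * (rho * Q i)
   + (2 * tau)^-1 * (T%:R * V) + (- tau) * (\sum_(t < T) 0) + \sum_(t < T) 0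
   + \sum_(t < T) (- (tau / 4) * mean P (fun w => dotv (q t w i) (q t w i))
       + - (tau / 2) * 0 + 2 / tau * V)).
  rewrite /W; apply: mean_boundD;
    [apply: mean_boundD; [apply: mean_boundD; [apply: mean_boundD; [apply: mean_boundD|]|]|]|].
  - by apply: mean_bound_scale_eq => //; exact: rintegrable_best_response.
  - apply: mean_boundZ; first by rewrite divr_ge0 ?mulr_ge0// ltW.
    split; first by apply: vsqint_dotv; exact: vsqint_sum.
    exact: (mean_xi_sum_sqr Sz0 Szn eta0 tau0 cX hor cr Ybd run msel csel usel mbat hind).
  - apply: mean_boundZ; first by rewrite invr_ge0 mulr_ge0// ltW.
    split; first by apply: vsqint_dotv; exact: vsqint_sum.
    exact: (mean_nu_sum_sqr Bz0 eta0 tau0 a0 Nn Nab cX hor cr run msel mbat lbat hind).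
  - apply: mean_bound_scale_eq; first by apply: rintegrable_sum => t; exact: vsqint_dotv.
    rewrite mean_sum => [|t]; last exact: vsqint_dotv.
    apply: eq_bigr => t _.
    exact: (mean_y_xi Sz0 Szn eta0 tau0 cX hor cr Ybd run msel csel usel mbat hind).
  - apply: mean_bound_sum => t; split; first exact: vsqint_dotv.
    by rewrite (mean_y_nu Bz0 eta0 tau0 a0 Nn Nab cX hor cr Ybd run msel mbat lbat hind).
  - apply: mean_bound_sum => t; apply: mean_boundD; [apply: mean_boundD|].
    + by apply: mean_bound_scale_eq => //; exact: vsqint_dotv.
    + have [i1 m1] := mean_unsampled_qq Sz0 Szn eta0 tau0 cX hor cr Ybd run msel csel usel
        mbat hind t i.
      exact: mean_bound_scale_eq.
    + apply: mean_boundZ; first by rewrite divr_ge0// ltW.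
      split; first exact: vsqint_dotv.
      exact: (mean_nu_sqr Bz0 eta0 tau0 a0 Nn Nab cX hor cr run msel mbat lbat hind).
have Q0 : 0 <= Q i by apply: sumr_ge0 => t _; apply: mean_ge0 => w; exact: dotvv_ge0.
apply: (mean_bound_le h); rewrite !big1_eq !big_split/= -mulr_sumr -/(Q i).
rewrite big1 => [|t _]; last exact: mulr0.
rewrite sumr_const card_ord -[2 / tau * V *+ T]mulr_natl.
(* The block-sampling noise is dominated by the movement term [- (tau / 4) * Q i]. The two
   occurrences of [V / tau], with weights 1/2 and 2, add up to 5/2. *)
have -> : tau / (8 * rho) * (rho * Q i) = tau / 8 * Q i by field; rewrite gt_eqF.
have -> : (2 * tau)^-1 * (T%:R * V) = T%:R * (V / tau) / 2 by field; rewrite gt_eqF.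
have := mulr_ge0 (ltW tau0) Q0; lra.
Qed.

Let C1 := var_g' a b M s1.
Let Om := mean P (fun w => \sum_(i < n) bregman (@half_sqnorm R m) (yt w i) (y0 i)).

Lemma rintegrable_bregman : rintegrable P
  (fun w => \sum_(i < n) bregman (@half_sqnorm R m) (yt w i) (y0 i)).
Proof.
apply: rintegrable_sum => i; under eq_fun do rewrite bregman_half_sqnorm.
exact: rintegrableZ (rintegrable_best_response i).
Qed.

Let OmE : \sum_(i < n) mean P (sqyt i) = 2 * Om.
Proof.
rewrite /Om mean_sum => [|i]; last first.
  under eq_fun do rewrite bregman_half_sqnorm.
  exact: rintegrableZ (rintegrable_best_response i).
rewrite mulr_sumr; apply: eq_bigr => i _.
under eq_fun do rewrite bregman_half_sqnorm.
by rewrite meanZ ?mulrA ?divff ?mul1r//; exact: rintegrable_best_response.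
Qed.

Let Wall_mean : mean_bound P Wall
  (6 * tau / Sz%:R * Om + T%:R * (25 * var_g a b s0 / (Bz%:R * tau))
   + T%:R * (2 * (C1 + delta ^+ 2) / (eta * Sz%:R))
   + (eta / 2 * D ^+ 2 + 16 * M ^+ 2 * gam ^+ 2 / eta)).
Proof.
have ie (t : 'I_T) : vsqint P (fun w => e t w).
  exact: (vsqint_e Sz0 Szn Bz0 eta0 tau0 a0 Nn Nab cX hor cr Ybd run msel csel mbat lbat hind).
have ix (t : 'I_T) : vsqint P (fun w => xs - x t w).
  exact: (vsqint_x Sz0 Szn Bz0 eta0 tau0 a0 Nn Nab cX hor cr Ybd run msel csel mbat
    lbat hind M0 gam0 Kxs minxs flip glip g'lip (ltnW (ltn_ord t))).
have h : mean_bound P Wall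
  (n%:R^-1 * (\sum_(i < n) ((5 / 2 * tau * rho + tau / 2) * mean P (sqyt i)
                            + T%:R * (5 / 2 * (V / tau))))
   + \sum_(t < T) (0 + eta^-1 * (2 * (C1 + delta ^+ 2) / Sz%:R))
   + (eta / 2 * D ^+ 2 + 16 * M ^+ 2 * gam ^+ 2 / eta)).
  apply: mean_boundD; [apply: mean_boundD|].
  - by apply: mean_boundZ; rewrite ?invr_ge0//; exact: mean_bound_sum W_mean.
  - apply: mean_bound_sum => t; apply: mean_boundD.
      split; first exact: vsqint_dotv.
      by rewrite (mean_e_x Sz0 Szn Bz0 eta0 tau0 a0 Nn Nab cX hor cr Ybd run msel csel usel mbat
        lbat hind M0 gam0 Kxs minxs flip glip g'lip).
    apply: mean_boundZ; first by rewrite invr_ge0 ltW.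
    split; first exact: vsqint_dotv.
    exact: (mean_e_sqr Sz0 Szn Bz0 eta0 tau0 a0 Nn Nab cX hor cr Ybd run msel csel usel mbat
      lbat hind).
  - apply: (mean_bound_le (mean_bound_cst _ _)); rewrite lerD2r ler_wpM2l ?divr_ge0 ?(ltW eta0)//.
    rewrite dotvv_distC -norm2_sqr lerXn2r ?nnegrE ?norm2_ge0//.
    by rewrite (le_trans _ hD)// norm2_ge0.
apply: (mean_bound_le h); rewrite lerD2r.
rewrite big_split/= -mulr_sumr OmE !sumr_const !card_ord -[(0 + _) *+ T]mulr_natl.
rewrite -[_ * _ *+ n]mulr_natl add0r.
have Om0 : 0 <= Om.
  apply: mean_ge0 => w; apply: sumr_ge0 => i _.
  by rewrite bregman_half_sqnorm mulr_ge0 ?invr_ge0// dotvv_ge0.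
apply: lerD; last first.
  by rewrite le_eqVlt; apply/orP; left; apply/eqP; field; rewrite SR0 gt_eqF.
have -> : n%:R^-1 * ((5 / 2 * tau * rho + tau / 2) * (2 * Om) + n%:R * (T%:R * (5 / 2 * (V / tau))))
  = 5 * tau / Sz%:R * Om + tau / n%:R * Om + T%:R * (25 * var_g a b s0 / (Bz%:R * tau)).
  by rewrite /rho /V; field; rewrite SR0 nR0 !gt_eqF// ltr0n.
rewrite lerD2r.
(* Passing from squared distances to Bregman divergences doubles the coefficients; the stray
   [tau / n] then turns the 5 into the 6 of the bound. *)
have : tau / n%:R * Om <= tau / Sz%:R * Om.
  by rewrite ler_wpM2r// (ler_wpM2l (ltW tau0))// lef_pV2 ?posrE ?ltr0n// ler_nat.
lra.
Qed.

Lemma expected_gap :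
  (\int[P]_w (objective pb (xbar x T w) - objective pb xs) <=
   (6 * tau / (Sz%:R * T%:R) * Om + 25 * var_g a b s0 / (Bz%:R * tau)
   + 2 * (C1 + delta ^+ 2) / (eta * Sz%:R)
   + eta * D ^+ 2 / (2 * T%:R) + 16 * M ^+ 2 * gam ^+ 2 / (eta * T%:R))%:E)%E.
Proof.
have TR : 0 < T%:R :> R by rewrite ltr0n.
have TV : 0 <= T%:R^-1 :> R by rewrite invr_ge0 ltW.
have [i1 m1] := mean_boundZ TV Wall_mean.
(* Minimality of [xs] makes the gap nonnegative, so the integrals compare without measurability of
   the objective along the run. *)
apply: (@le_trans _ _ (\int[P]_w (T%:R^-1 * Wall w)%:E)%E).
  apply: ge0_le_integralT => w;
    rewrite (objectiveE hdom Kxs) (objectiveE hdom (xbar_dom w)) -EFinB lee_fin.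
    by rewrite subr_ge0; exact: minxs.
  by rewrite -(ler_pM2l TR) mulrA divff ?mul1r ?gt_eqF//; exact: gap_le.
rewrite (meanE i1) lee_fin (le_trans m1)// le_eqVlt; apply/orP; left; apply/eqP.
by field; rewrite SR0 !gt_eqF// ltr0n.
Qed.

End Assembly.

(** * Choice of the step sizes *)

(** The primal step parameter grows like 1/(S eps) while the left-hand costs stay below
    [8 * G * B + L / 2]. The factor 6 limits these costs to 1/6 of that parameter, below the
    available 1/4 - 1/16. *)
Lemma step_size_absorb {R : realType} (c1 c2 G L S B eps : R) :
  1 <= c1 -> 1 <= c2 -> 1 <= S -> 1 <= B -> 0 <= G -> 0 <= L -> 0 < eps -> eps <= 1 ->
  6 * S * (8 * G * B + L) * eps <= 1 ->
  8 * G / (c2 / (B * eps)) + L / 2 + c1 / (S * eps) / 16 <= c1 / (S * eps) / 4.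
Proof.
move=> c11 c21 S1 B1 G0 L0 e0 e1 he.
have S0 : 0 < S by lra. have B0 : 0 < B by lra.
have c20 : 0 < c2 by lra.
have Se0 : 0 < S * eps by rewrite mulr_gt0.
have h1 : 8 * G / (c2 / (B * eps)) <= 8 * G * B.
  rewrite (_ : _ / _ = 8 * G * B * (eps / c2)); last by field; rewrite !gt_eqF.
  by rewrite ler_piMr ?mulr_ge0// ?(ltW B0)// ler_pdivrMr// mul1r (le_trans e1).
have h2 : (S * eps)^-1 <= c1 / (S * eps) by rewrite ler_peMl// invr_ge0 ltW.
suff : 6 * (8 * G * B + L) <= (S * eps)^-1.
  have : 0 <= 8 * G * B by rewrite !mulr_ge0// ltW.
  lra.
by rewrite -[leRHS]mul1r ler_pdivlMr//; move: he; lra.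
Qed.

(** Each of the five terms is at most [eps / 8]. The divergence and initial-distance terms use the
    lower bounds on [T], the two variance terms use [c1] and [c2]; the last one, of lower order,
    needs [eps] small against [K * S ^+ 2]. *)
Lemma step_size_gap {R : realType} (c1 c2 C v V K D Om S B T eps : R) :
  1 <= c1 -> 1 <= c2 -> 1 <= C -> 0 < S -> 0 < B -> 0 < T -> 0 < eps -> eps <= 1 ->
  200 * v <= c2 -> 16 * V <= c1 -> 4 * c1 * D ^+ 2 <= C -> 48 * c2 <= C ->
  0 <= Om -> 0 <= K -> 8 * K * S ^+ 2 * eps <= 1 ->
  C / (eps ^+ 2 * S) <= T -> C * Om / (eps ^+ 2 * (B * S)) <= T ->
  6 * (c2 / (B * eps)) / (S * T) * Om + 25 * v / (B * (c2 / (B * eps)))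
   + 2 * V / (c1 / (S * eps) * S) + c1 / (S * eps) * D ^+ 2 / (2 * T)
   + K / (c1 / (S * eps) * T) <= eps.
Proof.
move=> c11 c21 C1 S0 B0 T0 e0 e1 hv hV hD hc Om0 K0 hK.
have c10 : 0 < c1 by lra. have c20 : 0 < c2 by lra.
have e20 : 0 < eps ^+ 2 by rewrite exprn_gt0.
rewrite !ler_pdivrMr ?mulr_gt0// => hT hOm.
have -> : 6 * (c2 / (B * eps)) / (S * T) * Om = 6 * c2 * Om / (B * eps * (S * T)).
  by field; rewrite !gt_eqF.
have -> : 25 * v / (B * (c2 / (B * eps))) = 25 * v * eps / c2.
  by field; rewrite !gt_eqF.
have -> : 2 * V / (c1 / (S * eps) * S) = 2 * V * eps / c1 by field; rewrite !gt_eqF.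
have -> : c1 / (S * eps) * D ^+ 2 / (2 * T) = c1 * D ^+ 2 / (2 * (S * eps * T)).
  by field; rewrite !gt_eqF.
have -> : K / (c1 / (S * eps) * T) = K * (S * eps) / (c1 * T) by field; rewrite !gt_eqF.
have t1 : 6 * c2 * Om / (B * eps * (S * T)) <= eps / 8.
  rewrite ler_pdivrMr ?mulr_gt0//.
  have := ler_wpM2r Om0 hc; move: hOm; lra.
have t2 : 25 * v * eps / c2 <= eps / 8.
  rewrite ler_pdivrMr//; have := ler_wpM2r (ltW e0) hv; lra.
have t3 : 2 * V * eps / c1 <= eps / 8.
  rewrite ler_pdivrMr//; have := ler_wpM2r (ltW e0) hV; lra.
have t4 : c1 * D ^+ 2 / (2 * (S * eps * T)) <= eps / 8.
  rewrite ler_pdivrMr ?mulr_gt0//; move: hT hD; lra.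
have t5 : K * (S * eps) / (c1 * T) <= eps / 8.
  rewrite ler_pdivrMr ?mulr_gt0//.
  have h1 : 1 <= T * (eps ^+ 2 * S) by lra.
  have h2 : T <= c1 * T by rewrite ler_peMl// ltW.
  have h3 : K * S * 8 <= T.
    rewrite -(ler_pM2r (mulr_gt0 e20 S0)); apply: le_trans h1.
    have : 8 * K * S ^+ 2 * eps * eps <= eps by rewrite -[leRHS]mul1r ler_wpM2r// ltW.
    lra.
  have := ler_wpM2r (ltW e0) (le_trans h3 h2); lra.
lra.
Qed.

Theorem theorem3 (R : realType) (Cf Cg Lg s0 s1 delta a b D : R)
    (Lg_gt0 : 0 < Lg) (a_gt0 : 0 < a) :
  exists C ceta ctau : R, [/\ 0 < C, 0 < ceta & 0 < ctau] /\
  forall (d m n Sz Bz : nat) (pb : fcco R d m n) (N : 'rV[R]_m -> R) (mu : R)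
    (x0 xstar : 'rV[R]_d) (y0 : 'I_n -> 'rV[R]_m),
  (0 < Sz <= n)%N -> (0 < Bz)%N ->
  is_norm N -> norm_equiv a b N ->
  assumption_domain pb mu ->
  assumption_inner pb N Cg ->
  assumption_outer pb N Cf ->
  assumption_oracle pb N s0 s1 delta ->
  smooth_inner pb N Lg ->
  argmin_on (X pb) (objective pb) xstar ->
  X pb x0 -> norm2 (x0 - xstar) <= D -> (forall i, Ydom pb i (y0 i)) ->
  exists2 eps0 : R, 0 < eps0 & forall eps : R, 0 < eps <= eps0 ->
  exists eta tau : R,
    [/\ 0 < eta <= ceta / eps, 0 < tau <= ctau / (Bz%:R * eps) &
    forall (T : nat) (dO : measure_display) (Omega : measurableType dO)
      (P : probability Omega R)
      (sel : nat -> Omega -> {set 'I_n})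
      (bat : bool -> nat -> forall i : 'I_n, Omega -> 'I_Bz -> Z pb i)
      (x : nat -> Omega -> 'rV[R]_d) (y : nat -> Omega -> 'I_n -> 'rV[R]_m)
      (yt : Omega -> 'I_n -> 'rV[R]_m),
    let psi := fun _ : 'I_n => @half_sqnorm R m in
    alexr_run P psi eta tau 1 Sz T x0 y0 sel bat x y ->
    dual_best_response pb x T yt ->
    ((C / eps ^+ 2)%:E * maxe (Sz%:R^-1)%:E
       (((Bz * Sz)%N%:R^-1)%:E * OmegaY0 P psi yt y0) <= T%:R%:E)%E ->
    (\int[P]_w (objective pb (xbar x T w) - objective pb xstar) <= eps%:E)%E].
Proof.
pose M := dual_radius a Cf; pose gam := inner_lip a b Cg; pose lam := inner_smooth a b Lg.
pose v := var_g a b s0; pose V := var_g' a b M s1 + delta ^+ 2.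
have v0 : 0 <= v by exact: sqr_ge0.
have V0 : 0 <= V by rewrite addr_ge0 ?sqr_ge0.
(* The factors 16, 200, 4 and 48 are those that make the corresponding terms at most [eps / 8]; the
   added 1 keeps the constants positive when the variances or [D] vanish. *)
pose c1 := 16 * V + 1; pose c2 := 200 * v + 1; pose C := 4 * c1 * D ^+ 2 + 48 * c2 + 1.
have c11 : 1 <= c1 by rewrite /c1; lra.
have c21 : 1 <= c2 by rewrite /c2; lra.
have D2 : 0 <= 4 * c1 * D ^+ 2 by rewrite mulr_ge0 ?sqr_ge0//; lra.
have C1 : 1 <= C by rewrite /C; lra.
exists C, c1, c2; split; first by split; lra.
move=> d m n Sz Bz pb N mu x0 xs y0 /andP[Sz0 Szn] Bz0 Nn Nab hdom hin hout hor hsm hmin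
  Xx0 hD Yy0.
have M0 : 0 <= M by exact: dual_radius_ge0.
have lam0 : 0 <= lam by exact: inner_smooth_ge0.
have S1 : 1 <= Sz%:R :> R by rewrite ler1n.
have B1 : 1 <= Bz%:R :> R by rewrite ler1n.
have S0 : 0 < Sz%:R :> R by rewrite ltr0n.
have B0 : 0 < Bz%:R :> R by rewrite ltr0n.
pose H1 := 6 * Sz%:R * (8 * gam ^+ 2 * Bz%:R + M * lam).
pose K := 16 * M ^+ 2 * gam ^+ 2.
pose H2 := 8 * K * Sz%:R ^+ 2.
have K0 : 0 <= K by apply: mulr_ge0 (sqr_ge0 _); apply: mulr_ge0 (sqr_ge0 _).
have H10 : 0 <= H1.
  apply: mulr_ge0; first by rewrite mulr_ge0// ltW.
  apply: addr_ge0 (mulr_ge0 M0 lam0).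
  by apply: mulr_ge0 (ltW B0); apply: mulr_ge0 (sqr_ge0 _).
have H20 : 0 <= H2 by apply: mulr_ge0 (sqr_ge0 _); exact: mulr_ge0.
have H0 : 0 < 1 + H1 + H2 by lra.
(* Below this threshold [eps], [H1 * eps] and [H2 * eps] are all at most 1: [H1] comes from
   absorbing the primal movement, [H2] from the lower-order term. The dependence on the batch sizes
   is confined to the threshold. *)
exists (1 + H1 + H2)^-1; first by rewrite invr_gt0.
move=> eps /andP[e0]; rewrite -[leRHS]mul1r ler_pdivlMr// => he.
have e1 : eps <= 1 by have := mulr_ge0 (ltW e0) H10; have := mulr_ge0 (ltW e0) H20; lra.
have he1 : H1 * eps <= 1 by have := mulr_ge0 (ltW e0) H20; lra.
have he2 : H2 * eps <= 1 by have := mulr_ge0 (ltW e0) H10; lra.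
have eta0 : 0 < c1 / (Sz%:R * eps) by rewrite divr_gt0 ?mulr_gt0//; lra.
have tau0 : 0 < c2 / (Bz%:R * eps) by rewrite divr_gt0 ?mulr_gt0//; lra.
exists (c1 / (Sz%:R * eps)), (c2 / (Bz%:R * eps)); split.
- rewrite eta0 ler_wpM2l ?(le_trans _ c11)// lef_pV2 ?posrE ?mulr_gt0//.
  by rewrite ler_peMl// ltW.
- by rewrite tau0 lexx.
move=> T dO Omega P sel bat x y yt psi arun hyt.
set Om := mean P (fun w => \sum_(i < n) bregman (@half_sqnorm R m) (yt w i) (y0 i)).
have iOm := rintegrable_bregman P y0 a_gt0 Nn Nab hout hyt.
have OmE : OmegaY0 P psi yt y0 = Om%:E by rewrite /OmegaY0 unlock -meanE.
rewrite OmE -EFinM -EFin_max -EFinM lee_fin => hT.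
have Om0 : 0 <= Om.
  apply: mean_ge0 => w; apply: sumr_ge0 => i _.
  by rewrite bregman_half_sqnorm mulr_ge0 ?invr_ge0// dotvv_ge0.
have Ce : 0 <= C / eps ^+ 2 by rewrite divr_ge0 ?sqr_ge0//; lra.
have hT1 : C / (eps ^+ 2 * Sz%:R) <= T%:R.
  rewrite invfM mulrA; apply: le_trans hT; rewrite ler_wpM2l// le_max lexx//.
have hT2 : C * Om / (eps ^+ 2 * (Bz%:R * Sz%:R)) <= T%:R.
  have -> : C * Om / (eps ^+ 2 * (Bz%:R * Sz%:R)) = C / eps ^+ 2 * ((Bz * Sz)%N%:R^-1 * Om).
    by rewrite natrM; field; rewrite !gt_eqF.
  apply: le_trans hT; by rewrite ler_wpM2l// le_max lexx orbT.
have T0 : (0 < T)%N.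
  rewrite -(ltr0n R); apply: lt_le_trans hT1.
  by rewrite divr_gt0 ?mulr_gt0 ?exprn_gt0//; lra.
have absorb := step_size_absorb c11 c21 S1 B1 (sqr_ge0 gam) (mulr_ge0 M0 lam0) e0 e1 he1.
apply: (le_trans (expected_gap Sz0 Szn Bz0 T0 eta0 tau0 a_gt0 Nn Nab hdom hin hout
  hor hsm hmin Xx0 hD Yy0 absorb arun hyt)).
rewrite lee_fin; apply: (@step_size_gap _ c1 c2 C) => //; rewrite ?ltr0n//.
- by rewrite -/v /c2; lra.
- by rewrite -/M -/V /c1; lra.
- by rewrite /C; lra.
- by rewrite /C; lra.
Qed.
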